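(* Let $n\ge 2$, let $\{\Omega_t\}$ be a one-parameter family of domains in $\mathbb{R}^n$ whose boundaries $\Gamma_t=\partial\Omega_t$ are nonsingular real-analytic hypersurfaces with real-analytic dependence on the time $t$, and let $\mathbf{x}_0\in\Omega_t$ be a fixed point (the sink or source). Let $w(\mathbf{x},t)$ be the Schwarz potential of $\Gamma_t$, and let $P(\mathbf{x},t)$ be the pressure function of $\Omega_t$, i.e. for each $t$, $\Delta P=0$ in $\Omega_t\setminus\{\mathbf{x}_0\}$, $P|_{\Gamma_t}=0$, and $P(\mathbf{x},t)\sim -Q\,K(\mathbf{x}-\mathbf{x}_0)$ as $\mathbf{x}\to\mathbf{x}_0$. Then $\{\Omega_t\}$ solves the Laplacian growth problem, i.e. the normal velocity of $\Gamma_t$ is $v_n|_{\Gamma_t}=-\nabla P|_{\Gamma_t}$ for all $t$, if and only if $$\frac{\partial}{\partial t}w(\mathbf{x},t)=-n\,P(\mathbf{x},t).$$ In particular, for a solution of the Laplacian growth problem, the singularities of the Schwarz potential in $\Omega_t$ do not depend on time, except for one stationed at $\mathbf{x}_0$, which does not move but simply changes strength; that is, $\frac{\partial}{\partial t}w(\cdot,t)$, which is a priori defined only near $\Gamma_t$, extends to a harmonic function on $\Omega_t\setminus\{\mathbf{x}_0\}$ (namely $-nP$), with a singularity at $\mathbf{x}_0$ of the form $\sim nQ\,K(\mathbf{x}-\mathbf{x}_0)$.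
   Context: Schwarz potential: for a nonsingular real-analytic hypersurface $\Gamma\subset\mathbb{R}^n$, the Schwarz potential of $\Gamma$ is the unique (by Cauchy-Kovalevskaya) real-analytic solution $w$, in a neighborhood of $\Gamma$, of the Cauchy problem $$\Delta w=0 \text{ near }\Gamma,\qquad w|_\Gamma=\tfrac12\|\mathbf{x}\|^2,\qquad \nabla w|_\Gamma=\mathbf{x}.$$ For a family $\Gamma_t$, $w(\mathbf{x},t)$ denotes the Schwarz potential of $\Gamma_t$ for each $t$. Real-analytic dependence on $t$ means that near each point and time $\Gamma_t$ can be written as $\{\phi(\mathbf{x},t)=0\}$ with $\phi$ jointly real-analytic and $\nabla_{\mathbf{x}}\phi\neq 0$. $v_n$ denotes the normal velocity vector of the moving boundary $\Gamma_t$ (note that $\nabla P$ is normal to $\Gamma_t$ since $P=0$ there). $K$ is the fundamental solution of the Laplace equation in $\mathbb{R}^n$, with sign normalized so that $-\Delta K=\delta_0$. $Q$ is the rate: $Q>0$ corresponds to suction at the sink $\mathbf{x}_0$, and $Q<0$ to injection at a source $\mathbf{x}_0$. The equation $\partial_t w=-nP$ is understood as an identity of real-analytic functions near $\Gamma_t$ (where $P$ extends analytically across $\Gamma_t$), and hence wherever the two sides are analytically continued. *)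

(* Defs.v *)
From HB Require Import structures.
From mathcomp Require Import all_boot all_order all_algebra.
From mathcomp Require Import all_classical all_reals all_analysis.

Set Implicit Arguments.
Unset Strict Implicit.
Unset Printing Implicit Defensive.

Import Order.TTheory GRing.Theory Num.Theory.
Import numFieldNormedType.Exports.

Local Open Scope classical_set_scope.
Local Open Scope ring_scope.

(* The norm that the library puts on 'rV[R]_n is the sup norm; it serves only
   for the topology, and the Euclidean structure is given by [dot], [enorm]. *)

Definition dot (R : realType) (n : nat) (u v : 'rV[R]_n) : R :=
  \sum_(i < n) u 0 i * v 0 i.

Definition enorm (R : realType) (n : nat) (u : 'rV[R]_n) : R :=
  Num.sqrt (dot u u).

Definition boundary (T : topologicalType) (A : set T) : set T :=
  closure A `\` interior A.

Definition domain (R : realType) (n : nat) (A : set 'rV[R]_n) : Prop :=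
  [/\ open A, connected A & A !=set0].

Definition partial (R : realType) (n : nat) (i : 'I_n) (f : 'rV[R]_n -> R) :
    'rV[R]_n -> R :=
  fun x => 'D_(delta_mx 0 i) f x.

Definition grad (R : realType) (n : nat) (f : 'rV[R]_n -> R) (x : 'rV[R]_n) :
    'rV[R]_n :=
  \row_(i < n) partial i f x.

Definition laplacian (R : realType) (n : nat) (f : 'rV[R]_n -> R)
    (x : 'rV[R]_n) : R :=
  \sum_(i < n) partial i (partial i f) x.

(* The derivation operator of the library is total, so that the existence and
   the continuity of the derivatives have to be required separately. *)
Definition C2_on (R : realType) (n : nat) (U : set 'rV[R]_n)
    (f : 'rV[R]_n -> R) : Prop :=
  forall x, U x -> forall i : 'I_n,
    [/\ derivable f x (delta_mx 0 i),
        {for x, continuous (partial i f)} &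
        forall j : 'I_n, derivable (partial i f) x (delta_mx 0 j) /\
          {for x, continuous (partial j (partial i f))}].

Definition harmonic_on (R : realType) (n : nat) (U : set 'rV[R]_n)
    (f : 'rV[R]_n -> R) : Prop :=
  C2_on U f /\ forall x, U x -> laplacian f x = 0.

Definition monomial (R : realType) (n : nat) (alpha : 'I_n -> nat)
    (x : 'rV[R]_n) : R :=
  \prod_(i < n) x 0 i ^+ alpha i.

(* [f] is, on a cube centred at [a], the sum of an absolutely convergent
   multiple power series in [x - a]. The partial sums run over the multi-indices
   all of whose entries are [< N]; by absolute convergence the order of
   summation is immaterial. *)
Definition analytic_at (R : realType) (n : nat) (f : 'rV[R]_n -> R)
    (a : 'rV[R]_n) : Prop :=
  exists (c : ('I_n -> nat) -> R) (r : R), 0 < r /\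
    forall x : 'rV[R]_n, (forall i, `|x 0 i - a 0 i| < r) ->
      let term (N : nat) (alpha : {ffun 'I_n -> 'I_N}) : R :=
        c (fun i => alpha i) * monomial (fun i => alpha i) (x - a) in
      cvgn (fun N : nat => \sum_(alpha : {ffun 'I_n -> 'I_N}) `|term N alpha|)
      /\ (fun N : nat => \sum_(alpha : {ffun 'I_n -> 'I_N}) term N alpha)
           @ \oo --> f x.

(* Joint analyticity in [(x, t)], identifying R^n x R with R^(n+1). *)
Definition jointly_analytic_at (R : realType) (n : nat)
    (phi : 'rV[R]_n -> R -> R) (a : 'rV[R]_n) (t : R) : Prop :=
  analytic_at (fun z : 'rV[R]_(n + 1) => phi (lsubmx z) (rsubmx z 0 0))
              (row_mx a (const_mx t)).

(* At a fixed time this says that each [Gamma t] is a nonsingular real-analytic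
   hypersurface. *)
Definition analytic_hypersurface_family (R : realType) (n : nat) (T : set R)
    (Gamma : R -> set 'rV[R]_n) : Prop :=
  forall t a, T t -> Gamma t a ->
    exists phi : 'rV[R]_n -> R -> R,
      [/\ jointly_analytic_at phi a t,
          grad (phi^~ t) a != 0 &
          \forall z \near (a, t), Gamma z.2 z.1 <-> phi z.1 z.2 = 0].

(* [w] is the Schwarz potential of [Gamma], represented on the neighborhood [U];
   its values outside [U] are irrelevant. *)
Definition schwarz_potential (R : realType) (n : nat)
    (Gamma U : set 'rV[R]_n) (w : 'rV[R]_n -> R) : Prop :=
  [/\ open U /\ Gamma `<=` U,
      forall x, U x -> analytic_at w x,
      forall x, U x -> laplacian w x = 0,
      forall x, Gamma x -> w x = 2^-1 * enorm x ^+ 2 &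
      forall x, Gamma x -> grad w x = x].

(* Area of the unit sphere of R^n, that is 2 pi^(n/2) / Gamma(n/2), computed by
   the recurrence omega_(n+2) = (2 pi / n) omega_n; the value at 0 is junk. *)
Fixpoint sphere_area (R : realType) (n : nat) : R :=
  match n with
  | 0%N => 0
  | 1%N => 2
  | m.+2 => if m == 0%N then 2 * pi else 2 * pi / m%:R * sphere_area R m
  end.

(* The radial solution with - Delta K = delta_0; meant for [2 <= n]. *)
Definition fundamental_solution (R : realType) (n : nat) (x : 'rV[R]_n) : R :=
  if n == 2%N then - ln (enorm x) / (2 * pi)
  else (enorm x ^+ (n - 2))^-1 / ((n - 2)%:R * sphere_area R n).

(* [f ~ c K(. - x0)] at [x0]: the quotient of the two sides tends to 1. *)
Definition singular_like (R : realType) (n : nat) (f : 'rV[R]_n -> R)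
    (x0 : 'rV[R]_n) (c : R) : Prop :=
  (f : 'rV[R]_n -> R^o) ~_(x0^')
    (fun x => c * fundamental_solution (x - x0) : R^o).

Definition pressure (R : realType) (n : nat) (Omega : set 'rV[R]_n)
    (x0 : 'rV[R]_n) (Q : R) (p : 'rV[R]_n -> R) : Prop :=
  [/\ harmonic_on (Omega `\ x0) p,
      {within closure Omega `\ x0, continuous p},
      forall x, boundary Omega x -> p x = 0 &
      singular_like p x0 (- Q)].

Definition tangent_at (R : realType) (n : nat) (S : set 'rV[R]_n)
    (a tau : 'rV[R]_n) : Prop :=
  exists c : R -> 'rV[R]_n,
    [/\ c 0 = a, is_derive (0 : R) (1 : R) c tau & \forall s \near (0 : R), S (c s)].

Definition normal_at (R : realType) (n : nat) (S : set 'rV[R]_n)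
    (a nu : 'rV[R]_n) : Prop :=
  forall tau, tangent_at S a tau -> dot nu tau = 0.

(* [v] is the common normal component of the velocities of all the points that
   move with the hypersurface [Gamma s] and pass through [a] at time [t]. *)
Definition normal_velocity (R : realType) (n : nat)
    (Gamma : R -> set 'rV[R]_n) (t : R) (a v : 'rV[R]_n) : Prop :=
  normal_at (Gamma t) a v /\
  forall (c : R -> 'rV[R]_n) (c' : 'rV[R]_n),
    c t = a -> is_derive t (1 : R) c c' -> (\forall s \near t, Gamma s (c s)) ->
    forall nu, normal_at (Gamma t) a nu -> dot (c' - v) nu = 0.

Definition laplacian_growth (R : realType) (n : nat) (T : set R)
    (Omega : R -> set 'rV[R]_n) (P : 'rV[R]_n -> R -> R) : Prop :=
  forall t a, T t -> boundary (Omega t) a ->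
    normal_velocity (fun s => boundary (Omega s)) t a (- grad (P^~ t) a).

(* Main.v *)
Require Import Defs.
From HB Require Import structures.
From mathcomp Require Import all_boot all_order all_algebra.
From mathcomp Require Import all_classical all_reals all_analysis.
From mathcomp Require Import ring lra.

(** Near a point of the moving boundary, let [phi (x, t) = 0] be an equation of
    it, and write [nu = grad phi] for its gradient in space.

    _The computation._ Assume first that [w] is jointly analytic in space and
    time. Since [w = |x|^2 / 2] and [grad w = x] on the moving boundary, the
    space-time gradient of [w - |x|^2 / 2] vanishes there; in particular
    [dw/dt = 0] on the boundary. Likewise each component of [x - grad w]
    vanishes there, so its space-time gradient is parallel to that of [phi].
    As the Hessian of [w] is symmetric and has trace [0], the parallelism
    factors are determined, and
    [|nu|^2 grad (dw/dt) = - n (d phi / dt) nu] ([chart_mixed]). On the other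
    hand the normal velocity [v] is characterised by
    [|nu|^2 v = - (d phi / dt) nu] ([normal_velocityE]). Hence [v = - grad P] on
    the boundary if and only if [grad (dw/dt) = - n grad P] there. Both [dw/dt]
    and [- n P] are harmonic near the boundary (for [P] this crosses the boundary
    by the identity theorem, [harmonic_across_boundary]) and vanish on it, so by
    uniqueness for the Cauchy problem this holds if and only if
    [dw/dt = - n P] near the boundary. The statement about singularities
    follows, because [- n P] is harmonic in the domain minus [x0].

    _Regularity in time._ The potential is only given as an analytic function of
    [x] for each [t]; that it is differentiable in [t] at all has to be proved.
    The Cauchy problem for the Laplacian in [x] with data on the hypersurface
    [phi = 0] of space-time is not characteristic, since [nu] is not zero, and
    [cauchy_kovalevskaya_laplace] provides a jointly analytic solution. At each
    time near [t] it has the Cauchy data of [w], so that it coincides with [w] on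
    a fixed neighborhood ([cauchy_uniqueness], [local_chart_exists]).

    _Analytic functions._ They are handled through the family of their iterated
    partial derivatives, called a jet, and the Cauchy estimates
    [|d^l f| <= C A^|l| |l|!]. Convergent power series satisfy such estimates
    ([analytic_at_bjet]); conversely the estimates imply the identity theorem
    ([ajet_identity]). The solution of the Cauchy problem is
    [sum_k phi^k / k! * V_k] with coefficients [V_k] given by a recursion, and
    its convergence rests on one estimate for products, [jetmul_bound]. *)

Set Implicit Arguments.
Unset Strict Implicit.
Unset Printing Implicit Defensive.

Import Order.TTheory GRing.Theory Num.Theory.
Import numFieldNormedType.Exports.

Local Open Scope classical_set_scope.
Local Open Scope ring_scope.

(** * One-variable calculus and cubes *)

Lemma ler_of_eq (R : numDomainType) (x y : R) : x = y -> x <= y.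
Proof. by move=> ->. Qed.

Lemma is_derive_epsP (R : realType) (V W : normedModType R) (f : V -> W)
    (x v : V) (d : W) :
  is_derive x v f d <->
  (forall e : R, 0 < e -> exists2 r : R, 0 < r & forall h : R, `|h| < r ->
     `|f (h *: v + x) - f x - h *: d| <= e * `|h|).
Proof.
split=> [[/cvg_ex [l fl] fd] e e0|H].
  have ld : l = d by rewrite -fd /derive; apply/esym/cvg_lim.
  move: fl; rewrite {}ld => /cvgrPdist_le /(_ e e0) [r /= r0 Hr].
  exists r => // h hr; have [->|h0] := eqVneq h 0.
    by rewrite !scale0r add0r subrr subr0 !normr0 mulr0.
  have := Hr h; rewrite /ball_/= sub0r normrN => /(_ hr h0).
  rewrite distrC => hle.
  have -> : f (h *: v + x) - f x - h *: d
     = h *: (h^-1 *: (f (h *: v + x) - f x) - d).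
    by rewrite scalerBr scalerA divff// scale1r.
  by rewrite normrZ mulrC ler_wpM2r.
have fl : (fun h => h^-1 *: ((f \o shift x) (h *: v) - f x)) @ 0^' --> d.
  apply/cvgrPdist_le => e /H [r r0 Hr]; exists r => //= h; rewrite /ball_/=.
  rewrite sub0r normrN => /Hr hle h0.
  have -> : d - h^-1 *: (f (h *: v + x) - f x)
     = - (h^-1 *: (f (h *: v + x) - f x - h *: d)).
    by rewrite [in RHS]scalerBr scalerA mulVf// scale1r opprB.
  by rewrite normrN normrZ normfV ler_pdivrMl ?normr_gt0// mulrC.
by split; [apply/cvg_ex; exists d|apply/cvg_lim].
Qed.

Lemma is_derive_line (R : realType) (V W : normedModType R) (f : V -> W)
    (x v : V) (s : R) (d : W) :
  is_derive (s *: v + x) v f d ->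
  is_derive s (1 : R) (fun s => f (s *: v + x)) d.
Proof.
move=> /is_derive_epsP H; apply/is_derive_epsP => e /H [r r0 Hr].
exists r => // h /Hr; rewrite addrA -scalerDl.
by have -> : h *: (1 : R) + s = h + s by rewrite /GRing.scale/= mulr1.
Qed.

Lemma is_derive_unline (R : realType) (V W : normedModType R) (f : V -> W)
    (x v : V) (d : W) :
  is_derive 0 (1 : R) (fun s => f (s *: v + x)) d -> is_derive x v f d.
Proof.
move=> /is_derive_epsP H; apply/is_derive_epsP => e /H [r r0 Hr].
exists r => // h /Hr.
by rewrite addr0 scale0r add0r /GRing.scale/= mulr1.
Qed.

Lemma is_derive1_continuous (R : realType) (W : normedModType R)
    (f : R -> W) (x : R) (d : W) :
  is_derive x (1 : R) f d -> {for x, continuous f}.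
Proof.
by case=> /derivable1_diffP df _; exact: differentiable_continuous.
Qed.

Lemma is_derive_bigsum (R : realType) (V : normedModType R) (I : Type) (s : seq I)
    (f : I -> V -> R) (df : I -> R) (x v : V) :
  (forall i, is_derive x v (f i) (df i)) ->
  is_derive x v (fun y => \sum_(i <- s) f i y) (\sum_(i <- s) df i).
Proof.
move=> D; elim: s => [|i s IH].
  by rewrite big_nil; under eq_fun do rewrite big_nil; exact: is_derive_cst.
rewrite big_cons; under eq_fun do rewrite big_cons.
exact: is_deriveD (D i) IH.
Qed.

Lemma is_derive_affine (R : realType) (V : normedModType R) (v x : V) (t : R) :
  is_derive t (1 : R) (fun s : R => s *: v + x) v.
Proof.
apply/is_derive_epsP => e e0; exists 1 => // h _.
have -> : h *: (1 : R) = h by rewrite /GRing.scale/= mulr1.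
have -> : (h + t) *: v + x - (t *: v + x) - h *: v = 0.
  by rewrite scalerDl -[_ + _ + x]addrA addrK subrr.
by rewrite normr0 mulr_ge0// ltW.
Qed.

Lemma mvt_itv (R : realType) (f df : R -> R) (a b : R) : a <= b ->
  (forall s, a <= s <= b -> is_derive s (1 : R) f (df s)) ->
  exists2 c, a <= c <= b & f b - f a = df c * (b - a).
Proof.
move=> ab D; have [||c cab E] := @MVT_segment R f df a b ab.
- by move=> x; rewrite in_itv/= => /andP[ax xb]; apply: D; rewrite (ltW ax) ltW.
- apply: continuous_in_subspaceT => x /[!inE]/=; rewrite in_itv/= => axb.
  exact/is_derive1_continuous/D.
- by exists c => //; rewrite in_itv/= in cab.
Qed.

Lemma mvt0 (R : realType) (f df : R -> R) (h : R) :
  (forall s, `|s| <= `|h| -> is_derive s (1 : R) f (df s)) ->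
  exists2 c, `|c| <= `|h| & f h - f 0 = df c * h.
Proof.
move=> D; have [h0|h0] := leP 0 h.
  have [s /andP[s0 sh]|c /andP[c0 ch] E] := mvt_itv (f := f) (df := df) h0.
    by apply: D; rewrite !ger0_norm.
  by exists c; [rewrite !ger0_norm|rewrite E subr0].
have [s /andP[hs s0]|c /andP[hc c0] E] := mvt_itv (f := f) (df := df) (ltW h0).
  by apply: D; rewrite (ler0_norm s0) (ltr0_norm h0) lerN2.
exists c; first by rewrite (ler0_norm c0) (ltr0_norm h0) lerN2.
by rewrite -opprB E sub0r mulrN opprK.
Qed.

(** Only a bound on the second derivative enters, so that the estimate survives
    pointwise limits of functions with uniformly bounded second derivatives. *)
Lemma taylor2_le (R : realType) (f df ddf : R -> R) (K h : R) :
  (forall s, `|s| <= `|h| -> is_derive s (1 : R) f (df s)) ->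
  (forall s, `|s| <= `|h| -> is_derive s (1 : R) df (ddf s)) ->
  (forall s, `|s| <= `|h| -> `|ddf s| <= K) ->
  `|f h - f 0 - h * df 0| <= K * h ^+ 2.
Proof.
move=> D D2 B; have [c cP ->] := mvt0 D.
have [c' c'P E] : exists2 c', `|c'| <= `|c| & df c - df 0 = ddf c' * c.
  by apply: mvt0 => s sc; apply: D2; exact: le_trans cP.
rewrite (mulrC h) -mulrBl E !normrM -(ger0_norm (sqr_ge0 h)) normrX expr2.
rewrite mulrA ler_wpM2r// ler_pM//.
by apply: B; exact: le_trans cP.
Qed.

(** The balls of the sup norm, spelled out in coordinates because the estimates
    below move along one coordinate axis at a time. *)
Definition cube (R : realType) (m : nat) (x : 'rV[R]_m) (r : R) : set 'rV[R]_m :=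
  [set y | forall i, `|y 0 i - x 0 i| < r].

Section Cube.
Variables (R : realType) (m : nat).
Implicit Types (x y : 'rV[R]_m) (r : R).

Lemma cube_center x r : 0 < r -> cube x r x.
Proof. by move=> r0 i; rewrite subrr normr0. Qed.

Lemma cube_sub x r r' : r <= r' -> cube x r `<=` cube x r'.
Proof. by move=> rr y xy i; exact: lt_le_trans rr. Qed.

Lemma cube_convex x r y z (s : R) : 0 <= s <= 1 -> cube x r y -> cube x r z ->
  cube x r (s *: (z - y) + y).
Proof.
move=> /andP[s0 s1] xy xz i; rewrite !mxE.
have -> : s * (z 0 i - y 0 i) + y 0 i - x 0 i =
  s * (z 0 i - x 0 i) + (1 - s) * (y 0 i - x 0 i) by ring.
rewrite (le_lt_trans (ler_normD _ _))// !normrM (ger0_norm s0).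
rewrite (ger0_norm (_ : 0 <= 1 - s)) ?subr_ge0//.
move: (xy i) (xz i); set u := `|y 0 i - _|; set v := `|z 0 i - _| => ur vr.
have [->|sn0] := eqVneq s 0; first by rewrite mul0r add0r subr0 mul1r.
have : s * v < s * r by rewrite ltr_pM2l// lt_def sn0.
have : (1 - s) * u <= (1 - s) * r by rewrite ler_wpM2l ?subr_ge0// ltW.
lra.
Qed.

Lemma cube_nbhs x r : 0 < r -> nbhs x (cube x r).
Proof.
move=> r0; apply/nbhs_ballP; exists r => //= y; rewrite /ball/= => -[_ xy] i.
by have := xy 0 i; rewrite -ball_normE/= /ball_/= distrC.
Qed.

Lemma nbhs_cube x (A : set 'rV[R]_m) : nbhs x A ->
  exists2 r, 0 < r & cube x r `<=` A.
Proof.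
move=> /nbhs_ballP[r /= r0 rA]; exists r => // y xy; apply: rA.
split=> // i j; rewrite -ball_normE/= /ball_/= distrC ord1; exact: xy.
Qed.

Lemma open_cube x r : open (cube x r).
Proof.
rewrite openE => y xy.
pose d := \big[Num.min/1]_i (r - `|y 0 i - x 0 i|).
have d0 : 0 < d.
  by apply/bigmin_gtP; split=> [|i _]; rewrite ?ltr01// subr_gt0.
apply: filterS (cube_nbhs y d0) => z yz i.
have := yz i; have : d <= r - `|y 0 i - x 0 i| by exact: bigmin_le.
have : `|z 0 i - x 0 i| <= `|z 0 i - y 0 i| + `|y 0 i - x 0 i|.
  by rewrite (le_trans _ (ler_normD _ _))// addrA subrK.
lra.
Qed.
End Cube.

(** * Jets *)

Section Increments.
Variables (R : realType) (m : nat).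
Implicit Types (x y z : 'rV[R]_m) (r : R).

Definition l1dist x y : R := \sum_i `|y 0 i - x 0 i|.

Lemma l1dist_ge0 x y : 0 <= l1dist x y.
Proof. by apply: sumr_ge0 => i _; exact: normr_ge0. Qed.

(** The vertices of a path from [x] to [y] along the coordinate axes: the
    increments of a function on it only involve its partial derivatives. *)
Definition staircase x y (k : nat) : 'rV[R]_m :=
  \row_i (if (i < k)%N then y 0 i else x 0 i).

Lemma staircaseS x y (k : 'I_m) :
  staircase x y k.+1 =
  (y 0 k - x 0 k) *: delta_mx 0 k + staircase x y k.
Proof.
apply/rowP => i; rewrite !mxE eqxx/= ltnS leq_eqVlt -val_eqE/=.
case: ltngtP => [ik|ik|/val_inj ->]; rewrite ?mulr0 ?add0r// ?mulr1.
by rewrite subrK.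
Qed.

Lemma staircase_increment (G : 'rV[R]_m -> R) x y :
  G y - G x = \sum_(k < m) (G (staircase x y k.+1) - G (staircase x y k)).
Proof.
rewrite -(big_mkord xpredT
  (fun k => G (staircase x y k.+1) - G (staircase x y k))) telescope_sumr//.
by congr (G _ - G _); apply/rowP => i; rewrite !mxE ?ltn_ord// ltn0.
Qed.

Lemma staircase_near x y r (k : 'I_m) (s : R) : cube x r y ->
  `|s| <= `|y 0 k - x 0 k| ->
  cube x r (s *: delta_mx 0 k + staircase x y k) /\
  l1dist x (s *: delta_mx 0 k + staircase x y k) <= l1dist x y.
Proof.
move=> xy sk; have H (i : 'I_m) :
    `|(s *: delta_mx 0 k + staircase x y k) 0 i - x 0 i| <= `|y 0 i - x 0 i|.
  rewrite !mxE eqxx/= -val_eqE/=.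
  case: ltngtP => [ik|ik|/val_inj ->].
  - by rewrite mulr0 add0r.
  - by rewrite mulr0 add0r subrr normr0.
  - by rewrite mulr1 addrK.
split; first by move=> i; exact: le_lt_trans (xy i).
exact: ler_sum.
Qed.

Variables (G : 'rV[R]_m -> R) (g : 'I_m -> 'rV[R]_m -> R) (x : 'rV[R]_m) (r : R).
Hypothesis Gg : forall i z, cube x r z -> is_derive z (delta_mx 0 i) G (g i z).

Lemma staircase_mvt y (k : 'I_m) : cube x r y ->
  exists2 z, cube x r z /\ l1dist x z <= l1dist x y &
    G (staircase x y k.+1) - G (staircase x y k) = g k z * (y 0 k - x 0 k).
Proof.
move=> xy; pose p s := s *: delta_mx 0 k + staircase x y k.
have [s Hs|c cP] := @mvt0 R (G \o p) (g k \o p) (y 0 k - x 0 k).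
  by apply: (@is_derive_line _ _ _ G); apply: Gg; exact: (staircase_near xy Hs).1.
rewrite /p/= -staircaseS scale0r add0r => E; exists (p c); rewrite // /p.
exact: staircase_near.
Qed.

Lemma partials_lipschitz (K : R) y :
  (forall i z, cube x r z -> `|g i z| <= K) -> cube x r y ->
  `|G y - G x| <= K * l1dist x y.
Proof.
move=> gK xy; rewrite staircase_increment (le_trans (ler_norm_sum _ _ _))//.
rewrite mulr_sumr ler_sum// => k _.
have [z [xz _] ->] := staircase_mvt k xy.
by rewrite normrM ler_wpM2r//; exact: gK.
Qed.
End Increments.

(** Bounded second partial derivatives make a function differentiable in the
    strong sense, with a quadratic remainder. *)
Lemma partials_quadratic (R : realType) (m : nat) (G : 'rV[R]_m -> R)
  (g : 'I_m -> 'rV[R]_m -> R) (h : 'I_m -> 'I_m -> 'rV[R]_m -> R)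
  (x y : 'rV[R]_m) (r K : R) :
  (forall i z, cube x r z -> is_derive z (delta_mx 0 i) G (g i z)) ->
  (forall i j z, cube x r z -> is_derive z (delta_mx 0 j) (g i) (h i j z)) ->
  (forall i j z, cube x r z -> `|h i j z| <= K) ->
  cube x r y ->
  `|G y - G x - \sum_i g i x * (y 0 i - x 0 i)| <= K * l1dist x y ^+ 2.
Proof.
move=> Gg gh hK xy; rewrite (staircase_increment G) -sumrB.
rewrite (le_trans (ler_norm_sum _ _ _))// expr2 mulrA {2}/l1dist mulr_sumr.
apply: ler_sum => k _; have [z [xz zy] ->] := staircase_mvt Gg k xy.
rewrite -mulrBl normrM ler_wpM2r//.
rewrite (le_trans (@partials_lipschitz _ _ _ _ _ _ (gh k) K _ (hK k) xz))//.
by rewrite ler_wpM2l// (le_trans _ (hK k k z xz)).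
Qed.

Section Jets.
Variables (R : realType) (m : nat).
Implicit Types (F G : seq 'I_m -> 'rV[R]_m -> R) (U : set 'rV[R]_m).

(** The family of all iterated partial derivatives of a smooth function. The
    derivatives are part of the data, so that sums, products and limits of jets
    come with explicit derivatives; [l] lists the successive differentiations,
    the first one coming first. *)
Definition jet U F : Prop := forall l i x, U x ->
  is_derive x (delta_mx 0 i) (F l) (F (rcons l i) x).

(** Cauchy estimates. A smooth function is real-analytic if and only if it
    satisfies them locally, and they are easier to carry through products,
    limits and recursions than power series expansions. *)
Definition cauchy_bound U (C A : R) F : Prop := forall l x, U x ->
  `|F l x| <= C * A ^+ size l * (size l)`!%:R.

(** The jets of real-analytic functions. *)
Definition ajet U F : Prop := jet U F /\
  forall x, U x -> exists r C A,
    [/\ 0 < r, cube x r `<=` U & cauchy_bound (cube x r) C A F].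

(** Prepending [i] differentiates along [i] before anything else. *)
Definition djet (i : 'I_m) F := fun l => F (i :: l).

Lemma jet_sub U V F : V `<=` U -> jet U F -> jet V F.
Proof. by move=> VU H l i x /VU; exact: H. Qed.

Lemma cauchy_bound_sub U V C A F : V `<=` U -> cauchy_bound U C A F ->
  cauchy_bound V C A F.
Proof. by move=> VU H l x /VU; exact: H. Qed.

Lemma jet_djet U F i : jet U F -> jet U (djet i F).
Proof. by move=> H l j x; exact: H. Qed.

Lemma cauchy_bound_ge0 U C A F x : cauchy_bound U C A F -> U x -> 0 <= C.
Proof. by move=> H /(H [::] x); rewrite expr0 !mulr1; exact: le_trans. Qed.

Lemma cauchy_bound_le U C A C' A' F : 0 <= C -> C <= C' -> 0 <= A -> A <= A' ->
  cauchy_bound U C A F -> cauchy_bound U C' A' F.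
Proof.
move=> C0 CC A0 AA H l x /H/le_trans; apply.
rewrite ler_wpM2r// ler_pM// ?exprn_ge0// lerXn2r// ?nnegrE//.
exact: le_trans AA.
Qed.

Lemma cauchy_bound_djet U C A F i : 0 <= C -> 0 <= A -> cauchy_bound U C A F ->
  cauchy_bound U (C * A) (2 * A) (djet i F).
Proof.
move=> C0 A0 H l x /(H (i :: l)) /le_trans; apply => /=.
rewrite factS natrM exprMn exprS.
have -> : C * (A * A ^+ size l) * ((size l).+1%:R * (size l)`!%:R) =
  C * A * A ^+ size l * (size l)`!%:R * (size l).+1%:R by ring.
have -> : C * A * (2 ^+ size l * A ^+ size l) * (size l)`!%:R =
  C * A * A ^+ size l * (size l)`!%:R * 2 ^+ size l by ring.
rewrite ler_wpM2l ?mulr_ge0 ?exprn_ge0//.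
by rewrite -natrX ler_nat ltn_expl.
Qed.

Lemma cauchy_bound_norm U C A F : cauchy_bound U C A F ->
  cauchy_bound U C `|A| F.
Proof.
move=> H l x Ux; have C0 := cauchy_bound_ge0 H Ux.
apply: (le_trans (H l x Ux)); rewrite ler_wpM2r// ler_wpM2l//.
by rewrite -normrX ler_norm.
Qed.

Lemma ajet_djet U F i : ajet U F -> ajet U (djet i F).
Proof.
case=> jF bF; split; first exact: jet_djet.
move=> x /bF[r [C [A [r0 rU H]]]]; exists r, (C * `|A|), (2 * `|A|).
split => //; apply: cauchy_bound_djet => //.
  exact: cauchy_bound_ge0 H (cube_center x r0).
exact: cauchy_bound_norm.
Qed.

Lemma ajet_sub U V F : open V -> V `<=` U -> ajet U F -> ajet V F.
Proof.
move=> oV VU [jF bF]; split; first exact: jet_sub jF.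
move=> x Vx; have [r [C [A [r0 rU H]]]] := bF x (VU x Vx).
have [s s0 sV] : exists2 s, 0 < s & cube x s `<=` V.
  by apply: nbhs_cube; exact: open_nbhs_nbhs.
exists (Num.min r s), C, A; split; first by rewrite lt_min r0.
  by apply: subset_trans sV; apply: cube_sub; rewrite ge_min lexx orbT.
by apply: cauchy_bound_sub H; apply: cube_sub; rewrite ge_min lexx.
Qed.

Lemma bounded_jet_ajet U C A F : open U -> jet U F -> cauchy_bound U C A F ->
  ajet U F.
Proof.
move=> oU jF bF; split=> // x Ux.
have [s s0 sV] : exists2 s, 0 < s & cube x s `<=` U.
  by apply: nbhs_cube; exact: open_nbhs_nbhs.
by exists s, C, A; split=> //; apply: cauchy_bound_sub bF.
Qed.

Lemma ajet_lin U (a b : R) F G : open U -> ajet U F -> ajet U G ->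
  ajet U (fun l x => a * F l x + b * G l x).
Proof.
move=> oU [jF bF] [jG bG]; split=> [l i x Ux|x Ux].
  apply: is_deriveD => //.
  - exact: is_deriveZ (jF l i x Ux).
  - exact: is_deriveZ (jG l i x Ux).
have [r [C [A [r0 rU H]]]] := bF x Ux.
have [s [D [B [s0 sU K]]]] := bG x Ux.
have C0 := cauchy_bound_ge0 H (cube_center x r0).
have D0 := cauchy_bound_ge0 K (cube_center x s0).
exists (Num.min r s), (`|a| * C + `|b| * D), (`|A| + `|B|).
have rr : cube x (Num.min r s) `<=` cube x r.
  by apply: cube_sub; rewrite ge_min lexx.
have ss : cube x (Num.min r s) `<=` cube x s.
  by apply: cube_sub; rewrite ge_min lexx orbT.
split; [by rewrite lt_min r0|exact: subset_trans rU|move=> l y xy].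
have {}H := cauchy_bound_le C0 (lexx _) (normr_ge0 _)
  (_ : `|A| <= `|A| + `|B|) (cauchy_bound_norm H).
have {}K := cauchy_bound_le D0 (lexx _) (normr_ge0 _)
  (_ : `|B| <= `|A| + `|B|) (cauchy_bound_norm K).
rewrite (le_trans (ler_normD _ _))// !normrM !mulrDl lerD// -!mulrA.
  by rewrite ler_wpM2l// mulrA H ?lerDl//; exact: rr.
by rewrite ler_wpM2l// mulrA K ?lerDr//; exact: ss.
Qed.

Lemma ajet_bound U F k x : ajet U F -> U x -> exists r K,
  [/\ 0 < r, cube x r `<=` U & forall l y, (size l <= k)%N ->
      cube x r y -> `|F l y| <= K].
Proof.
move=> [jF bF] Ux; have [r [C [A [r0 rU H]]]] := bF x Ux.
have C0 := cauchy_bound_ge0 H (cube_center x r0).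
exists r, (C * (1 + `|A|) ^+ k * (k)`!%:R); split=> //.
move=> l y sl xy; apply: (le_trans (H l y xy)).
rewrite -!mulrA ler_wpM2l//.
have A1 : 1 <= 1 + `|A| by rewrite lerDl.
apply: (@le_trans _ _ ((1 + `|A|) ^+ size l * (size l)`!%:R)).
  rewrite ler_wpM2r// (le_trans (ler_norm _))// normrX.
  by rewrite lerXn2r ?nnegrE ?addr_ge0// lerDr.
apply: ler_pM => //; last by rewrite ler_nat leq_fact.
by rewrite ler_weXn2l.
Qed.

Lemma ajet_quadratic U F l x : ajet U F -> U x -> exists r K,
  [/\ 0 < r, 0 <= K, cube x r `<=` U & forall y, cube x r y ->
   `|F l y - F l x - \sum_i F (rcons l i) x * (y 0 i - x 0 i)|
     <= K * l1dist x y ^+ 2].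
Proof.
move=> aF Ux; have [r [K [r0 rU H]]] := ajet_bound (size l).+2 aF Ux.
exists r, K; split=> //.
  by apply: le_trans (H [::] x _ (cube_center x r0)).
move=> y xy.
apply: (@partials_quadratic _ _ (F l) (fun i => F (rcons l i))
  (fun i j => F (rcons (rcons l i) j)) x y r) => //.
- by move=> i z xz; apply: aF.1; exact: rU.
- by move=> i j z xz; apply: aF.1; exact: rU.
- by move=> i j z xz; apply: H; rewrite // !size_rcons.
Qed.

Lemma row_norm_coord (M : 'rV[R]_m) i : `|M 0 i| <= `|M|.
Proof.
rewrite [leRHS]/Num.Def.normr/= mx_normrE.
exact: (@le_bigmax _ R _ _ (fun ij : 'I_1 * 'I_m => `|M ij.1 ij.2|) (0, i)).
Qed.

Lemma ajet_chain U F l (gam : R -> 'rV[R]_m) (v : 'rV[R]_m) (t : R) :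
  ajet U F -> U (gam t) -> is_derive t (1 : R) gam v ->
  is_derive t (1 : R) (fun s => F l (gam s))
    (\sum_i F (rcons l i) (gam t) * v 0 i).
Proof.
move=> aF Ut dgam; have [r [K [r0 K0 rU Q]]] := ajet_quadratic l aF Ut.
apply/is_derive_epsP => e e0.
pose S := \sum_i `|F (rcons l i) (gam t)|.
pose B := \sum_i (`|v 0 i| + 1).
have S0 : 0 <= S by apply: sumr_ge0.
have B0 : 0 <= B by apply: sumr_ge0 => i _; rewrite addr_ge0.
have KB0 : 0 <= K * B ^+ 2 by rewrite mulr_ge0// sqr_ge0.
pose e1 := Num.min 1 (e / 2 / (S + 1)).
have e10 : 0 < e1 by rewrite lt_min ltr01/= !divr_gt0// ltr_wpDl.
move/is_derive_epsP : dgam => /(_ e1 e10)[r1 r10 H1].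
pose r2 := Num.min r1 (Num.min (r / (B + 1)) (e / 2 / (K * B ^+ 2 + 1))).
exists r2.
  by rewrite !lt_min r10/= !divr_gt0// ltr_wpDl.
move=> h; rewrite !lt_min => /andP[/H1 h1 /andP[hr he]].
set y := gam (h *: 1 + t) in h1 *.
have co i : `|y 0 i - gam t 0 i - h * v 0 i| <= e1 * `|h|.
  apply: le_trans h1; apply: le_trans (row_norm_coord _ i).
  by rewrite !mxE.
have co1 i : `|y 0 i - gam t 0 i| <= (`|v 0 i| + 1) * `|h|.
  have -> : y 0 i - gam t 0 i = (y 0 i - gam t 0 i - h * v 0 i) + h * v 0 i.
    by rewrite subrK.
  apply: (le_trans (ler_normD _ _)); rewrite addrC mulrDl; apply: lerD.
    by rewrite normrM mulrC.
  by apply: (le_trans (co i)); rewrite ler_wpM2r// ge_min lexx.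
have ly : l1dist (gam t) y <= B * `|h|.
  by rewrite mulr_suml; apply: ler_sum => i _; exact: co1.
have xy : cube (gam t) r y.
  move=> i; apply: (le_lt_trans (co1 i)).
  have : `|v 0 i| + 1 <= B.
    by rewrite /B (bigD1 i)//= lerDl sumr_ge0// => j _; rewrite addr_ge0.
  move=> /ler_wpM2r => /(_ _ (normr_ge0 h)) /le_lt_trans; apply.
  move: hr; rewrite ltr_pdivlMr ?ltr_wpDl//; apply: le_lt_trans.
  by rewrite mulrC ler_wpM2l// lerDl.
have := Q y xy; set D := \sum_i F _ _ * (y 0 i - _) => QD.
have -> : F l y - F l (gam t) - h *: (\sum_i F (rcons l i) (gam t) * v 0 i)
  = (F l y - F l (gam t) - D) +
    \sum_i F (rcons l i) (gam t) * (y 0 i - gam t 0 i - h * v 0 i).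
  have -> : \sum_i F (rcons l i) (gam t) * (y 0 i - gam t 0 i - h * v 0 i)
    = D - h * (\sum_i F (rcons l i) (gam t) * v 0 i).
    rewrite mulr_sumr -sumrB; apply: eq_bigr => i _; ring.
  by rewrite addrA subrK.
rewrite (le_trans (ler_normD _ _))// (splitr e) mulrDl lerD//.
  apply: (le_trans QD).
  have l2 : l1dist (gam t) y ^+ 2 <= (B * `|h|) ^+ 2.
    by rewrite lerXn2r// nnegrE ?l1dist_ge0// mulr_ge0.
  apply: (le_trans (ler_wpM2l K0 l2)).
  rewrite exprMn mulrA expr2 mulrA ler_wpM2r//.
  move: he; rewrite ltr_pdivlMr ?ltr_wpDl// => /ltW; apply: le_trans.
  by rewrite mulrC ler_wpM2l// lerDl.
rewrite (le_trans (ler_norm_sum _ _ _))//.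
apply: (@le_trans _ _ (S * (e1 * `|h|))).
  by rewrite mulr_suml ler_sum// => i _; rewrite normrM ler_wpM2l.
rewrite mulrA ler_wpM2r//.
have : e1 <= e / 2 / (S + 1) by rewrite ge_min lexx orbT.
rewrite ler_pdivlMr ?ltr_wpDl//; apply: le_trans.
by rewrite mulrC ler_wpM2l ?(ltW e10)// lerDl.
Qed.
End Jets.

(** * Limits, series and products of jets *)

(** Derivatives pass to a pointwise limit as soon as the derivatives of each
    order are bounded uniformly in [N]: the second-order Taylor estimates have
    a common constant, hence hold in the limit. *)
Lemma jet_limit (R : realType) (m : nat) (U : set 'rV[R]_m)
    (F : nat -> seq 'I_m -> 'rV[R]_m -> R) (G : seq 'I_m -> 'rV[R]_m -> R)
    (B : seq 'I_m -> R) :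
  open U -> (forall N, jet U (F N)) ->
  (forall N l x, U x -> `|F N l x| <= B l) ->
  (forall l x, U x -> (fun N => F N l x) @ \oo --> G l x) ->
  jet U G.
Proof.
move=> oU jF FB FG l i x Ux.
have [r r0 rU] : exists2 r, 0 < r & cube x r `<=` U.
  by apply: nbhs_cube; exact: open_nbhs_nbhs.
pose K := B (rcons (rcons l i) i).
have K0 : 0 <= K by exact: le_trans (FB 0%N _ x Ux).
have inU (s : R) : `|s| < r -> U (s *: delta_mx 0 i + x).
  move=> sr; apply: rU => j; rewrite !mxE addrK eqxx/=.
  by case: eqP => _; rewrite ?mulr1// mulr0 normr0 (le_lt_trans _ sr).
apply/is_derive_epsP => e e0.
exists (Num.min r (e / (K + 1))).
  by rewrite lt_min r0/= divr_gt0// ltr_wpDl.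
move=> h; rewrite lt_min => /andP[hr he].
apply: (@le_trans _ _ (K * h ^+ 2)); last first.
  rewrite -real_normK ?num_real// expr2 mulrA ler_wpM2r//.
  move: he; rewrite ltr_pdivlMr ?ltr_wpDl// => /ltW; apply: le_trans.
  by rewrite mulrC ler_wpM2l// lerDl.
pose y := h *: delta_mx 0 i + x.
have Uy : U y by exact: inU.
have cv : (fun N => `|F N l y - F N l x - h * F N (rcons l i) x|) @ \oo -->
    `|G l y - G l x - h * G (rcons l i) x|.
  apply: (@cvg_norm _ R); apply: cvgB; first by apply: cvgB; exact: FG.
  by apply: cvgM; [exact: cvg_cst|exact: FG].
rewrite -(cvg_lim _ cv)//; apply: limr_le; first by apply/cvg_ex; eexists; exact: cv.
near=> N; rewrite /y.
have T := @taylor2_le R (fun s => F N l (s *: delta_mx 0 i + x))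
  (fun s => F N (rcons l i) (s *: delta_mx 0 i + x))
  (fun s => F N (rcons (rcons l i) i) (s *: delta_mx 0 i + x)) K h.
rewrite scale0r add0r in T; apply: T => s sh.
- by apply: (@is_derive_line _ _ _ (F N l)); apply: jF; apply: inU; exact: le_lt_trans hr.
- apply: (@is_derive_line _ _ _ (F N (rcons l i))); apply: jF; apply: inU.
  exact: le_lt_trans hr.
- by apply: FB; apply: inU; exact: le_lt_trans hr.
Unshelve. all: by end_near. Qed.

Section JetSeries.
Variables (R : realType) (m : nat) (U : set 'rV[R]_m).
Variables (p : nat -> seq 'I_m -> 'rV[R]_m -> R) (C A : R).
Hypotheses (oU : open U) (jp : forall k, jet U (p k)).
Hypothesis bp : forall k, cauchy_bound U (C * 2^-1 ^+ k) A (p k).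

Definition jet_series l x : R := limn (fun N => \sum_(0 <= k < N) p k l x).

Let half_sum N : \sum_(0 <= k < N) (2^-1 : R) ^+ k <= 2.
Proof.
have -> : \sum_(0 <= k < N) (2^-1 : R) ^+ k = 2 * (1 - 2^-1 ^+ N).
  elim: N => [|N IH]; first by rewrite big_geq// expr0 subrr mulr0.
  by rewrite big_nat_recr//= IH exprS; field.
by rewrite -[leRHS]mulr1 ler_wpM2l// gerBl exprn_ge0.
Qed.

Lemma jet_series_cvg l x : U x ->
  (fun N => \sum_(0 <= k < N) p k l x) @ \oo --> jet_series l x.
Proof.
move=> Ux; apply: normed_cvg.
pose D := C * A ^+ size l * (size l)`!%:R.
have pD k : `|p k l x| <= D * 2^-1 ^+ k.
  by apply: (le_trans (@bp k l x Ux)); rewrite /D; apply/ler_of_eq; ring.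
apply: (@series_le_cvg _ _ (geometric D 2^-1)).
- by move=> k; exact: normr_ge0.
- by move=> k; exact: le_trans (normr_ge0 _) (pD k).
- exact: pD.
- by apply: is_cvg_geometric_series; rewrite ger0_norm// invf_lt1// ltr1n.
Qed.

Lemma jet_series_partial_bound N :
  cauchy_bound U (2 * C) A (fun l x => \sum_(0 <= k < N) p k l x).
Proof.
move=> l x Ux; rewrite (le_trans (ler_norm_sum _ _ _))//.
pose D := C * A ^+ size l * (size l)`!%:R.
apply: (@le_trans _ _ (\sum_(0 <= k < N) D * 2^-1 ^+ k)).
  apply: ler_sum => k _; apply: (le_trans (@bp k l x Ux)).
  by rewrite /D; apply/ler_of_eq; ring.
have D0 : 0 <= D.
  by have := le_trans (normr_ge0 _) (@bp 0%N l x Ux); rewrite expr0 mulr1.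
rewrite -mulr_sumr (le_trans (ler_wpM2l D0 (half_sum N)))//.
by rewrite /D; apply/ler_of_eq; ring.
Qed.

Lemma jet_jet_series : jet U jet_series.
Proof.
apply: (@jet_limit _ _ _ (fun N l x => \sum_(0 <= k < N) p k l x) _
  (fun l => 2 * C * A ^+ size l * (size l)`!%:R)) => //.
- move=> N l i x Ux; rewrite !big_mkord.
  have -> : (fun x => \sum_(0 <= k < N) p k l x) =
    \sum_(k < N) p k l.
    by apply/funext => y; rewrite fct_sumE big_mkord.
  by apply: is_derive_sum => k; exact: jp.
- by move=> N l x; exact: jet_series_partial_bound.
- by move=> l x; exact: jet_series_cvg.
Qed.

Lemma cauchy_bound_jet_series : cauchy_bound U (2 * C) A jet_series.
Proof.
move=> l x Ux; have cv := @jet_series_cvg l x Ux.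
have {}cv : (fun N => `|\sum_(0 <= k < N) p k l x|) @ \oo -->
    `|jet_series l x| by apply: (@cvg_norm _ R).
rewrite -(cvg_lim _ cv)//; apply: limr_le; first by apply/cvg_ex; eexists; exact: cv.
by near=> N; exact: (@jet_series_partial_bound N l x Ux).
Unshelve. all: by end_near. Qed.
End JetSeries.

Lemma geometric_half_le (R : realType) (q : R) (n : nat) : 0 <= q -> q <= 2^-1 ->
  \sum_(j < n) q ^+ j.+1 <= 2 * q.
Proof.
move=> q0 qh; elim: n => [|n IH]; first by rewrite big_ord0 mulr_ge0.
rewrite big_ord_recl expr1.
under eq_bigr do rewrite lift0 exprS.
rewrite -mulr_sumr mulr_natl mulr2n lerD2l ler_piMr//.
by apply: (le_trans IH); lra.
Qed.

Section JetProduct.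
Variables (R : realType) (m : nat).
Implicit Types (F G E H : seq 'I_m -> 'rV[R]_m -> R) (U : set 'rV[R]_m).

(** The Leibniz rule as a recursion: the first differentiation falls on one of
    the two factors. *)
Fixpoint jetmul F G (l : seq 'I_m) (x : 'rV[R]_m) : R :=
  if l is i :: l' then jetmul (djet i F) G l' x + jetmul F (djet i G) l' x
  else F [::] x * G [::] x.

Lemma jet_jetmul U F G : jet U F -> jet U G -> jet U (jetmul F G).
Proof.
move=> + + l; elim: l F G => [|j l IH] F G jF jG i x Ux /=.
  apply: is_derive_eq; first exact: is_deriveM (jF [::] i x Ux) (jG [::] i x Ux).
  by rewrite /djet /GRing.scale/= addrC mulrC.
by apply: is_deriveD; apply: IH => //; exact: jet_djet.
Qed.

Lemma leibniz_bound (a b : nat -> R) F G x l :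
  (forall l, `|F l x| <= a (size l)) -> (forall l, `|G l x| <= b (size l)) ->
  `|jetmul F G l x| <=
    \sum_(j < (size l).+1) a j * b (size l - j)%N * 'C(size l, j)%:R.
Proof.
elim: l a b F G => [|i l IH] a b F G Fa Gb /=.
  by rewrite big_ord1 bin0 mulr1 normrM ler_pM// ?(Fa [::]) ?(Gb [::]).
rewrite (le_trans (ler_normD _ _))//.
have H1 := IH (a \o succn) b (djet i F) G (fun l => Fa (i :: l)) Gb.
have H2 := IH a (b \o succn) F (djet i G) Fa (fun l => Gb (i :: l)).
apply: (le_trans (lerD H1 H2)); apply/ler_of_eq => {H1 H2}/=.
set L := size l.
rewrite [in RHS]big_ord_recl /= bin0 mulr1 subn0.
under [in RHS]eq_bigr => j _.
  rewrite /bump leq0n add1n binS natrD mulrDr subSS addrC; over.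
rewrite big_split/= addrCA; congr (_ + _).
rewrite [in RHS]big_ord_recr/= bin_small// mulr0 addr0.
rewrite big_ord_recl/= bin0 mulr1 subn0; congr (_ + _).
apply: eq_bigr => j _; rewrite /bump leq0n add1n subnSK//.
Qed.

(** Measured by [cauchy_bound], multiplication by [E] acts essentially as
    multiplication by [sup |E|] once [A] is large compared to the growth rate
    [b] of [E]: all the derivatives of [E] together cost only [2 B b / A]. The
    shift [k] lets the same estimate serve for the bounds of the recursion
    below, where the [k]-th coefficient grows like [(k + size l)!]. *)
Lemma jetmul_bound U (k : nat) (eps B b D A : R) E H :
  0 <= eps -> 0 <= B -> 0 <= b -> 0 < A -> 2 * b <= A -> 0 <= D ->
  (forall x, U x -> `|E [::] x| <= eps) -> cauchy_bound U B b E ->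
  (forall l x, U x -> `|H l x| <= D * A ^+ size l * (k + size l)`!%:R) ->
  forall l x, U x -> `|jetmul E H l x| <=
    (eps + 2 * B * b / A) * D * A ^+ size l * (k + size l)`!%:R.
Proof.
move=> e0 B0 b0 A0 bA D0 Ee EB HD l x Ux.
pose a j : R := if j == 0%N then eps else B * b ^+ j * j`!%:R.
have Ea l' : `|E l' x| <= a (size l').
  by case: l' => [|i l']; [exact: Ee|exact: EB].
pose c j : R := D * A ^+ j * (k + j)`!%:R.
have := @leibniz_bound a c E H x l Ea (fun l' => HD l' x Ux).
move=> /le_trans; apply; set L := size l.
rewrite big_ord_recl/= bin0 mulr1 subn0 /a /c eqxx {Ea}.
pose q := b / A; have q0 : 0 <= q by rewrite divr_ge0// ltW.
have qh : q <= 2^-1 by rewrite ler_pdivrMr//; lra.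
have bq : b = q * A by rewrite divfK// gt_eqF.
pose M := D * A ^+ L * (k + L)`!%:R.
have M0 : 0 <= M by rewrite !mulr_ge0// exprn_ge0// ltW.
have -> : (eps + 2 * B * b / A) * D * A ^+ L * (k + L)`!%:R =
   eps * M + 2 * q * B * M by rewrite /M /q; ring.
apply: lerD; first by rewrite /M !mulrA.
apply: (@le_trans _ _ (\sum_(j < L) q ^+ j.+1 * (B * M))).
  apply: ler_sum => j _; rewrite /bump leq0n add1n.
  have jL : (j < L)%N by [].
  have AL : A ^+ L = A ^+ (L - j.+1) * A ^+ j.+1 by rewrite -exprD subnK.
  rewrite /= bq exprMn /M AL.
  have -> : B * (q ^+ j.+1 * A ^+ j.+1) * j.+1`!%:R *
     (D * A ^+ (L - j.+1) * (k + (L - j.+1))`!%:R) * 'C(L, j.+1)%:R =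
     q ^+ j.+1 * (B * (D * (A ^+ (L - j.+1) * A ^+ j.+1))) *
     ('C(L, j.+1) * (j.+1`! * (k + (L - j.+1))`!))%:R by rewrite !natrM; ring.
  rewrite !mulrA; apply: ler_wpM2l.
    by rewrite !mulr_ge0// exprn_ge0// ltW.
  have jkL : (j.+1 <= k + L)%N by rewrite (leq_trans jL)// leq_addl.
  by rewrite ler_nat addnBA// -(bin_fact jkL) leq_mul2r leq_bin2l ?orbT ?leq_addl.
rewrite -mulr_suml -[leRHS]mulrA; apply: ler_wpM2r; first by rewrite mulr_ge0.
exact: geometric_half_le.
Qed.

Lemma cauchy_bound_jetmul U (eps B b D A : R) E H :
  0 <= eps -> 0 <= B -> 0 <= b -> 0 < A -> 2 * b <= A -> 0 <= D ->
  (forall x, U x -> `|E [::] x| <= eps) -> cauchy_bound U B b E ->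
  cauchy_bound U D A H ->
  cauchy_bound U ((eps + 2 * B * b / A) * D) A (jetmul E H).
Proof.
move=> e0 B0 b0 A0 bA D0 Ee EB HD l x Ux.
exact: (@jetmul_bound U 0 eps B b D A).
Qed.
End JetProduct.

(** * The algebra of bounded jets *)

Section BoundedJets.
Variables (R : realType) (m : nat) (U : set 'rV[R]_m).
Implicit Types (F G E H : seq 'I_m -> 'rV[R]_m -> R).

(** Jets with Cauchy estimates uniform over [U]. They form an algebra that is
    stable under differentiation, but with constants that deteriorate at each
    operation, so that recursions need the finer estimate [jetmul_bound]. *)
Definition bjet F : Prop :=
  jet U F /\ exists C A, [/\ 0 <= C, 0 < A & cauchy_bound U C A F].

Lemma bjet_djet i F : bjet F -> bjet (djet i F).
Proof.
case=> jF [C [A [C0 A0 FC]]]; split; first exact: jet_djet.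
exists (C * A), (2 * A); split; [by rewrite mulr_ge0// ltW|by rewrite mulr_gt0|].
by apply: cauchy_bound_djet => //; exact: ltW.
Qed.

Lemma bjet_const (c : R) : bjet (fun l _ => if l is [::] then c else 0).
Proof.
split=> [l i x _|].
  by case: l => [|j l] /=; exact: is_derive_cst.
exists `|c|, 1; split=> // -[|j l] x _ /=; first by rewrite expr0 !mulr1.
by rewrite normr0 !mulr_ge0// exprn_ge0.
Qed.

Lemma bjet_add F G : bjet F -> bjet G -> bjet (fun l x => F l x + G l x).
Proof.
move=> [jF [C [A [C0 A0 FC]]]] [jG [D [B [D0 B0 GD]]]]; split.
  by move=> l i x Ux; apply: is_deriveD; [exact: jF|exact: jG].
exists (C + D), (A + B); split; [exact: addr_ge0|exact: addr_gt0|].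
move=> l x Ux; rewrite (le_trans (ler_normD _ _))// !mulrDl lerD//.
  apply: (@cauchy_bound_le _ _ U C A) => //; first exact: ltW.
  by rewrite lerDl ltW.
apply: (@cauchy_bound_le _ _ U D B) => //; first exact: ltW.
by rewrite lerDr ltW.
Qed.

Lemma bjet_scale (a : R) F : bjet F -> bjet (fun l x => a * F l x).
Proof.
move=> [jF [C [A [C0 A0 FC]]]]; split.
  by move=> l i x Ux; exact: (is_deriveZ a (jF l i x Ux)).
exists (`|a| * C), A; split=> //; first by rewrite mulr_ge0.
by move=> l x Ux; rewrite normrM -!mulrA ler_wpM2l// mulrA FC.
Qed.

Lemma bjet_sum n (F : 'I_n -> _) : (forall i, bjet (F i)) ->
  bjet (fun l x => \sum_(i < n) F i l x).
Proof.
elim: n F => [|n IH] F bF.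
  have := bjet_const 0; congr bjet; apply/funext => l; apply/funext => x.
  by rewrite big_ord0; case: l.
have := bjet_add (IH (fun i => F (widen_ord (leqnSn n) i)) (fun i => bF _)) (bF ord_max).
by congr bjet; apply/funext => l; apply/funext => x; rewrite big_ord_recr.
Qed.

Lemma bjet_mul F G : bjet F -> bjet G -> bjet (jetmul F G).
Proof.
move=> [jF [C [A [C0 A0 FC]]]] [jG [D [B [D0 B0 GD]]]]; split.
  exact: jet_jetmul.
pose B' := B + 2 * A.
have B'0 : 0 < B' by rewrite addr_gt0// mulr_gt0.
exists ((C + 2 * C * A / B') * D), B'; split=> //.
  by rewrite mulr_ge0// addr_ge0// !mulr_ge0// ?invr_ge0 ltW.
apply: cauchy_bound_jetmul => //; [exact: ltW|by rewrite lerDr ltW| |].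
  by move=> x /(FC [::]); rewrite expr0 !mulr1.
apply: (@cauchy_bound_le _ _ U D B) => //; first exact: ltW.
by rewrite lerDl mulr_ge0// ltW.
Qed.

(** Neumann series: the powers of [1 - F / c] decay geometrically together with
    all their derivatives, once the derivatives are allowed to grow fast enough
    with their order. *)
Lemma bjet_inverse F (c : R) : open U -> bjet F -> 0 < c ->
  (forall x, U x -> `|F [::] x - c| <= c / 4) ->
  exists2 H, bjet H & forall x, U x -> F [::] x * H [::] x = 1.
Proof.
move=> oU bF c0 Fc.
pose E l x : R := (if l is [::] then 1 else 0) + - c^-1 * F l x.
have bE : bjet E by exact: bjet_add (bjet_const 1) (bjet_scale _ bF).
have E4 x : U x -> `|E [::] x| <= 4^-1.
  move=> /Fc; rewrite /E.
  have -> : 1 + - c^-1 * F [::] x = - (F [::] x - c) / c.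
    by field; rewrite gt_eqF.
  by rewrite normrM normrN normfV (gtr0_norm c0) ler_pdivrMr// mulrC.
case: bE => jE [B [b [B0 b0 EB]]].
pose A := 2 * b + 8 * B * b + 1.
have Bb0 : 0 <= B * b by rewrite mulr_ge0// ltW.
have A0 : 0 < A by rewrite ltr_wpDl// -mulrA; lra.
pose p k := iter k (jetmul E) (fun l (_ : 'rV[R]_m) => if l is [::] then 1 : R else 0).
have jp k : jet U (p k).
  elim: k => [|k IH]; first by case: (bjet_const 1).
  exact: jet_jetmul.
have bp k : cauchy_bound U (1 * 2^-1 ^+ k) A (p k).
  elim: k => [|k IH].
    move=> [|i l] x _ /=; first by rewrite normr1 expr0 !mulr1.
    by rewrite normr0 !mulr_ge0// exprn_ge0 ?ltW// invr_ge0.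
  have k0 : 0 <= 1 * (2^-1 : R) ^+ k by rewrite mulr_ge0// exprn_ge0// invr_ge0.
  have e40 : 0 <= 4^-1 :> R by rewrite invr_ge0.
  have bA : 2 * b <= A by rewrite /A -mulrA; lra.
  have := cauchy_bound_jetmul e40 B0 (ltW b0) A0 bA k0 E4 EB IH.
  apply: cauchy_bound_le => //.
  - by rewrite mulr_ge0// addr_ge0// ?invr_ge0// !mulr_ge0// ?invr_ge0 ltW.
  - rewrite exprS [leRHS]mulrCA; apply: ler_wpM2r => //.
    have : 2 * B * b / A <= 4^-1.
      by rewrite ler_pdivrMr// /A -!mulrA; lra.
    by lra.
  - exact: ltW.
exists (fun l x => c^-1 * jet_series p l x).
  apply: bjet_scale; split; first exact: (jet_jet_series oU jp bp).
  by exists (2 * 1), A; split=> //; exact: cauchy_bound_jet_series.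
move=> x Ux.
have pE k : p k [::] x = E [::] x ^+ k.
  by elim: k => [|k IH]; rewrite ?expr0// exprS -IH.
have cv := jet_series_cvg bp (l := [::]) Ux.
have e1 : E [::] x != 1.
  by apply/eqP => e1; have := E4 x Ux; rewrite e1 normr1; lra.
have <- : (1 - E [::] x) * jet_series p [::] x = F [::] x * (c^-1 * jet_series p [::] x).
  by rewrite /E; field; rewrite gt_eqF.
have cv1 : (fun N => (1 - E [::] x) * \sum_(0 <= k < N) p k [::] x) @ \oo -->
    (1 - E [::] x) * jet_series p [::] x by apply: cvgM => //; exact: cvg_cst.
have cv2 : (fun N => 1 - E [::] x ^+ N) @ \oo --> (1 - 0 : R).
  apply: cvgB; first exact: cvg_cst.
  by apply: cvg_expr; apply: (le_lt_trans (E4 x Ux)); rewrite invf_lt1// ltr1n.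
rewrite subr0 in cv2; rewrite -(cvg_lim _ cv1)// -[RHS](cvg_lim _ cv2)//.
congr (limn _); apply/funext => N.
under eq_bigr do rewrite pE.
by rewrite big_mkord -[RHS]opprB subrX1 -mulNr opprB.
Qed.
End BoundedJets.

(** * The Cauchy problem for the Laplace operator *)

Lemma fact_add_le (k L : nat) : ((k + L)`! <= 2 ^ (k + L) * (k`! * L`!))%N.
Proof.
rewrite -(bin_fact (leq_addr L k)) addKn leq_mul2r.
have -> : (2 ^ (k + L) = \sum_(i < (k + L).+1) 'C(k + L, i))%N.
  rewrite -[2%N]/(1 + 1)%N expnDn; apply: eq_bigr => i _.
  by rewrite !exp1n !muln1.
have kL : (k < (k + L).+1)%N by rewrite ltnS leq_addr.
by rewrite (bigD1 (Ordinal kL))//= leq_addr orbT.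
Qed.

Section CauchyKovalevskaya.
Variables (R : realType) (m n : nat) (sig : 'I_n -> 'I_m).
Implicit Types (F G V Phi : seq 'I_m -> 'rV[R]_m -> R) (U : set 'rV[R]_m).

(** The Laplacian with respect to the directions [sig i] only; the others are
    parameters. *)
Definition jetlap F (x : 'rV[R]_m) : R := \sum_i F [:: sig i; sig i] x.

Section Powers.
Variables (Phi V : seq 'I_m -> 'rV[R]_m -> R) (x : 'rV[R]_m).
Let P k := iter k (jetmul Phi) V.

Lemma jetpow0 k : P k [::] x = Phi [::] x ^+ k * V [::] x.
Proof. by elim: k => [|k IH]; rewrite ?mul1r//= exprS -mulrA -IH. Qed.

Lemma jetpow1 k i : P k [:: i] x =
  k%:R * Phi [::] x ^+ k.-1 * Phi [:: i] x * V [::] x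
  + Phi [::] x ^+ k * V [:: i] x.
Proof.
elim: k => [|k IH]; first by rewrite !mul0r add0r mul1r.
have -> : P k.+1 [:: i] x = Phi [:: i] x * P k [::] x + Phi [::] x * P k [:: i] x.
  by [].
rewrite IH jetpow0; case: k {IH} => [|k] /=.
  by rewrite !expr0 expr1; ring.
by rewrite !exprS -!natr1; ring.
Qed.

Lemma jetpow2 k i : P k [:: i; i] x =
  (k * k.-1)%:R * Phi [::] x ^+ k.-2 * Phi [:: i] x ^+ 2 * V [::] x
  + k%:R * Phi [::] x ^+ k.-1 *
    (Phi [:: i; i] x * V [::] x + 2 * Phi [:: i] x * V [:: i] x)
  + Phi [::] x ^+ k * V [:: i; i] x.
Proof.
elim: k => [|k IH]; first by rewrite !mul0r !add0r mul1r.
have -> : P k.+1 [:: i; i] x = Phi [:: i; i] x * P k [::] x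
    + 2 * Phi [:: i] x * P k [:: i] x + Phi [::] x * P k [:: i; i] x.
  rewrite -[P k.+1]/(jetmul Phi (P k)) /= /djet; ring.
rewrite IH jetpow0 jetpow1; case: k {IH} => [|[|k]] /=.
- by rewrite !expr0 expr1; ring.
- by rewrite !expr0 expr1 expr2; ring.
- by rewrite !exprS !natrM -!natr1; ring.
Qed.
End Powers.

Section Recursion.
Variables (U : set 'rV[R]_m) (Phi V0 h : seq 'I_m -> 'rV[R]_m -> R).
Hypotheses (oU : open U) (bPhi : bjet U Phi) (bV0 : bjet U V0) (bh : bjet U h).
Hypothesis hPhi : forall x, U x ->
  (\sum_i Phi [:: sig i] x ^+ 2) * h [::] x = 1.

Let b i : seq 'I_m -> 'rV[R]_m -> R :=
  fun l x => - 2 * jetmul h (djet (sig i) Phi) l x.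
Let lapPhi : seq 'I_m -> 'rV[R]_m -> R :=
  fun l x => \sum_i djet (sig i) (djet (sig i) Phi) l x.
Let c : seq 'I_m -> 'rV[R]_m -> R := fun l x => - 1 * jetmul h lapPhi l x.
Let e : seq 'I_m -> 'rV[R]_m -> R := fun l x => - 1 * h l x.

Let step V1 V : seq 'I_m -> 'rV[R]_m -> R := fun l x =>
  \sum_i jetmul (b i) (djet (sig i) V1) l x + jetmul c V1 l x
  + \sum_i jetmul e (djet (sig i) (djet (sig i) V)) l x.

(** The Laplacian of [sum_k Phi^k / k! * V_k] vanishes as soon as for all [k]
    [|grad Phi|^2 V_(k+2) + Lap Phi V_(k+1) + 2 grad Phi . grad V_(k+1)
     + Lap V_k = 0],
    which this recursion solves, [h] being the inverse of [|grad Phi|^2]. The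
    choice [V_1 = 0] makes the sum agree with [V_0] to second order on
    [Phi = 0]. *)
Definition ck_coef (k : nat) : seq 'I_m -> 'rV[R]_m -> R :=
  (iter k (fun p => (p.2, step p.2 p.1)) (V0, fun _ _ => 0)).1.

Let ck_coefSS k : ck_coef k.+2 = step (ck_coef k.+1) (ck_coef k).
Proof. by []. Qed.

Let bjet_step V1 V : bjet U V1 -> bjet U V -> bjet U (step V1 V).
Proof.
move=> bV1 bV; do 2?[apply: bjet_add].
- apply: bjet_sum => i; apply: bjet_mul; last exact: bjet_djet.
  by apply: bjet_scale; apply: bjet_mul => //; exact: bjet_djet.
- apply: bjet_mul => //; apply: bjet_scale; apply: bjet_mul => //.
  by apply: bjet_sum => i; do 2!apply: bjet_djet.
- apply: bjet_sum => i; apply: bjet_mul; first exact: bjet_scale.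
  by do 2!apply: bjet_djet.
Qed.

Lemma bjet_ck_coef k : bjet U (ck_coef k).
Proof.
suff : bjet U (ck_coef k) /\ bjet U (ck_coef k.+1) by case.
elim: k => [|k [IH1 IH2]]; last by split=> //; rewrite ck_coefSS; exact: bjet_step.
split=> //; have := bjet_const U 0; congr bjet.
by apply/funext => l; apply/funext => x; case: l.
Qed.

Lemma ck_coef_eq k x : U x ->
  (\sum_i Phi [:: sig i] x ^+ 2) * ck_coef k.+2 [::] x
  + (jetlap Phi x * ck_coef k.+1 [::] x
     + 2 * \sum_i Phi [:: sig i] x * ck_coef k.+1 [:: sig i] x)
  + jetlap (ck_coef k) x = 0.
Proof.
move=> /hPhi N1; rewrite ck_coefSS /step /=.
set N := \sum_i _ in N1 *; set v := ck_coef k.+1; set u := ck_coef k.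
have -> : \sum_i b i [::] x * djet (sig i) v [::] x =
    - 2 * h [::] x * \sum_i Phi [:: sig i] x * v [:: sig i] x.
  by rewrite mulr_sumr; apply: eq_bigr => i _; rewrite /b /djet/=; ring.
have -> : \sum_i e [::] x * djet (sig i) (djet (sig i) u) [::] x =
    - h [::] x * jetlap u x.
  by rewrite mulr_sumr; apply: eq_bigr => i _; rewrite /e /djet/=; ring.
have -> : c [::] x = - h [::] x * jetlap Phi x.
  by have lE : lapPhi [::] x = jetlap Phi x by []; rewrite /c/= lE; ring.
set S := \sum_i _ * _.
have -> : N * (- 2 * h [::] x * S + - h [::] x * jetlap Phi x * v [::] x +
   - h [::] x * jetlap u x) =
  - (N * h [::] x) * (2 * S + jetlap Phi x * v [::] x + jetlap u x) by ring.
rewrite N1; ring.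
Qed.

(** The coefficient of index [k] grows like [k!], and its derivatives of order
    [j] like [(k + j)!]. This is consistent with the recursion because each
    derivative that it takes is compensated by a step of the index: the second
    derivatives of [V_k] and the first ones of [V_(k+1)] have the size allowed
    for [V_(k+2)]. *)
Lemma ck_coef_bound : exists D M A : R, [/\ 0 <= D, 1 <= M, 0 < A &
  forall k l x, U x ->
    `|ck_coef k l x| <= D * M ^+ k * A ^+ size l * (k + size l)`!%:R].
Proof.
have [_ [D [A0 [D0 A00 V0D]]]] := bV0.
have bb i : bjet U (b i).
  by apply: bjet_scale; apply: bjet_mul => //; exact: bjet_djet.
have [_ [Bc [ac [Bc0 ac0 cB]]]] : bjet U c.
  apply: bjet_scale; apply: bjet_mul => //.
  by apply: bjet_sum => i; do 2!apply: bjet_djet.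
have [_ [Be [ae [Be0 ae0 eB]]]] : bjet U e by exact: bjet_scale.
have [Bb [ab [Bb0 ab0 bB]]] : exists Bb ab,
    [/\ 0 <= Bb, 0 < ab & forall i, cauchy_bound U Bb ab (b i)].
  have H i := (bb i).2.
  pose C i := sval (cid (H i)).
  pose a i := sval (cid (svalP (cid (H i)))).
  have P i : [/\ 0 <= C i, 0 < a i & cauchy_bound U (C i) (a i) (b i)].
    exact: (svalP (cid (svalP (cid (H i))))).
  have a0 i : 0 <= a i by apply/ltW; case: (P i).
  have C0 i : 0 <= C i by case: (P i).
  exists (\sum_i C i), (1 + \sum_i a i); split.
  - exact: sumr_ge0.
  - by rewrite ltr_wpDr// sumr_ge0.
  - move=> i; apply: (@cauchy_bound_le _ _ U (C i) (a i)) => //.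
    + by rewrite (bigD1 i)//= lerDl sumr_ge0.
    + by rewrite (bigD1 i)//= addrCA lerDl addr_ge0// sumr_ge0.
    + by case: (P i).
pose B := Bb + Bc + Be; have B0 : 0 <= B by rewrite !addr_ge0.
pose a := ab + ac + ae; have a0 : 0 < a by rewrite !addr_gt0.
have {}bB i : cauchy_bound U B a (b i).
  apply: (@cauchy_bound_le _ _ U Bb ab) => //; rewrite /B /a; lra.
have {}cB : cauchy_bound U B a c.
  apply: (@cauchy_bound_le _ _ U Bc ac) => //; rewrite /B /a; lra.
have {}eB : cauchy_bound U B a e.
  apply: (@cauchy_bound_le _ _ U Be ae) => //; rewrite /B /a; lra.
pose A := A0 + 2 * a; have A_gt0 : 0 < A by rewrite addr_gt0// mulr_gt0.
have aA : 2 * a <= A by rewrite lerDr ltW.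
(* the three summands come from the three terms of the recursion *)
pose M := 1 + 2 * B * (n%:R * A + 1 + n%:R * A ^+ 2).
have A2 : 0 <= A ^+ 2 by rewrite sqr_ge0.
have M1 : 1 <= M.
  by rewrite lerDl !mulr_ge0// !addr_ge0// mulr_ge0// ltW.
have M0 : 0 <= M by exact: le_trans M1.
have prod E k K V : cauchy_bound U B a E -> 0 <= K ->
    (forall l x, U x -> `|V l x| <= K * A ^+ size l * (k + size l)`!%:R) ->
    forall l x, U x ->
    `|jetmul E V l x| <= 2 * B * K * A ^+ size l * (k + size l)`!%:R.
  move=> EB K0 VK l x Ux.
  have E0 y : U y -> `|E [::] y| <= B by move=> /(EB [::]); rewrite expr0 !mulr1.
  have := jetmul_bound B0 B0 (ltW a0) A_gt0 aA K0 E0 EB VK l Ux.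
  move=> /le_trans; apply.
  have K2 : 0 <= K * A ^+ size l * (k + size l)`!%:R.
    by rewrite !mulr_ge0// exprn_ge0// ltW.
  have q2 : 2 * B * a / A <= B.
    by rewrite ler_pdivrMr// -mulrA mulrCA ler_wpM2l.
  have -> : (B + 2 * B * a / A) * K * A ^+ size l * (k + size l)`!%:R =
    (B + 2 * B * a / A) * (K * A ^+ size l * (k + size l)`!%:R) by ring.
  have -> : 2 * B * K * A ^+ size l * (k + size l)`!%:R =
    (2 * B) * (K * A ^+ size l * (k + size l)`!%:R) by ring.
  by rewrite ler_wpM2r//; lra.
exists D, M, A; split=> //.
suff H k : (forall l x, U x ->
    `|ck_coef k l x| <= D * M ^+ k * A ^+ size l * (k + size l)`!%:R) /\
    (forall l x, U x -> `|ck_coef k.+1 l x|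
       <= D * M ^+ k.+1 * A ^+ size l * (k.+1 + size l)`!%:R).
  by move=> k; have [] := H k.
elim: k => [|k [IH0 IH1]].
  split=> l x Ux; last first.
    by rewrite normr0 !mulr_ge0// exprn_ge0// ltW.
  rewrite expr0 mulr1 add0n; apply: (@cauchy_bound_le _ _ U D A0) => //.
    exact: ltW.
  by rewrite lerDl mulr_ge0// ltW.
split=> // l x Ux; rewrite ck_coefSS /step.
set X := A ^+ size l * (k.+2 + size l)`!%:R.
have X0 : 0 <= X by rewrite mulr_ge0// exprn_ge0// ltW.
have Mk0 j : 0 <= M ^+ j by exact: exprn_ge0.
have Ak0 j : 0 <= A ^+ j by rewrite exprn_ge0// ltW.
have t1 i : `|jetmul (b i) (djet (sig i) (ck_coef k.+1)) l x|
    <= 2 * B * (D * M ^+ k.+1 * A) * X.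
  rewrite mulrA; apply: (prod (b i) k.+2) => //.
    by rewrite !mulr_ge0// ltW.
  move=> l' y Uy; apply: (le_trans (IH1 (sig i :: l') y Uy)).
  by apply: ler_of_eq; rewrite /= !addnS !addSn; set f := _ `!%:R; rewrite !exprS; ring.
have t2 : `|jetmul c (ck_coef k.+1) l x| <= 2 * B * (D * M ^+ k.+1) * X.
  rewrite mulrA; apply: (prod c k.+2) => //; first by rewrite !mulr_ge0.
  move=> l' y Uy; apply: (le_trans (IH1 l' y Uy)).
  apply: ler_wpM2l; first by rewrite !mulr_ge0.
  by rewrite ler_nat; apply: leq_fact; rewrite leq_add2r.
have t3 i : `|jetmul e (djet (sig i) (djet (sig i) (ck_coef k))) l x|
    <= 2 * B * (D * M ^+ k * A ^+ 2) * X.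
  rewrite mulrA; apply: (prod e k.+2) => //; first by rewrite !mulr_ge0// ltW.
  move=> l' y Uy; apply: (le_trans (IH0 (sig i :: sig i :: l') y Uy)).
  by apply: ler_of_eq; rewrite /= !addnS !addSn; set f := _ `!%:R; rewrite !exprS expr0; ring.
apply: (@le_trans _ _ (n%:R * (2 * B * (D * M ^+ k.+1 * A) * X) +
   2 * B * (D * M ^+ k.+1) * X + n%:R * (2 * B * (D * M ^+ k * A ^+ 2) * X))).
  rewrite (le_trans (ler_normD _ _))// lerD//.
    rewrite (le_trans (ler_normD _ _))// lerD// (le_trans (ler_norm_sum _ _ _))//.
    rewrite (le_trans (ler_sum _ (fun i _ => t1 i)))// sumr_const card_ord.
    by rewrite -[leLHS]mulr_natl.
  rewrite (le_trans (ler_norm_sum _ _ _))//.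
  rewrite (le_trans (ler_sum _ (fun i _ => t3 i)))// sumr_const card_ord.
  by rewrite -[leLHS]mulr_natl.
have -> : D * M ^+ k.+2 * A ^+ size l * (k.+2 + size l)`!%:R =
    D * M ^+ k * X * (M * M) by rewrite /X !exprS; ring.
have -> : n%:R * (2 * B * (D * M ^+ k.+1 * A) * X) +
   2 * B * (D * M ^+ k.+1) * X + n%:R * (2 * B * (D * M ^+ k * A ^+ 2) * X) =
   D * M ^+ k * X *
   (2 * B * (n%:R * A * M + M + n%:R * A ^+ 2)) by rewrite exprS; ring.
rewrite ler_wpM2l ?mulr_ge0//.
apply: (@le_trans _ _ (2 * B * (n%:R * A + 1 + n%:R * A ^+ 2) * M)).
  rewrite -[leRHS]mulrA ler_wpM2l ?mulr_ge0// !mulrDl mul1r lerD2l.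
  by rewrite ler_peMr// mulr_ge0.
by rewrite ler_wpM2r// lerDr.
Qed.
End Recursion.
End CauchyKovalevskaya.

Lemma bjet_ajet (R : realType) (m : nat) (U : set 'rV[R]_m) F :
  open U -> bjet U F -> ajet U F.
Proof. by move=> oU [jF [C [A [_ _ FC]]]]; exact: bounded_jet_ajet FC. Qed.

Lemma bjet_sub (R : realType) (m : nat) (U V : set 'rV[R]_m) F :
  V `<=` U -> bjet U F -> bjet V F.
Proof.
move=> VU [jF [C [A [C0 A0 FC]]]]; split; first exact: jet_sub jF.
by exists C, A; split=> //; exact: cauchy_bound_sub FC.
Qed.

Lemma ajet_near (R : realType) (m : nat) (U : set 'rV[R]_m) F l x (e : R) :
  ajet U F -> U x -> 0 < e ->
  exists r, [/\ 0 < r, cube x r `<=` U &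
    forall y, cube x r y -> `|F l y - F l x| <= e].
Proof.
move=> aF Ux e0; have [r [K [r0 rU H]]] := ajet_bound (size l).+1 aF Ux.
have K0 : 0 <= K by exact: le_trans (H [::] x isT (cube_center x r0)).
pose d := Num.min r (e / (K * m%:R + 1)).
have d0 : 0 < d by rewrite lt_min r0 divr_gt0// ltr_wpDl// mulr_ge0.
have dr : cube x d `<=` cube x r by apply: cube_sub; rewrite ge_min lexx.
exists d; split=> //; first exact: subset_trans rU.
move=> y xy; apply: (@le_trans _ _ (K * l1dist x y)).
  apply: (@partials_lipschitz _ _ (F l) (fun i => F (rcons l i)) x r) => //.
  - by move=> i z xz; apply: aF.1; exact: rU.
  - by move=> i z xz; apply: H; rewrite // size_rcons.
  - exact: dr.
apply: (@le_trans _ _ (K * (m%:R * d))).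
  apply: ler_wpM2l => //; apply: (@le_trans _ _ (\sum_(i < m) d)).
    by apply: ler_sum => i _; apply: ltW; exact: xy.
  by rewrite sumr_const card_ord -[leLHS]mulr_natl.
have Km : 0 <= K * m%:R by rewrite mulr_ge0.
rewrite mulrA; apply: (@le_trans _ _ ((K * m%:R + 1) * d)).
  by rewrite ler_wpM2r ?(ltW d0)// lerDl.
by rewrite mulrC -ler_pdivlMr ?ltr_wpDl// ge_min lexx orbT.
Qed.

Lemma cvg_sum_ord (R : realType) n (u : 'I_n -> nat -> R) (l : 'I_n -> R) :
  (forall i, u i @ \oo --> l i) ->
  (fun N => \sum_i u i N) @ \oo --> \sum_i l i.
Proof.
elim: n u l => [|n IH] u l ul.
  by under eq_fun do rewrite big_ord0; rewrite big_ord0; exact: cvg_cst.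
under eq_fun do rewrite big_ord_recr; rewrite big_ord_recr/=.
by apply: cvgD => //; exact: IH.
Qed.

(** Cauchy-Kovalevskaya for the Laplace operator in the directions [sig], with
    data on the hypersurface [Phi = 0] of a space that may have further
    (parameter) directions. The solution is sought as
    [sum_k Phi^k / k! * V_k]; the coefficients [V_k] are functions on the
    ambient space, so that the hypersurface need not be straightened. The
    factor [Phi^k] makes the series converge near the hypersurface; so do its
    derivatives, if a faster growth in their order is admitted. *)
Theorem cauchy_kovalevskaya_laplace (R : realType) (m n : nat)
    (sig : 'I_n -> 'I_m) (U : set 'rV[R]_m) (z0 : 'rV[R]_m)
    (Phi V0 : seq 'I_m -> 'rV[R]_m -> R) :
  open U -> U z0 -> bjet U Phi -> bjet U V0 -> Phi [::] z0 = 0 ->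
  0 < \sum_i Phi [:: sig i] z0 ^+ 2 ->
  exists r W, [/\ 0 < r, cube z0 r `<=` U, bjet (cube z0 r) W,
    forall x, cube z0 r x -> jetlap sig W x = 0 &
    forall x, cube z0 r x -> Phi [::] x = 0 ->
      W [::] x = V0 [::] x /\ forall j, W [:: j] x = V0 [:: j] x].
Proof.
move=> oU Uz bPhi bV0 Phi0 N0.
pose N : seq 'I_m -> 'rV[R]_m -> R := fun l x =>
  \sum_i jetmul (djet (sig i) Phi) (djet (sig i) Phi) l x.
have bN : bjet U N.
  by apply: bjet_sum => i; apply: bjet_mul; exact: bjet_djet.
have NE x : N [::] x = \sum_i Phi [:: sig i] x ^+ 2.
  by apply: eq_bigr => i _; rewrite /= expr2.
have [r1 [r10 r1U N1]] : exists r, [/\ 0 < r, cube z0 r `<=` U &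
    forall y, cube z0 r y -> `|N [::] y - N [::] z0| <= N [::] z0 / 4].
  apply: ajet_near => //; first exact: bjet_ajet.
  by rewrite NE divr_gt0.
pose U1 := cube z0 r1; have oU1 : open U1 by exact: open_cube.
have Nz0 : 0 < N [::] z0 by rewrite NE.
have [h bh hN] := bjet_inverse oU1 (bjet_sub r1U bN) Nz0 N1.
have {hN}hN x : U1 x -> (\sum_i Phi [:: sig i] x ^+ 2) * h [::] x = 1.
  by move=> xU; rewrite -NE hN// NE.
have {}bPhi := bjet_sub r1U bPhi; have {}bV0 := bjet_sub r1U bV0.
pose V := ck_coef sig Phi V0 h.
have bV k : bjet U1 (V k) by exact: bjet_ck_coef.
have VE k x : U1 x -> _ := fun Ux => @ck_coef_eq _ _ _ sig U1 Phi V0 h hN k x Ux.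
have [D [M [A [D0 M1 A0 VD]]]] := ck_coef_bound sig bPhi bV0 bh.
have M0 : 0 < M by exact: lt_le_trans M1.
have [jPhi [B [b [B0 b0 PhiB]]]] := bPhi.
pose eps := (8 * M)^-1; have eps0 : 0 < eps by rewrite invr_gt0 mulr_gt0.
have [r [r0 rU1 Peps]] : exists r, [/\ 0 < r, cube z0 r `<=` U1 &
    forall y, cube z0 r y -> `|Phi [::] y - Phi [::] z0| <= eps].
  apply: ajet_near => //; first exact: bjet_ajet.
  exact: cube_center.
pose U2 := cube z0 r; have oU2 : open U2 by exact: open_cube.
have {}Peps x : U2 x -> `|Phi [::] x| <= eps.
  by move=> /Peps; rewrite Phi0 subr0.
have MB0 : 0 <= M * B * b by rewrite !mulr_ge0// ltW.
(* large enough for a multiplication by [Phi] to cost at most [2 * eps] *)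
pose A' := 2 * A + 2 * b + 16 * (M * B * b).
have A'0 : 0 < A' by rewrite /A'; lra.
have bA' : 2 * b <= A' by rewrite /A'; lra.
have AA' : 2 * A <= A' by rewrite /A'; lra.
(* separating the two factorials turns the bound into a geometric one *)
have VD2 k : cauchy_bound U2 (D * (2 * M) ^+ k * k`!%:R) A' (V k).
  have nn : 0 <= D * (2 * M) ^+ k * k`!%:R.
    by rewrite !mulr_ge0// exprn_ge0// mulr_ge0// ltW.
  apply: (@cauchy_bound_le _ _ U2 (D * (2 * M) ^+ k * k`!%:R) (2 * A)) => //.
    by rewrite mulr_ge0// ltW.
  move=> l x /rU1 Ux; apply: (le_trans (VD k l x Ux)).
  apply: (@le_trans _ _ (D * M ^+ k * A ^+ size l *
    (2 ^ (k + size l) * (k`! * (size l)`!))%:R)).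
    apply: ler_wpM2l; last by rewrite ler_nat fact_add_le.
    by rewrite !mulr_ge0// exprn_ge0// ltW.
  by apply: ler_of_eq; rewrite !natrM natrX exprD !exprMn; ring.
pose p k : seq 'I_m -> 'rV[R]_m -> R := fun l x =>
  k`!%:R^-1 * iter k (jetmul Phi) (V k) l x.
have jp k : jet U2 (p k).
  have jk j : jet U2 (iter j (jetmul Phi) (V k)).
    elim: j => [|j IH]; first by apply: jet_sub rU1 _; case: (bV k).
    by apply: jet_jetmul => //; exact: jet_sub jPhi.
  by move=> l i x Ux; exact: (is_deriveZ _ (jk k l i x Ux)).
have bp k : cauchy_bound U2 (D * 2^-1 ^+ k) A' (p k).
  pose C := D * (2 * M) ^+ k * k`!%:R.
  have C0 : 0 <= C.
    by rewrite !mulr_ge0// exprn_ge0// mulr_ge0// ltW.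
  pose q := (4 * M)^-1; have q0 : 0 < q by rewrite invr_gt0 mulr_gt0.
  have bk j : cauchy_bound U2 (q ^+ j * C) A' (iter j (jetmul Phi) (V k)).
    elim: j => [|j IH]; first by rewrite mul1r; exact: VD2.
    have qC : 0 <= q ^+ j * C by rewrite mulr_ge0// exprn_ge0// ltW.
    have := cauchy_bound_jetmul (ltW eps0) B0 (ltW b0) A'0 bA' qC Peps
      (cauchy_bound_sub rU1 PhiB) IH.
    apply: cauchy_bound_le => //; last exact: ltW.
      apply: mulr_ge0 => //; apply: addr_ge0; first exact: ltW.
      by rewrite !mulr_ge0// ?invr_ge0 ltW.
    have -> : q ^+ j.+1 * C = q * (q ^+ j * C) by rewrite exprS mulrA.
    apply: ler_wpM2r => //.
    have : 2 * B * b / A' <= eps.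
      by rewrite ler_pdivrMr// -ler_pdivrMl// /eps invrK /A'; lra.
    have -> : q = eps + eps by rewrite /q /eps; field; rewrite gt_eqF.
    lra.
  move=> l x Ux; rewrite normrM ger0_norm ?invr_ge0//.
  have f0 : (0 : R) < k`!%:R by rewrite ltr0n fact_gt0.
  rewrite mulrC ler_pdivrMr//.
  apply: (le_trans (bk k l x Ux)); apply: ler_of_eq; rewrite /C.
  have -> : (2^-1 : R) = q * (2 * M) by rewrite /q; field; rewrite gt_eqF.
  rewrite (_ : (q * (2 * M)) ^+ k = q ^+ k * (2 * M) ^+ k) ?exprMn//.
  by set X := (2 * M) ^+ k; set Y := q ^+ k; ring.
pose W := jet_series p.
have jW : jet U2 W by exact: (jet_jet_series oU2 jp bp).
have W_cvg l x : U2 x -> (fun N => \sum_(0 <= k < N) p k l x) @ \oo --> W l x.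
  exact: (jet_series_cvg bp).
exists r, W; split=> //.
- exact: subset_trans r1U.
- split=> //; exists (2 * D), A'; split=> //; first exact: mulr_ge0.
  exact: (cauchy_bound_jet_series bp).
- move=> x Ux.
  have cvS : (fun K => \sum_(i < n) \sum_(0 <= k < K.+2) p k [:: sig i; sig i] x)
      @ \oo --> jetlap sig W x.
    apply: (@cvg_sum_ord R n
      (fun i K => \sum_(0 <= k < K.+2) p k [:: sig i; sig i] x)) => i.
    have := @W_cvg [:: sig i; sig i] x Ux.
    by rewrite -(cvg_shiftn 2); under eq_fun do rewrite addn2.
  pose a := Phi [::] x; pose q k : R := k`!%:R^-1 * a ^+ k.
  have f0 k : (k`!%:R : R) != 0 by rewrite pnatr_eq0 -lt0n fact_gt0.
  pose lapp k : R := \sum_(i < n) p k [:: sig i; sig i] x.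
  have lappE k : lapp k = k`!%:R^-1 * ((k * k.-1)%:R * a ^+ k.-2 * N [::] x * V k [::] x
      + k%:R * a ^+ k.-1 * (jetlap sig Phi x * V k [::] x
         + 2 * \sum_i Phi [:: sig i] x * V k [:: sig i] x)
      + a ^+ k * jetlap sig (V k) x).
    rewrite NE /jetlap /lapp !(mulr_sumr, mulr_suml) -big_split/=.
    rewrite !(mulr_sumr, mulr_suml) -!big_split/= mulr_sumr; apply: eq_bigr => i _.
    by rewrite /p jetpow2 -/a; ring.
  (* the recursion cancels everything but the last two terms *)
  have telescope K : \sum_(i < n) \sum_(0 <= k < K.+2) p k [:: sig i; sig i] x =
      q K.+1 * jetlap sig (V K.+1) x - q K * N [::] x * V K.+2 [::] x.
    rewrite exchange_big/= -/(lapp _).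
    have -> : \sum_(0 <= k < K.+2) \sum_(i < n) p k [:: sig i; sig i] x =
      \sum_(0 <= k < K.+2) lapp k by [].
    elim: K => [|K IH].
      rewrite !big_nat_recr//= big_geq// add0r !lappE /q.
      rewrite !fact0 factS fact0.
      have := VE 0%N x (rU1 x Ux); rewrite -NE -/V -/(V 0%N) -/(V 1%N) -/(V 2%N).
      move=> E0; rewrite -[RHS]addr0 -[X in _ = _ + X]E0 /= !expr0 expr1 invr1.
      by ring.
    rewrite big_nat_recr//= IH lappE /q.
    have := VE K.+1 x (rU1 x Ux); rewrite -NE -/(V K.+1) -/(V K.+2) -/(V K.+3).
    move=> E0; rewrite -[RHS]addr0 -[X in _ = _ + X](mulr0 (q K.+1)).
    rewrite -[X in _ = _ + _ * X]E0 /q /=.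
    rewrite !factS !natrM !exprS.
    by field; rewrite f0 nat1r -natrD !pnatr_eq0.
  have bnd K : `|\sum_(i < n) \sum_(0 <= k < K.+2) p k [:: sig i; sig i] x| <=
      (n%:R * D * A' ^+ 2 * 2 + `|N [::] x| * D * 2 * (2 * M) ^+ 2) * 4^-1 ^+ K.
    have aeps k : `|a| ^+ k <= eps ^+ k.
      by rewrite lerXn2r ?nnegrE//; [exact: ltW|exact: Peps].
    have fp k : (0 : R) < k`!%:R by rewrite ltr0n fact_gt0.
    have eM k : eps ^+ k * (2 * M) ^+ k = 4^-1 ^+ k.
      by rewrite -exprMn; congr (_ ^+ _); rewrite /eps; field; rewrite gt_eqF.
    have qE k : `|q k| <= k`!%:R^-1 * eps ^+ k.
      by rewrite normrM normrX ger0_norm ?invr_ge0// ler_wpM2l ?invr_ge0.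
    have e0 k : 0 <= eps ^+ k by rewrite exprn_ge0// ltW.
    have M2 k : 0 <= (2 * M) ^+ k by rewrite exprn_ge0// mulr_ge0// ltW.
    rewrite telescope (le_trans (ler_normB _ _))// mulrDl lerD//.
      pose Z := D * (2 * M) ^+ K.+1 * K.+1`!%:R * A' ^+ 2 * 2.
      have VZ : `|jetlap sig (V K.+1) x| <= n%:R * Z.
        apply: (le_trans (ler_norm_sum _ _ _)).
        apply: (@le_trans _ _ (\sum_(i < n) Z)).
          by apply: ler_sum => i _; exact: (VD2 K.+1 [:: sig i; sig i] x Ux).
        by rewrite sumr_const card_ord -[leLHS]mulr_natl.
      rewrite normrM; apply: (le_trans (ler_pM _ _ (qE _) VZ)) => //.
      have -> : K.+1`!%:R^-1 * eps ^+ K.+1 * (n%:R * Z) =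
          n%:R * D * A' ^+ 2 * 2 * (eps ^+ K.+1 * (2 * M) ^+ K.+1).
        by rewrite /Z; field; exact: f0.
      rewrite eM; apply: ler_wpM2l.
        by rewrite !mulr_ge0// ltW.
      by rewrite exprS ler_piMl ?exprn_ge0 ?invr_ge0// invf_le1// ler1n.
    pose Z := D * (2 * M) ^+ 2 * 2 * (2 * M) ^+ K * K`!%:R.
    have VZ : `|V K.+2 [::] x| <= Z.
      apply: (le_trans (VD K.+2 [::] x (rU1 x Ux))).
      rewrite /= expr0 mulr1 addn0.
      apply: (@le_trans _ _ (D * M ^+ K.+2 * (2 ^ (K + 2) * (K`! * 2`!))%:R)).
        apply: ler_wpM2l; first by apply: mulr_ge0 => //; rewrite exprn_ge0// ltW.
        by rewrite ler_nat -[K.+2]addn2 fact_add_le.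
      have E2M j : (2 * M) ^+ j = 2 ^+ j * M ^+ j by rewrite exprMn.
      have -> : (2 ^ (K + 2) * (K`! * 2`!))%:R = 2 ^+ K * 2 ^+ 2 * (K`!%:R * 2) :> R.
        by rewrite natrM natrX (natrM _ K`!) exprD.
      by apply: ler_of_eq; rewrite /Z !E2M -[K.+2]addn2 exprD; ring.
    rewrite !normrM.
    have -> : `|N [::] x| * D * 2 * (2 * M) ^+ 2 * 4^-1 ^+ K =
        K`!%:R^-1 * eps ^+ K * `|N [::] x| * Z.
      by rewrite -eM /Z; field; exact: f0.
    apply: ler_pM => //; apply: ler_wpM2r => //.
    by rewrite -normrM; exact: qE.
  have cv0 : (fun K => \sum_(i < n) \sum_(0 <= k < K.+2) p k [:: sig i; sig i] x)
      @ \oo --> (0 : R).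
    apply/norm_cvg0P.
    set C := n%:R * D * _ * _ + _ in bnd.
    have cvC : (fun K => C * 4^-1 ^+ K) @ \oo --> (0 : R).
      rewrite -(mulr0 C); apply: cvgM; first exact: cvg_cst.
      by apply: cvg_expr; rewrite ger0_norm ?invr_ge0// invf_lt1// ltr1n.
    apply: (squeeze_cvgr _ (@cvg_cst _ _ _ _ _) cvC).
    by near=> K; rewrite normr_ge0/=.
  by rewrite -(cvg_lim _ cvS)// (cvg_lim _ cv0).
- move=> x Ux P0; have V1 l : V 1%N l x = 0 by [].
  have lim_const l (c : R) : (forall k, p k l x = if k == 0%N then c else 0) ->
      W l x = c.
    move=> pk; rewrite -(cvg_lim _ (W_cvg l x Ux))//.
    apply: lim_near_cst => //; near=> K.
    have K0 : (0 < K)%N by near: K; exists 1%N.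
    rewrite (big_ltn K0) pk eqxx big_nat_cond big1 ?addr0// => k.
    by rewrite andbT pk => /andP[k0 _]; rewrite gtn_eqF.
  split=> [|j]; apply: lim_const => -[|k]; rewrite /p ?jetpow0 ?jetpow1 P0/=.
  + by rewrite fact0 invr1 !mul1r.
  + by rewrite exprS !mul0r mulr0.
  + by rewrite fact0 invr1 !mul0r add0r !mul1r.
  + by case: k => [|k]; rewrite ?V1 !exprS ?(mulr0, mul0r, addr0).
Unshelve. all: by end_near. Qed.

(** * Convergent power series satisfy Cauchy estimates *)

Section PowerSeriesJet.
Variables (R : realType) (n : nat).
Implicit Types (a x : 'rV[R]_n) (l : seq 'I_n) (alpha : 'I_n -> nat).

(** The derivative along [l] of [(x - a)^alpha]. *)
Definition djmonomial a l alpha (x : 'rV[R]_n) : R :=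
  \prod_i ((alpha i ^_ count_mem i l)%:R * (x 0 i - a 0 i) ^+ (alpha i - count_mem i l)).

Lemma is_derive_powerB (y b : R) k :
  is_derive y (1 : R) (fun s => (s - b) ^+ k) (k%:R * (y - b) ^+ k.-1).
Proof.
have d1 : is_derive y (1 : R) (fun s : R => s - b) 1.
  by apply: is_derive_eq; rewrite subr0.
have d2 := is_deriveX k d1.
have -> : (fun s => (s - b) ^+ k) = (fun s => s - b) ^+ k.
  by apply/funext => s; rewrite exprfctE.
by apply: (is_derive_eq d2); rewrite /GRing.scale/= mulr1.
Qed.

Lemma is_derive_djmonomial a l alpha j x :
  is_derive x (delta_mx 0 j) (djmonomial a l alpha)
    (djmonomial a (rcons l j) alpha x).
Proof.
apply: is_derive_unline.
pose k := count_mem j l; pose Q := \prod_(i | i != j)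
  ((alpha i ^_ count_mem i l)%:R * (x 0 i - a 0 i) ^+ (alpha i - count_mem i l)).
have E s : djmonomial a l alpha (s *: delta_mx 0 j + x) =
    (alpha j ^_ k)%:R * Q * ((s - (a 0 j - x 0 j)) ^+ (alpha j - k)).
  rewrite /djmonomial (bigD1 j)//= !mxE !eqxx/= mulr1.
  have -> : \prod_(i | i != j) ((alpha i ^_ count_mem i l)%:R *
     ((s *: delta_mx 0 j + x) 0 i - a 0 i) ^+ (alpha i - count_mem i l)) = Q.
    apply: eq_bigr => i /negPf ij.
    by rewrite !mxE ij andbF mulr0 add0r.
  have -> : s + x 0 j - a 0 j = s - (a 0 j - x 0 j) by ring.
  by rewrite /k; ring.
have -> : djmonomial a (rcons l j) alpha x = (alpha j ^_ k)%:R * Q *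
    ((alpha j - k)%:R * (0 - (a 0 j - x 0 j)) ^+ (alpha j - k).-1).
  rewrite /djmonomial (bigD1 j)//= -cats1 count_cat/= eqxx addn0 addn1.
  have -> : \prod_(i | i != j) ((alpha i ^_ count_mem i (l ++ [:: j]))%:R *
     (x 0 i - a 0 i) ^+ (alpha i - count_mem i (l ++ [:: j]))) = Q.
    apply: eq_bigr => i /negPf ij.
    by rewrite count_cat/= eq_sym ij !addn0.
  rewrite ffactnSr natrM -subnS -/k.
  have -> : 0 - (a 0 j - x 0 j) = x 0 j - a 0 j by ring.
  ring.
under eq_fun do rewrite E.
exact: (is_deriveZ _ (is_derive_powerB 0 _ _)).
Qed.

Lemma prod_fact_count l : (\prod_i (count_mem i l)`! <= (size l)`!)%N.
Proof.
elim: l => [|j l IH]; first by rewrite big1.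
rewrite (bigD1 j)//= eqxx add1n factS -mulnA factS leq_mul//.
  by rewrite ltnS count_size.
apply: leq_trans IH; rewrite [leqRHS](bigD1 j)//=; apply: leq_mul => //.
by apply: leq_prod => i /negPf; rewrite eq_sym => ->.
Qed.

Lemma sum_count l : (\sum_i count_mem i l)%N = size l.
Proof.
elim: l => [|j l IH]; first by rewrite big1.
rewrite /= big_split/= IH (bigD1 j)//= eqxx big1 ?addn0// => i.
by rewrite eq_sym => /negPf ->.
Qed.

(** Each coordinate contributes a single term of the binomial expansion of
    [(y + h)^k], where [y] is the distance to the center. *)
Lemma djmonomial_bound a l alpha x (h r : R) : 0 < h -> 0 <= r ->
  (forall i, `|x 0 i - a 0 i| + h <= r) ->
  `|djmonomial a l alpha x| <= (size l)`!%:R * h^-1 ^+ size l * r ^+ (\sum_i alpha i).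
Proof.
move=> h0 r0 xh; have hV k : 0 <= h^-1 ^+ k by rewrite exprn_ge0// invr_ge0 ltW.
have one (k j : nat) (y : R) : 0 <= y -> y + h <= r ->
    (k ^_ j)%:R * y ^+ (k - j) <= j`!%:R * h^-1 ^+ j * r ^+ k.
  move=> y0 yr; have [jk|kj] := leqP j k; last first.
    by rewrite ffact_small// mul0r !mulr_ge0// exprn_ge0.
  have yh0 : 0 <= y + h by rewrite addr_ge0// ltW.
  apply: (@le_trans _ _ (j`!%:R * h^-1 ^+ j * (y + h) ^+ k)); last first.
    by apply: ler_wpM2l; [rewrite mulr_ge0|rewrite lerXn2r].
  have jk1 : (j < k.+1)%N by [].
  rewrite exprDn (bigD1 (Ordinal jk1))//= mulrDr -[leLHS]addr0 lerD//; last first.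
    apply: mulr_ge0; first by rewrite mulr_ge0.
    by apply: sumr_ge0 => i _; rewrite mulrn_wge0// mulr_ge0// exprn_ge0// ltW.
  rewrite -bin_ffact natrM -[X in _ <= _ * X]mulr_natl exprVn.
  by apply: ler_of_eq; field; rewrite expf_neq0// gt_eqF.
rewrite normr_prod; apply: (@le_trans _ _
    (\prod_i ((count_mem i l)`!%:R * h^-1 ^+ count_mem i l * r ^+ alpha i))).
  apply: ler_prod => i _; rewrite normr_ge0/= normrM normrX ger0_norm//.
  exact: one.
rewrite !big_split/= !prodrXr sum_count; apply: ler_wpM2r; first exact: exprn_ge0.
by apply: ler_wpM2r => //; rewrite -natr_prod ler_nat prod_fact_count.
Qed.

(** Makes the partial sums over cubes of multi-indices monotone, so that
    boundedness is enough for their convergence. *)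
Lemma ler_sum_multiindex (g : ('I_n -> nat) -> R) N : (forall alpha, 0 <= g alpha) ->
  \sum_(alpha : {ffun 'I_n -> 'I_N}) g (fun i => alpha i) <=
  \sum_(alpha : {ffun 'I_n -> 'I_N.+1}) g (fun i => alpha i).
Proof.
move=> g0.
pose f (alpha : {ffun 'I_n -> 'I_N}) := [ffun i => widen_ord (leqnSn N) (alpha i)].
have finj : injective f.
  move=> u v /ffunP uv; apply/ffunP => i; have := uv i; rewrite !ffunE.
  by move=> /(congr1 val)/= /val_inj.
rewrite [leRHS](bigID (mem (finset.imset f (mem predT))))/= -[leLHS]addr0.
rewrite lerD//; last exact: sumr_ge0.
rewrite big_imset/=; last by move=> u v _ _ /finj.
apply: ler_of_eq; apply: eq_bigr => alpha _; congr g.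
by apply/funext => i; rewrite ffunE.
Qed.

(** Term-by-term differentiation on a smaller cube: the coefficients are
    controlled by the absolute convergence at a corner of a larger one. *)
Theorem analytic_at_bjet (f : 'rV[R]_n -> R) a : analytic_at f a ->
  exists r F, [/\ 0 < r, bjet (cube a r) F & forall x, cube a r x -> F [::] x = f x].
Proof.
move=> [c [r [r0 cf]]].
pose h := r / 4; have h0 : 0 < h by rewrite divr_gt0.
have h20 : 0 <= h + h by rewrite addr_ge0// ltW.
pose F N l x : R := \sum_(alpha : {ffun 'I_n -> 'I_N})
  c (fun i => alpha i) * djmonomial a l (fun i => alpha i) x.
pose S N : R := \sum_(alpha : {ffun 'I_n -> 'I_N})
  `|c (fun i => alpha i)| * (h + h) ^+ (\sum_i alpha i).
have [K K0 SK] : exists2 K, 0 <= K & forall N, S N <= K.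
  pose x : 'rV[R]_n := a + const_mx (h + h).
  have xr i : `|x 0 i - a 0 i| < r.
    rewrite /x !mxE [_ + (h + h)]addrC addrK ger0_norm// /h; lra.
  have [cv _] := cf x xr.
  have /cvg_seq_bounded/pinfty_ex_gt0 [K K0 SK] := cv.
  exists K; first exact: ltW.
  move=> N; have /= SN := SK N I; apply: le_trans SN.
  rewrite ger0_norm; last by apply: sumr_ge0.
  apply: ler_sum => alpha _; rewrite normrM; apply: ler_wpM2l => //.
  rewrite /monomial normr_prod -prodrXr; apply: ler_of_eq; apply: eq_bigr => i _.
  by rewrite /x !mxE [_ + (h + h)]addrC addrK normrX ger0_norm.
pose U := cube a h; have oU : open U by exact: open_cube.
have dB l alpha x : U x -> `|djmonomial a l alpha x| <=
    (size l)`!%:R * h^-1 ^+ size l * (h + h) ^+ (\sum_i alpha i).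
  move=> Ux; apply: djmonomial_bound => // i.
  by rewrite lerD2r ltW.
have FB N l x : U x -> \sum_(alpha : {ffun 'I_n -> 'I_N})
    `|c (fun i => alpha i) * djmonomial a l (fun i => alpha i) x| <=
    K * h^-1 ^+ size l * (size l)`!%:R.
  move=> Ux; pose B : R := (size l)`!%:R * h^-1 ^+ size l.
  have B0 : 0 <= B by rewrite mulr_ge0// exprn_ge0// invr_ge0 ltW.
  apply: (@le_trans _ _ (B * S N)).
    rewrite mulr_sumr; apply: ler_sum => alpha _.
    by rewrite normrM mulrCA; apply: ler_wpM2l => //; exact: dB.
  by rewrite -mulrA [_ * (size l)`!%:R]mulrC -/B mulrC; apply: ler_wpM2r.
have jF N : jet U (F N).
  move=> l i x Ux; rewrite /F.
  apply: is_derive_bigsum => alpha.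
  exact: (is_deriveZ _ (is_derive_djmonomial _ _ _ _ _)).
have cF l x : U x -> cvgn (fun N => F N l x).
  move=> Ux.
  pose t (alpha : 'I_n -> nat) := c alpha * djmonomial a l alpha x.
  pose u N := \sum_(alpha : {ffun 'I_n -> 'I_N}) `|t (fun i => alpha i)|.
  pose v N := \sum_(alpha : {ffun 'I_n -> 'I_N})
     (t (fun i => alpha i) + `|t (fun i => alpha i)|).
  have cu : cvgn u.
    apply: nondecreasing_is_cvgn.
      apply/nondecreasing_seqP => N.
      exact: (@ler_sum_multiindex (fun alpha => `|t alpha|)).
    by eexists => _ [N _ <-]; exact: (FB N l x Ux).
  have cv : cvgn v.
    apply: nondecreasing_is_cvgn.
      apply/nondecreasing_seqP => N.
      apply: (@ler_sum_multiindex (fun alpha => t alpha + `|t alpha|)) => alpha.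
      by rewrite -lerBlDr sub0r; exact: lerNnormlW.
    exists (2 * (K * h^-1 ^+ size l * (size l)`!%:R)) => _ [N _ <-].
    apply: (@le_trans _ _ (2 * u N)); last by rewrite ler_wpM2l//; exact: FB.
    rewrite mulr_sumr; apply: ler_sum => alpha _.
    by rewrite mulr_natl mulr2n lerD2r ler_norm.
  have -> : (fun N => F N l x) = (fun N => v N - u N).
    apply/funext => N; rewrite /F /v /u -sumrB; apply: eq_bigr => alpha _.
    by rewrite addrK.
  exact: is_cvgB.
pose G l x := limn (fun N => F N l x).
have FG l x : U x -> (fun N => F N l x) @ \oo --> G l x by move=> /cF; apply.
have {}FB N l x : U x -> `|F N l x| <= K * h^-1 ^+ size l * (size l)`!%:R.
  by move=> Ux; apply: le_trans (ler_norm_sum _ _ _) _; exact: FB.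
exists h, G; split=> //.
- split; first exact: (jet_limit oU jF FB FG).
  exists K, h^-1; split=> //; first by rewrite invr_gt0.
  move=> l x Ux; have cv := FG l x Ux.
  have {}cv : (fun N => `|F N l x|) @ \oo --> `|G l x| by apply: (@cvg_norm _ R).
  rewrite -(cvg_lim _ cv)//; apply: limr_le; first by apply/cvg_ex; eexists; exact: cv.
  by near=> N; exact: FB.
- move=> x Ux; have hr : h <= r by rewrite /h; lra.
  have [_ cv] := cf x (cube_sub hr Ux).
  rewrite /G -(cvg_lim _ cv)//; congr (limn _); apply/funext => N.
  apply: eq_bigr => alpha _; congr (_ * _); apply: eq_bigr => i _.
  by rewrite ffactn0 mul1r subn0 !mxE.
Unshelve. all: by end_near. Qed.
End PowerSeriesJet.

(** * The identity theorem *)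

Lemma derivative_power_bound (R : realType) (u du : R -> R) (M : R) (q : nat) :
  (forall s : R, 0 <= s <= 1 -> is_derive s (1 : R) u (du s)) -> u 0 = 0 ->
  (forall s : R, 0 <= s <= 1 -> `|du s| <= M * s ^+ q) ->
  forall s : R, 0 <= s <= 1 -> `|u s| <= M * s ^+ q.+1 / q.+1%:R.
Proof.
move=> D u0 B s /andP[s0 s1].
have q0 : (q.+1%:R : R) != 0 by rewrite pnatr_eq0.
pose w (z t : R) := M / q.+1%:R * (t - 0) ^+ q.+1 + z * u t.
have dw (z t : R) : 0 <= t <= 1 -> is_derive t (1 : R) (w z) (M * t ^+ q + z * du t).
  move=> t01; apply: is_deriveD.
    have -> : M * t ^+ q = M / q.+1%:R * (q.+1%:R * (t - 0) ^+ q.+1.-1).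
      by rewrite subr0/=; field.
    exact: (is_deriveZ _ (is_derive_powerB t 0 q.+1)).
  exact: (is_deriveZ z (D t t01)).
have w_ge0 (z : R) : `|z| <= 1 -> 0 <= w z s.
  move=> z1; have [t /andP[t0 ts]|c /andP[c0 cs]] :=
    mvt_itv (f := w z) s0 (df := fun t => M * t ^+ q + z * du t).
    by apply: dw; rewrite t0 (le_trans ts).
  have -> : w z 0 = 0 by rewrite /w u0 subrr exprS mul0r !mulr0 addr0.
  rewrite !subr0 => ->; apply: mulr_ge0 => //.
  have c01 : 0 <= c <= 1 by rewrite c0 (le_trans cs).
  have : `|z * du c| <= M * c ^+ q.
    by rewrite normrM (le_trans _ (B c c01))// ler_piMl.
  by rewrite ler_norml => /andP[H _]; rewrite -lerBlDl sub0r.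
have := w_ge0 1; have := w_ge0 (-1).
rewrite normrN normr1 lexx /w subr0 => /(_ isT) H1 /(_ isT) H2.
have -> : M * s ^+ q.+1 / q.+1%:R = M / q.+1%:R * s ^+ q.+1 by ring.
move: H1 H2; set X := M / _ * _; rewrite mulN1r mul1r => H1 H2.
by rewrite ler_norml; apply/andP; split; lra.
Qed.

(** Connectedness of the unit interval. *)
Lemma unit_interval_propagation (R : realType) (P : R -> Prop) :
  P 0 ->
  (forall s : R, 0 <= s <= 1 -> exists2 d : R, 0 < d & forall u v : R, 0 <= u <= 1 ->
     0 <= v <= 1 -> `|u - s| < d -> `|v - s| < d -> P u -> P v) ->
  P 1.
Proof.
move=> P0 loc; pose E := [set u : R | 0 <= u <= 1 /\ P u].
have E0 : E 0 by split=> //; rewrite lexx ler01.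
have supE : has_sup E by split; [exists 0|exists 1 => u [/andP[]]].
pose s := sup E.
have s01 : 0 <= s <= 1.
  apply/andP; split; first by apply: ub_le_sup => //; case: supE.
  by apply: ge_sup; [exists 0|move=> u [/andP[]]].
have [d d0 H] := loc s s01.
have [u Eu su] := sup_adherent d0 supE.
have us : u <= s by apply: ub_le_sup => //; case: supE.
have uds : `|u - s| < d by rewrite distrC ger0_norm ?subr_ge0//; rewrite -/s in su; lra.
case: Eu => u01 Pu.
pose v := Num.min 1 (s + d / 2).
have v01 : 0 <= v <= 1.
  by rewrite ge_min lexx le_min ler01/=; move: s01 => /andP[s0 _]; rewrite andbT; lra.
have sv : s <= v by rewrite le_min; move: s01 => /andP[_ ->]/=; lra.
have vds : `|v - s| < d.
  rewrite ger0_norm ?subr_ge0//; have : v <= s + d / 2 by rewrite ge_min lexx orbT.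
  lra.
have Pv : P v by exact: (H u v).
have vs : v <= s by apply: ub_le_sup; [case: supE|split].
have v1 : v = 1.
  move: vs; rewrite /v minElt; case: ifP => // _; lra.
by rewrite -v1.
Qed.

Section Identity.
Variables (R : realType) (m : nat).
Implicit Types (F G : seq 'I_m -> 'rV[R]_m -> R) (U : set 'rV[R]_m).

(** Taylor expansion along the segment from [p] to [y], all of whose
    coefficients vanish: the Cauchy estimates beat the remainder as long as [y]
    is within a distance of [p] that only depends on the constants. *)
Lemma taylor_vanish F (c p y : 'rV[R]_m) (r C A : R) :
  jet (cube c r) F -> cauchy_bound (cube c r) C A F -> 0 <= A ->
  cube c r p -> cube c r y -> 2 * A * l1dist p y < 1 ->
  (forall l, F l p = 0) -> forall l, F l y = 0.
Proof.
move=> jF bF A0 cp cy small Fp l.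
have C0 := cauchy_bound_ge0 bF cp.
have aF : ajet (cube c r) F by exact: (bounded_jet_ajet (@open_cube _ _ _ _) jF bF).
pose v := y - p; pose gam (s : R) := s *: v + p.
have gamU s : 0 <= s <= 1 -> cube c r (gam s) by move=> s01; exact: cube_convex.
pose S := l1dist p y; have S0 : 0 <= S by exact: l1dist_ge0.
pose M k := C * A ^+ k * k`!%:R.
have M0 k : 0 <= M k by rewrite !mulr_ge0// exprn_ge0.
have key q : forall l (s : R), 0 <= s <= 1 ->
    `|F l (gam s)| <= M (size l + q)%N * S ^+ q * s ^+ q / q`!%:R.
  elim: q => [|q IH] {}l s s01.
    by rewrite addn0 fact0 invr1 !mulr1; apply: bF; exact: gamU.
  have := @derivative_power_bound R (fun s => F l (gam s))
    (fun s => \sum_i F (rcons l i) (gam s) * v 0 i)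
    (M (size l + q.+1)%N * S ^+ q.+1 / q`!%:R) q _ _ _ s s01.
  have -> : M (size l + q.+1)%N * S ^+ q.+1 / q`!%:R * s ^+ q.+1 / q.+1%:R =
     M (size l + q.+1)%N * S ^+ q.+1 * s ^+ q.+1 / q.+1`!%:R.
    rewrite factS natrM; field; rewrite nat1r !pnatr_eq0/= -lt0n fact_gt0//.
  apply.
  - move=> t t01; apply: (ajet_chain _ aF); first exact: gamU.
    exact: is_derive_affine.
  - by rewrite /gam scale0r add0r.
  - move=> t t01; apply: (le_trans (ler_norm_sum _ _ _)).
    rewrite exprS.
    have -> : M (size l + q.+1)%N * (S * S ^+ q) / q`!%:R * t ^+ q =
      \sum_i (M (size l + q.+1)%N * S ^+ q * t ^+ q / q`!%:R * `|v 0 i|).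
      rewrite -mulr_sumr.
      have -> : \sum_i `|v 0 i| = S by apply: eq_bigr => i _; rewrite !mxE.
      by field; rewrite pnatr_eq0 -lt0n fact_gt0.
    apply: ler_sum => i _; rewrite normrM; apply: ler_wpM2r => //.
    by have := IH (rcons l i) t t01; rewrite size_rcons addSnnS.
have key2 q : `|F l y| <= C * (2 * A) ^+ size l * (size l)`!%:R * (2 * A * S) ^+ q.
  have := key q l 1; rewrite lexx ler01 => /(_ isT).
  have -> : gam 1 = y by rewrite /gam scale1r subrK.
  move=> /le_trans; apply; rewrite expr1n mulr1 ler_pdivrMr ?ltr0n ?fact_gt0//.
  rewrite /M exprD [(2 * A) ^+ _]exprMn.
  have -> : (2 * A * S) ^+ q = 2 ^+ q * A ^+ q * S ^+ q by rewrite !exprMn.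
  apply: (@le_trans _ _ (C * (A ^+ size l * A ^+ q) * S ^+ q *
     (2 ^ (size l + q) * ((size l)`! * q`!))%:R)).
    rewrite -!mulrA; do 3?[apply: ler_wpM2l; first by rewrite ?exprn_ge0].
    rewrite mulrC; apply: ler_wpM2l; first by rewrite exprn_ge0.
    by rewrite ler_nat fact_add_le.
  by apply: ler_of_eq; rewrite !natrM natrX exprD; ring.
have cv : (fun q => C * (2 * A) ^+ size l * (size l)`!%:R * (2 * A * S) ^+ q)
    @ \oo --> (0 : R).
  rewrite -[X in _ --> X](mulr0 (C * (2 * A) ^+ size l * (size l)`!%:R)).
  apply: cvgM; first exact: cvg_cst.
  by apply: cvg_expr; rewrite ger0_norm// !mulr_ge0.
apply/normr0_eq0/le_anti; rewrite normr_ge0 andbT.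
rewrite -(cvg_lim _ cv)//; apply: limr_ge; first by apply/cvg_ex; eexists; exact: cv.
by near=> q.
Unshelve. all: by end_near. Qed.

(** The set of points of a segment where the whole jet vanishes is open and
    closed. *)
Theorem ajet_identity F (c p y : 'rV[R]_m) (r : R) :
  ajet (cube c r) F -> cube c r p -> (forall l, F l p = 0) ->
  cube c r y -> forall l, F l y = 0.
Proof.
move=> aF cp Fp cy.
pose gam (s : R) := s *: (y - p) + p.
suff : forall l, F l (gam 1) = 0 by rewrite /gam scale1r subrK.
apply: (@unit_interval_propagation R (fun s => forall l, F l (gam s) = 0)).
  by rewrite /gam scale0r add0r.
move=> s s01; have Us : cube c r (gam s) by exact: cube_convex.
have [r1 [C [A [r10 r1U bF]]]] := aF.2 _ Us.
have {}bF := cauchy_bound_norm bF.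
pose S := l1dist p y; have S0 : 0 <= S by exact: l1dist_ge0.
have dist u v : l1dist (gam u) (gam v) = `|v - u| * S.
  rewrite /S /l1dist mulr_sumr; apply: eq_bigr => i _.
  by rewrite !mxE -normrM; congr `|_|; ring.
have coord u v i : `|gam v 0 i - gam u 0 i| <= `|v - u| * S.
  rewrite -dist /l1dist (bigD1 i)//= lerDl; exact: sumr_ge0.
(* points of the segment within [d] of [gam s] are within the reach of
   [taylor_vanish] from each other *)
pose d := Num.min (r1 / (S + 1)) (8 * (`|A| * S + 1))^-1.
have AS0 : 0 <= `|A| * S by rewrite mulr_ge0.
have d0 : 0 < d.
  by rewrite lt_min divr_gt0 ?ltr_wpDl//= invr_gt0 mulr_gt0// ltr_wpDl.
exists d => // u v u01 v01; rewrite !lt_min => /andP[ur uA] /andP[vr vA] Pu.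
have inr w : `|w - s| < r1 / (S + 1) -> cube (gam s) r1 (gam w).
  rewrite ltr_pdivlMr ?ltr_wpDl// => H i; apply: le_lt_trans (coord s w i) _.
  by apply: le_lt_trans H; rewrite ler_wpM2l// lerDl.
apply: (@taylor_vanish F (gam s) (gam u) (gam v) r1 C `|A|) => //.
- exact: jet_sub aF.1.
- exact: inr.
- exact: inr.
rewrite dist.
have : `|v - u| <= `|u - s| + `|v - s|.
  have -> : v - u = (v - s) - (u - s) by ring.
  by rewrite [leRHS]addrC; exact: ler_normB.
rewrite invfM in uA vA.
have X : `|v - s| * (`|A| * S + 1) < 8^-1.
  by rewrite -ltr_pdivlMr// ltr_wpDl.
have Y : `|u - s| * (`|A| * S + 1) < 8^-1.
  by rewrite -ltr_pdivlMr// ltr_wpDl.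
move=> Z; have : `|v - u| * (`|A| * S + 1) <= (`|u - s| + `|v - s|) * (`|A| * S + 1).
  by rewrite ler_wpM2r// addr_ge0.
have : 0 <= `|v - u| by [].
lra.
Qed.
End Identity.

(** * Second derivatives and implicit curves *)

Section JetCalculus.
Variables (R : realType) (m : nat).
Implicit Types (F G : seq 'I_m -> 'rV[R]_m -> R) (U : set 'rV[R]_m).

Lemma coord_delta (s : R) (i j : 'I_m) : (s *: delta_mx 0 i : 'rV[R]_m) 0 j =
  if j == i then s else 0.
Proof. by rewrite !mxE eqxx/=; case: eqP; rewrite ?mulr1 ?mulr0. Qed.

Lemma cube_move2 (x : 'rV[R]_m) (r s t : R) (i j : 'I_m) : `|s| + `|t| < r ->
  cube x r (s *: delta_mx 0 i + (t *: delta_mx 0 j + x)).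
Proof.
move=> st k; rewrite mxE coord_delta mxE coord_delta addrA addrK.
apply: le_lt_trans st; apply: (le_trans (ler_normD _ _)).
by apply: lerD; case: ifP => // _; rewrite normr0.
Qed.

(** Both mixed derivatives are values, at points close to [x], of the same
    second difference divided by [h^2]. *)
Lemma ajet_symmetric U F l x i j : ajet U F -> U x ->
  F (rcons (rcons l i) j) x = F (rcons (rcons l j) i) x.
Proof.
move=> aF Ux.
have close e : 0 < e ->
    `|F (rcons (rcons l i) j) x - F (rcons (rcons l j) i) x| <= 2 * e.
  move=> e0.
  have [r1 [r10 r1U c1]] := ajet_near (rcons (rcons l i) j) aF Ux e0.
  have [r2 [r20 r2U c2]] := ajet_near (rcons (rcons l j) i) aF Ux e0.
  pose h := Num.min r1 r2 / 4.
  have rr : 0 < Num.min r1 r2 by rewrite lt_min r10.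
  have h0 : 0 < h by rewrite divr_gt0.
  have inc r a b s t : h + h < r -> `|s| <= `|h| -> `|t| <= `|h| ->
      cube x r (s *: delta_mx 0 a + (t *: delta_mx 0 b + x)).
    rewrite (gtr0_norm h0) => hr sh th; apply: cube_move2.
    by apply: le_lt_trans hr; exact: lerD.
  have h1 : h + h < r1.
    have : Num.min r1 r2 <= r1 by rewrite ge_min lexx.
    rewrite /h; lra.
  have h2 : h + h < r2.
    have : Num.min r1 r2 <= r2 by rewrite ge_min lexx orbT.
    rewrite /h; lra.
  pose Q := F l (h *: delta_mx 0 i + (h *: delta_mx 0 j + x))
    - F l (h *: delta_mx 0 i + x) - (F l (h *: delta_mx 0 j + x) - F l x).
  have half a b r : cube x r `<=` U -> h + h < r -> exists2 z, cube x r z &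
      F l (h *: delta_mx 0 a + (h *: delta_mx 0 b + x))
      - F l (h *: delta_mx 0 a + x) - (F l (h *: delta_mx 0 b + x) - F l x) =
      F (rcons (rcons l a) b) z * h * h.
    move=> rU hr.
    pose u s := F l (s *: delta_mx 0 a + (h *: delta_mx 0 b + x))
      - F l (s *: delta_mx 0 a + x).
    pose du s := F (rcons l a) (s *: delta_mx 0 a + (h *: delta_mx 0 b + x))
      - F (rcons l a) (s *: delta_mx 0 a + x).
    have h00 : `|0 : R| <= `|h| by rewrite normr0.
    have [s sh|c ch] := @mvt0 R u du h.
      apply: is_deriveB; apply: (@is_derive_line _ _ _ (F l)); apply: aF.1; apply: rU.
        exact: inc.
      by have := inc r a b s 0 hr sh h00; rewrite scale0r add0r.
    rewrite /u !scale0r !add0r => E.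
    have [s sh|c' ch'] := @mvt0 R
        (fun s => F (rcons l a) (s *: delta_mx 0 b + (c *: delta_mx 0 a + x)))
        (fun s => F (rcons (rcons l a) b) (s *: delta_mx 0 b + (c *: delta_mx 0 a + x))) h.
      by apply: (@is_derive_line _ _ _ (F (rcons l a))); apply: aF.1; apply: rU; exact: inc.
    rewrite scale0r add0r => E'.
    exists (c' *: delta_mx 0 b + (c *: delta_mx 0 a + x)); first exact: inc.
    rewrite E; congr (_ * _); rewrite /du -E'; congr (F _ _ - _).
    by rewrite addrCA.
  have [z xz Ez] := half i j r1 r1U h1.
  have [y xy Ey] := half j i r2 r2U h2.
  have E : F (rcons (rcons l i) j) z = F (rcons (rcons l j) i) y.
    have hh : h * h != 0 by rewrite mulf_neq0// gt_eqF.
    move: Ez Ey; rewrite -!(mulrA _ h h) => Ez Ey; apply: (mulIf hh) => /=; rewrite -Ez -Ey.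
    by rewrite [h *: delta_mx 0 j + (h *: _ + _)]addrCA; ring.
  have := c1 z xz; have := c2 y xy; rewrite E.
  set p := F _ y; set a := F _ x; set b := F _ x.
  move=> P1 P2; have -> : b - a = (p - a) - (p - b) by ring.
  by rewrite (le_trans (ler_normB _ _))// mulr_natl mulr2n lerD.
apply/eqP; rewrite -subr_eq0 -normr_le0; apply/ler_addgt0Pl => e e0.
by rewrite addr0; have := close (e / 2); rewrite divr_gt0// mulrC divfK//; apply.
Qed.

(** A solution that is off by at most [L h^2] from the linearised one is found
    by the intermediate value theorem for each [h] separately, which already
    makes any choice of solutions differentiable at [0]. *)
Lemma implicit_curve U F l p i k : open U -> ajet U F -> U p -> F l p = 0 ->
  F (rcons l k) p != 0 ->
  exists lam : R -> R, [/\ lam 0 = 0,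
    is_derive (0 : R) (1 : R) lam (- F (rcons l i) p / F (rcons l k) p) &
    \forall h \near (0 : R),
      F l (h *: delta_mx 0 i + (lam h *: delta_mx 0 k + p)) = 0].
Proof.
move=> oU aF Up Fp0 fk0.
have [r [K [r0 K0 rU Q]]] := ajet_quadratic l aF Up.
set fi := F (rcons l i) p; set fk := F (rcons l k) p in fk0 *.
pose c := - fi / fk; pose sg := m%:R * (1 + (`|c| + 1)) : R.
have sg0 : 0 <= sg by rewrite mulr_ge0// !addr_ge0.
have nfk : 0 < `|fk| by rewrite normr_gt0.
(* at distance [L h^2] from the linearised solution, the linear part of [F l]
   dominates the quadratic error *)
pose L := (K * sg ^+ 2 + 1) / `|fk|.
have KS0 : 0 <= K * sg ^+ 2 by rewrite mulr_ge0// sqr_ge0.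
have L0 : 0 < L by rewrite divr_gt0// ltr_wpDl.
pose B := 1 + (`|c| + 1); have B0 : 0 < B by rewrite /B addr_gt0// ltr_wpDl.
pose d := Num.min (r / B) L^-1.
have d0 : 0 < d by rewrite lt_min divr_gt0//= invr_gt0.
pose pt (h s : R) := h *: delta_mx 0 i + (s *: delta_mx 0 k + p).
have small h s : `|h| < d -> `|s - c * h| <= L * h ^+ 2 ->
    `|h| + `|s| <= B * `|h|.
  rewrite lt_min => /andP[_ hL] hs; rewrite mulrDl mul1r lerD2l.
  have -> : s = (s - c * h) + c * h by rewrite subrK.
  rewrite (le_trans (ler_normD _ _))// normrM addrC mulrDl lerD2l.
  apply: (le_trans hs); rewrite -real_normK ?num_real// expr2 mulrA ler_wpM2r//.
  by rewrite mulrC -ler_pdivlMr// mul1r ltW.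
have inU h s : `|h| < d -> `|s - c * h| <= L * h ^+ 2 -> cube p r (pt h s).
  move=> hd hs; apply: cube_move2; apply: le_lt_trans (small h s hd hs) _.
  by move: hd; rewrite lt_min => /andP[+ _]; rewrite ltr_pdivlMr// mulrC.
have est h s : `|h| < d -> `|s - c * h| <= L * h ^+ 2 ->
    `|F l (pt h s) - (h * fi + s * fk)| <= K * sg ^+ 2 * h ^+ 2.
  move=> hd hs; have := Q _ (inU h s hd hs).
  have co j : (pt h s) 0 j - p 0 j =
      (if j == i then h else 0) + (if j == k then s else 0).
    by rewrite mxE coord_delta mxE coord_delta addrA addrK.
  have -> : \sum_j F (rcons l j) p * ((pt h s) 0 j - p 0 j) = h * fi + s * fk.
    under eq_bigr do rewrite co mulrDr; rewrite big_split/=.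
    rewrite (bigD1 i)//= eqxx [X in _ + X + _]big1 => [|j /negPf ->];
      last by rewrite mulr0.
    rewrite [X in _ + X](bigD1 k)//= eqxx [X in _ + (_ + X)]big1 => [|j /negPf ->];
      last by rewrite mulr0.
    by rewrite !addr0 mulrC [_ * s]mulrC.
  rewrite Fp0 subr0 => /le_trans; apply; rewrite -mulrA ler_wpM2l//.
  rewrite -exprMn -[leRHS]real_normK ?num_real// lerXn2r ?nnegrE ?l1dist_ge0//.
  rewrite normrM (ger0_norm sg0) /sg -mulrA.
  apply: (@le_trans _ _ (\sum_(j < m) B * `|h|)).
    apply: ler_sum => j _; apply: le_trans (small h s hd hs).
    rewrite co (le_trans (ler_normD _ _))// lerD//; case: ifP => // _.
      by rewrite normr0.
    by rewrite normr0.
  by rewrite sumr_const card_ord -[leLHS]mulr_natl.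
have root h : exists s, `|h| < d -> `|s - c * h| <= L * h ^+ 2 /\ F l (pt h s) = 0.
  have [hd|hd] := ltP `|h| d; last by exists 0.
  have h20 : 0 <= L * h ^+ 2 by rewrite mulr_ge0 ?sqr_ge0// ltW.
  pose s1 := c * h - L * h ^+ 2; pose s2 := c * h + L * h ^+ 2.
  have s12 : s1 <= s2 by rewrite lerD2l (ge0_cp h20).
  have near_s s : s1 <= s <= s2 -> `|s - c * h| <= L * h ^+ 2.
    by rewrite ler_distl.
  have E1 : h * fi + s1 * fk = - (L * fk) * h ^+ 2.
    by rewrite /s1 /c; field.
  have E2 : h * fi + s2 * fk = L * fk * h ^+ 2.
    by rewrite /s2 /c; field.
  have Lfk : L * `|fk| = K * sg ^+ 2 + 1 by rewrite divfK// gt_eqF.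
  have P1 := est h s1 hd (near_s s1 _).
  have P2 := est h s2 hd (near_s s2 _).
  have [||s sI Fs] := @IVT R (fun s => F l (pt h s)) s1 s2 0 s12.
  - apply: continuous_in_subspaceT => s /[!inE]/=; rewrite in_itv/= => sI.
    have dpt : is_derive s (1 : R) (pt h) (delta_mx 0 k).
      have -> : pt h = (fun s => s *: delta_mx 0 k + (h *: delta_mx 0 i + p)).
        by apply/funext => z; rewrite /pt addrCA.
      exact: is_derive_affine.
    have ptU : U (pt h s) by apply: rU; apply: inU => //; exact: near_s.
    exact: (is_derive1_continuous (ajet_chain l aF ptU dpt)).
  - have h2 : 0 <= h ^+ 2 by exact: sqr_ge0.
    have key : K * sg ^+ 2 * h ^+ 2 <= L * `|fk| * h ^+ 2.
      by rewrite Lfk mulrDl mul1r lerDl.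
    rewrite E1 in P1; rewrite E2 in P2.
    have /ler_normlP[P11 P12] : `|F l (pt h s1) - - (L * fk) * h ^+ 2| <= K * sg ^+ 2 * h ^+ 2.
      by apply: P1; rewrite lexx.
    have /ler_normlP[P21 P22] : `|F l (pt h s2) - L * fk * h ^+ 2| <= K * sg ^+ 2 * h ^+ 2.
      by apply: P2; rewrite lexx andbT.
    move: key P11 P12 P21 P22; rewrite ge_min le_max mulNr.
    set X := _ * _ * h ^+ 2; set f1 := F l _; set f2 := F l _.
    have [fk_ge0|fk_lt0] := leP 0 fk.
      rewrite ger0_norm// -/X; clearbody X f1 f2; clear => *.
      by apply/andP; split; apply/orP; [left|right]; lra.
    rewrite ltr0_norm// mulrN mulNr; clearbody f1 f2.
    set Y := L * fk * _; clearbody X Y; clear => *.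
    by apply/andP; split; apply/orP; [right|left]; lra.
  - by exists s => _; split=> //; apply: near_s; rewrite in_itv/= in sI.
have [lam lamP] := choice root.
have lam0 : lam 0 = 0.
  have [|H _] := lamP 0; first by rewrite normr0.
  by move: H; rewrite expr0n/= !mulr0 subr0 normr_le0 => /eqP.
exists lam; split=> //.
  apply/is_derive_epsP => e e0; exists (Num.min d (e / L)).
    by rewrite lt_min d0 divr_gt0.
  move=> h; rewrite lt_min => /andP[hd he].
  rewrite lam0 subr0 addr0.
  have -> : h *: (1 : R) = h by rewrite /GRing.scale/= mulr1.
  have -> : lam h - h *: (- fi / fk) = lam h - c * h.
    by rewrite /c /GRing.scale/= mulrC.
  have [H _] := lamP h hd; apply: (le_trans H).
  rewrite -real_normK ?num_real// expr2 mulrA ler_wpM2r//.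
  by rewrite mulrC -ler_pdivlMr// ltW.
exists d => //= h; rewrite /ball_/= sub0r normrN => hd.
exact: (lamP h hd).2.
Qed.

Lemma is_derive_graph (lam : R -> R) (c : R) (p : 'rV[R]_m) i k t :
  is_derive t (1 : R) lam c ->
  is_derive t (1 : R) (fun h => h *: delta_mx 0 i + (lam h *: delta_mx 0 k + p))
    (delta_mx 0 i + c *: delta_mx 0 k : 'rV[R]_m).
Proof.
move=> dlam.
have H1 : is_derive t (1 : R) (fun h => h *: delta_mx 0 i : 'rV[R]_m) (delta_mx 0 i).
  have := is_derive_affine (delta_mx 0 i : 'rV[R]_m) 0 t.
  by under eq_fun do rewrite addr0.
have H2 : is_derive t (1 : R) (fun h => lam h *: delta_mx 0 k + p : 'rV[R]_m)
    (c *: delta_mx 0 k).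
  move: dlam => /is_derive_epsP H; apply/is_derive_epsP => e e0.
  pose M := `|delta_mx 0 k : 'rV[R]_m| + 1.
  have M0 : 0 < M by rewrite ltr_wpDl.
  have [|s s0 Hs] := H (e / M); first by rewrite divr_gt0.
  exists s => // h /Hs{}Hs.
  have E (a b : R) : a *: delta_mx 0 k + p - (b *: delta_mx 0 k + p) =
      (a - b) *: (delta_mx 0 k : 'rV[R]_m).
    by rewrite opprD addrACA subrr addr0 scalerBl.
  rewrite E scalerA -scalerBl normrZ.
  apply: (@le_trans _ _ (e / M * `|h| * M)).
    by apply: ler_pM => //; rewrite lerDl.
  by rewrite mulrAC divfK// gt_eqF.
exact: (is_deriveD H1 H2).
Qed.

Lemma sum_delta2 (g : 'I_m -> R) (c : R) i k :
  \sum_j g j * (delta_mx 0 i + c *: delta_mx 0 k : 'rV[R]_m) 0 j = g i + c * g k.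
Proof.
under eq_bigr do rewrite mxE coord_delta mxE eqxx/= mulrDr.
rewrite big_split/= (bigD1 i)//= eqxx mulr1 big1 => [|j /negPf ->];
      last by rewrite mulr0.
rewrite (bigD1 k)//= eqxx [X in _ + (_ + X)]big1 => [|j /negPf ->];
      last by rewrite mulr0.
by rewrite !addr0 mulrC.
Qed.

(** [G] is constant along the curves in [F = 0] that [implicit_curve] provides
    in the plane of the directions [i] and [k]. *)
Lemma gradient_parallel U F l G l' p i k : open U -> ajet U F -> ajet U G -> U p ->
  F l p = 0 -> F (rcons l k) p != 0 ->
  (forall y, U y -> F l y = 0 -> G l' y = 0) ->
  G (rcons l' i) p = G (rcons l' k) p * (F (rcons l i) p / F (rcons l k) p).
Proof.
move=> oU aF aG Up Fp Fk FG.
have [lam [lam0 dlam Flam]] := implicit_curve i oU aF Up Fp Fk.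
have dgam := is_derive_graph p i k dlam.
set c := - _ / _ in dlam dgam; set gam := (fun h : R => _) in dgam.
have gam0 : gam 0 = p by rewrite /gam lam0 !scale0r !add0r.
have gU : U (gam 0) by rewrite gam0.
have dG := ajet_chain l' aG gU dgam.
have Unear : \forall s \near (0 : R), U (gam s).
  by apply: (is_derive1_continuous dgam); exact: open_nbhs_nbhs.
have Z : \forall s \near (0 : R), G l' (gam s) = cst 0 s.
  by near=> s; apply: FG; near: s.
have [_ dE] := near_eq_is_derive Z dG.
move: dE; rewrite derive_cst gam0 sum_delta2 => /esym/eqP.
rewrite addr_eq0 => /eqP ->; rewrite /c; ring.
Unshelve. all: by end_near. Qed.
End JetCalculus.

(** * Uniqueness for the Cauchy problem *)

Section CauchyUniqueness.
Variables (R : realType) (m : nat).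
Implicit Types (F G Phi : seq 'I_m -> 'rV[R]_m -> R) (U : set 'rV[R]_m).

Lemma jet_ext U F l G l' i x : open U -> jet U F -> jet U G ->
  (forall y, U y -> F l y = G l' y) -> U x -> F (rcons l i) x = G (rcons l' i) x.
Proof.
move=> oU jF jG FG Ux.
have E : \forall y \near x, F l y = G l' y.
  by apply: filterS (open_nbhs_nbhs (conj oU Ux)) => y Uy; exact: FG.
by have [_ <-] := jF l i x Ux; have [_ <-] := jG l' i x Ux; exact: near_eq_derive.
Qed.

Lemma jetlap_djet n (sig : 'I_n -> 'I_m) U G i x : open U -> ajet U G ->
  (forall y, U y -> jetlap sig G y = 0) -> U x -> jetlap sig (djet i G) x = 0.
Proof.
move=> oU aG GL Ux.
have -> : jetlap sig (djet i G) x = \sum_j G [:: sig j; sig j; i] x.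
  apply: eq_bigr => j _; rewrite /djet.
  rewrite (@ajet_symmetric _ _ U G [:: sig j] x (sig j) i aG Ux).
  apply: (@jet_ext U G [:: i; sig j] G [:: sig j; i] (sig j) x) => //; try exact: aG.1.
  by move=> y Uy; exact: (@ajet_symmetric _ _ U G [::] y i (sig j) aG Uy).
have D : is_derive x (delta_mx 0 i) (jetlap sig G) (\sum_j G [:: sig j; sig j; i] x).
  by apply: is_derive_bigsum => j; exact: (aG.1 [:: sig j; sig j] i x Ux).
have E : \forall y \near x, jetlap sig G y = cst 0 y.
  by apply: filterS (open_nbhs_nbhs (conj oU Ux)) => y Uy; exact: GL.
by have [_ <-] := near_eq_is_derive E D; rewrite derive_cst.
Qed.

Lemma jet_vanish U F : open U -> jet U F -> (forall x, U x -> F [::] x = 0) ->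
  forall l x, U x -> F l x = 0.
Proof.
move=> oU jF F0; elim/last_ind => [|l i IH] // x Ux.
pose Z : seq 'I_m -> 'rV[R]_m -> R := fun l x => if l is [::] then 0 else 0.
have -> // : F (rcons l i) x = Z (rcons [::] i) x.
by apply: (@jet_ext U F l Z [::]) => //; exact: (bjet_const U 0).1.
Qed.

(** The Hessian of a function with vanishing gradient on a hypersurface is a
    multiple of [nu nu^T], and a harmonic function leaves no room for it. *)
Lemma hessian_vanish U Phi G p k i j : open U -> ajet U Phi -> ajet U G -> U p ->
  Phi [::] p = 0 -> Phi [:: k] p != 0 ->
  (forall y, U y -> Phi [::] y = 0 -> forall i, G [:: i] y = 0) ->
  jetlap id G p = 0 -> G [:: i; j] p = 0.
Proof.
move=> oU aP aG Up P0 Pk G0 GL.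
pose nu i := Phi [:: i] p / Phi [:: k] p.
have par a b : G [:: a; b] p = G [:: a; k] p * nu b.
  exact: (@gradient_parallel _ _ U Phi [::] G [:: a] p b k oU aP aG Up P0 Pk
    (fun y Uy Py => G0 y Uy Py a)).
have sym a b : G [:: a; b] p = G [:: b; a] p by exact: (@ajet_symmetric _ _ U G [::] p a b).
have full a b : G [:: a; b] p = G [:: k; k] p * nu a * nu b.
  by rewrite par sym par.
have : G [:: k; k] p * \sum_a nu a ^+ 2 = 0.
  rewrite -[RHS]GL mulr_sumr; apply: eq_bigr => a _.
  by rewrite [RHS]full expr2 mulrA.
move/eqP; rewrite mulf_eq0 => /orP[/eqP Gkk|]; first by rewrite full Gkk !mul0r.
rewrite psumr_eq0; last by move=> a _; exact: sqr_ge0.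
move=> /allP/(_ k (mem_index_enum _)).
by rewrite /nu divff// expr1n oner_eq0.
Qed.

(** Each derivative of a harmonic function is harmonic, so that
    [hessian_vanish] can be applied again and again. *)
Lemma cauchy_data_vanish U Phi k : open U -> ajet U Phi ->
  (forall y, U y -> Phi [:: k] y != 0) ->
  forall l G, ajet U G -> (forall y, U y -> jetlap id G y = 0) ->
  (forall y, U y -> Phi [::] y = 0 -> G [::] y = 0 /\ forall j, G [:: j] y = 0) ->
  forall y, U y -> Phi [::] y = 0 -> G l y = 0.
Proof.
move=> oU aP Pk; elim=> [|i l IH] G aG GL G0 y Uy Py; first by case: (G0 y Uy Py).
apply: (IH (djet i G)) => //; first exact: ajet_djet.
  by move=> z Uz; exact: (@jetlap_djet _ id U).
move=> z Uz Pz; split=> [|j]; first exact: (G0 z Uz Pz).2.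
apply: (@hessian_vanish U Phi G z k i j) => //; [exact: Pk| |exact: GL].
by move=> x Ux Px; exact: (G0 x Ux Px).2.
Qed.

Theorem cauchy_uniqueness (c p y : 'rV[R]_m) (r : R) Phi G k :
  ajet (cube c r) Phi -> ajet (cube c r) G ->
  (forall z, cube c r z -> Phi [:: k] z != 0) ->
  (forall z, cube c r z -> jetlap id G z = 0) ->
  (forall z, cube c r z -> Phi [::] z = 0 ->
    G [::] z = 0 /\ forall j, G [:: j] z = 0) ->
  cube c r p -> Phi [::] p = 0 -> cube c r y -> forall l, G l y = 0.
Proof.
move=> aP aG Pk GL G0 cp Pp cy l.
apply: (@ajet_identity _ _ G c p y r) => // l'.
exact: (@cauchy_data_vanish (cube c r) Phi k (@open_cube _ _ _ _)).
Qed.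
End CauchyUniqueness.

(** * Iterated partial derivatives of analytic functions *)

Section AnalyticFunctions.
Variables (R : realType) (n : nat).

Fixpoint partials (l : seq 'I_n) (f : 'rV[R]_n -> R) : 'rV[R]_n -> R :=
  if l is i :: l' then partials l' (partial i f) else f.

Lemma jet_partials U F f : open U -> jet U F -> (forall x, U x -> F [::] x = f x) ->
  forall l x, U x -> F l x = partials l f x.
Proof.
move=> oU jF Ff l; elim: l F f jF Ff => [|i l IH] F f jF Ff x Ux; first exact: Ff.
apply: (IH (djet i F)) => //; first exact: jet_djet.
move=> y Uy; rewrite /partial /djet; have [_ /= <-] := jF [::] i y Uy.
apply: near_eq_derive; apply: filterS (open_nbhs_nbhs (conj oU Uy)) => z Uz.
exact: Ff.
Qed.

Lemma analytic_ajet U (f : 'rV[R]_n -> R) : open U ->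
  (forall x, U x -> analytic_at f x) -> ajet U (fun l => partials l f).
Proof.
move=> oU af.
have loc x : U x -> exists r F, [/\ 0 < r, cube x r `<=` U, bjet (cube x r) F &
    forall l y, cube x r y -> F l y = partials l f y].
  move=> Ux; have [r [F [r0 bF Ff]]] := analytic_at_bjet (af x Ux).
  have [s s0 sU] : exists2 s, 0 < s & cube x s `<=` U.
    by apply: nbhs_cube; exact: open_nbhs_nbhs.
  have sub : cube x (Num.min r s) `<=` cube x r by apply: cube_sub; rewrite ge_min lexx.
  exists (Num.min r s), F; split=> //.
  - by rewrite lt_min r0.
  - by apply: subset_trans sU; apply: cube_sub; rewrite ge_min lexx orbT.
  - exact: bjet_sub bF.
  - apply: jet_partials; [exact: open_cube|exact: jet_sub bF.1|].
    by move=> y /sub; exact: Ff.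
split=> [l i x Ux|x Ux]; have [r [F [r0 rU bF Ff]]] := loc x Ux.
  rewrite -Ff; last exact: cube_center.
  apply: near_eq_is_derive (bF.1 l i x (cube_center x r0)).
  by apply: filterS (cube_nbhs x r0) => y; exact: Ff.
case: bF => _ [C [A [C0 A0 FC]]]; exists r, C, A; split=> // l y xy.
by rewrite -Ff//; exact: FC.
Qed.
End AnalyticFunctions.

(** * Time slices of space-time jets *)

Section Slice.
Variables (R : realType) (n : nat).

Definition spacetime (x : 'rV[R]_n) (s : R) : 'rV[R]_(n + 1) := row_mx x (const_mx s).

Definition slice (s : R) (F : seq 'I_(n + 1) -> 'rV[R]_(n + 1) -> R) :
    seq 'I_n -> 'rV[R]_n -> R :=
  fun l x => F (map (lshift 1) l) (spacetime x s).

Lemma coord_addscale m (h : R) (A B : 'rV[R]_m) j :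
  (h *: A + B) 0 j = h * A 0 j + B 0 j.
Proof. by rewrite !mxE. Qed.

Lemma spacetime_coordl (x : 'rV[R]_n) s k : spacetime x s 0 (lshift 1 k) = x 0 k.
Proof. by rewrite /spacetime row_mxEl. Qed.

Lemma spacetime_coordr (x : 'rV[R]_n) s k : spacetime x s 0 (rshift n k) = s.
Proof. by rewrite /spacetime row_mxEr mxE. Qed.

Lemma coord_unit m (i j : 'I_m) : (delta_mx 0 i : 'rV[R]_m) 0 j = (j == i)%:R.
Proof. by rewrite mxE eqxx. Qed.

Lemma spacetime_move (x : 'rV[R]_n) (h s : R) i :
  spacetime (h *: delta_mx 0 i + x) s = h *: delta_mx 0 (lshift 1 i) + spacetime x s.
Proof.
apply/rowP => j; case: (split_ordP j) => k ->; rewrite coord_addscale coord_unit.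
  by rewrite !spacetime_coordl coord_addscale coord_unit (inj_eq (@lshift_inj _ _)).
by rewrite !spacetime_coordr eq_sym eq_lrshift mulr0 add0r.
Qed.

Lemma spacetime_wait (x : 'rV[R]_n) (h s : R) :
  spacetime x (h + s) = h *: delta_mx 0 (rshift n ord0) + spacetime x s.
Proof.
apply/rowP => j; case: (split_ordP j) => k ->; rewrite coord_addscale coord_unit.
  by rewrite !spacetime_coordl eq_lrshift mulr0 add0r.
by rewrite !spacetime_coordr !ord1 eqxx mulr1.
Qed.

Lemma cube_spacetime (a x : 'rV[R]_n) (t s r : R) :
  cube a r x -> `|s - t| < r -> cube (spacetime a t) r (spacetime x s).
Proof.
move=> ax st j; case: (split_ordP j) => k ->; first by rewrite !spacetime_coordl.
by rewrite !spacetime_coordr.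
Qed.

Lemma ajet_slice (a : 'rV[R]_n) (t s r : R) F :
  ajet (cube (spacetime a t) r) F -> `|s - t| < r -> ajet (cube a r) (slice s F).
Proof.
move=> aF st; split=> [l i x ax|x ax].
  rewrite /slice map_rcons; apply/is_derive_epsP => e e0.
  have /is_derive_epsP /(_ e e0)[d d0 H] :=
    aF.1 (map (lshift 1) l) (lshift 1 i) _ (cube_spacetime ax st).
  by exists d => // h /H; rewrite spacetime_move.
have [d [C [A [d0 dU bF]]]] := aF.2 _ (cube_spacetime ax st).
have [d' d'0 d'U] : exists2 d', 0 < d' & cube x d' `<=` cube a r.
  by apply: nbhs_cube; apply: open_nbhs_nbhs; split=> //; exact: open_cube.
exists (Num.min d d'), C, A; split.
- by rewrite lt_min d0.
- by apply: subset_trans d'U; apply: cube_sub; rewrite ge_min lexx orbT.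
- move=> l y xy; have := bF (map (lshift 1) l) (spacetime y s).
  rewrite size_map; apply; apply: cube_spacetime; last by rewrite subrr normr0.
  by move=> i; apply: lt_le_trans (xy i) _; rewrite ge_min lexx.
Qed.

Lemma is_derive_spacetime (c : R -> 'rV[R]_n) (v : 'rV[R]_n) (t : R) :
  is_derive t (1 : R) c v ->
  is_derive t (1 : R) (fun s => spacetime (c s) s) (spacetime v 1).
Proof.
move=> /is_derive_epsP H; apply/is_derive_epsP => e /H[d d0 Hd].
exists d => // h /Hd.
have -> : spacetime (c (h *: 1 + t)) (h *: 1 + t) - spacetime (c t) t - h *: spacetime v 1
   = spacetime (c (h *: 1 + t) - c t - h *: v) 0.
  have E m (A B C : 'rV[R]_m) j : (A - B - h *: C) 0 j = A 0 j - B 0 j - h * C 0 j.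
    by rewrite !mxE.
  apply/rowP => j; case: (split_ordP j) => k ->; rewrite E.
    by rewrite !spacetime_coordl E.
  by rewrite !spacetime_coordr /GRing.scale/= !mulr1 addrK subrr.
apply: le_trans; rewrite [leLHS]/Num.Def.normr/= mx_normrE.
apply: bigmax_le => // -[i0 j] _ /=; rewrite ord1.
case: (split_ordP j) => k ->.
  by rewrite spacetime_coordl; exact: row_norm_coord.
by rewrite spacetime_coordr normr0.
Qed.
End Slice.

(** * The Schwarz potential near the moving boundary *)

Section LocalPotential.
Variables (R : realType) (n : nat).
Notation time := (rshift n ord0 : 'I_(n + 1)).
Notation space := (@lshift n 1).

Definition coord_jet m (j : 'I_m) : seq 'I_m -> 'rV[R]_m -> R := fun l x =>
  match l with [::] => x 0 j | [:: i] => (j == i)%:R | _ => 0 end.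

Lemma bjet_coord m (j : 'I_m) (a : 'rV[R]_m) (r : R) : 0 < r ->
  bjet (cube a r) (coord_jet j).
Proof.
move=> r0; split=> [l i x _|].
  case: l => [|i' [|i'' l]] /=; [|exact: is_derive_cst|exact: is_derive_cst].
  apply/is_derive_epsP => e e0; exists 1 => // h _.
  rewrite /= coord_addscale coord_unit addrK /GRing.scale/=.
  by rewrite subrr normr0 mulr_ge0// ltW.
exists (`|a 0 j| + r + 1), 1; split=> //; first by rewrite !addr_ge0// ltW.
have C1 : 1 <= `|a 0 j| + r + 1 by rewrite lerDr addr_ge0// ltW.
have C0 : 0 <= `|a 0 j| + r + 1 by exact: le_trans C1.
move=> [|i [|i' l]] x ax; rewrite /coord_jet.
- rewrite expr0 !mulr1 -[x 0 j](subrK (a 0 j)) (le_trans (ler_normD _ _))//.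
  have := ax j; lra.
- rewrite expr1 !mulr1 /=; apply: le_trans C1.
  by case: eqP => _; rewrite ?normr1// normr0.
- by rewrite normr0 expr1n mulr1 mulr_ge0.
Qed.

Definition halfsq_jet : seq 'I_(n + 1) -> 'rV[R]_(n + 1) -> R := fun l z =>
  \sum_(i < n) 2^-1 * jetmul (coord_jet (space i)) (coord_jet (space i)) l z.

Lemma bjet_halfsq (z : 'rV[R]_(n + 1)) r : 0 < r -> bjet (cube z r) halfsq_jet.
Proof.
move=> r0; apply: bjet_sum => i; apply: bjet_scale.
by apply: bjet_mul; exact: bjet_coord.
Qed.

Lemma halfsq_jet0 x s : halfsq_jet [::] (spacetime x s) = 2^-1 * enorm x ^+ 2.
Proof.
rewrite sqr_sqrtr; last by apply: sumr_ge0 => i _; rewrite -expr2 sqr_ge0.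
by rewrite mulr_sumr; apply: eq_bigr => i _; rewrite /= spacetime_coordl.
Qed.

Lemma halfsq_jet_space x s j : halfsq_jet [:: space j] (spacetime x s) = x 0 j.
Proof.
rewrite /halfsq_jet (bigD1 j)//= big1 => [|i /negPf ij].
  by rewrite /= /djet/= eqxx spacetime_coordl addr0 mul1r mulr1; field.
by rewrite /= /djet/= (inj_eq (@lshift_inj _ _)) ij mul0r mulr0 addr0 mulr0.
Qed.

Lemma halfsq_jet_time x s : halfsq_jet [:: time] (spacetime x s) = 0.
Proof.
by rewrite /halfsq_jet big1// => i _; rewrite /= /djet/= eq_lrshift mul0r mulr0 addr0 mulr0.
Qed.

Variables (T : set R) (Omega : R -> set 'rV[R]_n) (N : set ('rV[R]_n * R)).
Variable w : 'rV[R]_n -> R -> R.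
Let Gamma s := boundary (Omega s).
Hypotheses (openT : open T) (openN : open N).
Hypothesis analyticGamma : analytic_hypersurface_family T Gamma.
Hypothesis schwarz_w : forall t, T t ->
  schwarz_potential (Gamma t) [set x | N (x, t)] (w^~ t).

(** A neighborhood of a boundary point [a] at time [t] where everything is
    described by space-time jets: [Phi] is an equation of the moving boundary,
    with [d Phi / d x_k] nowhere zero, and [W] represents [w] near [a] for all
    times near [t], jointly analytic in space and time. *)
Record local_chart (a : 'rV[R]_n) (t r : R) (k : 'I_n)
    (Phi W : seq 'I_(n + 1) -> 'rV[R]_(n + 1) -> R) : Prop := LocalChart {
  chart_gt0 : 0 < r;
  chart_Phi : ajet (cube (spacetime a t) r) Phi;
  chart_W : ajet (cube (spacetime a t) r) W;
  chart_k : forall z, cube (spacetime a t) r z -> Phi [:: space k] z != 0;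
  chart_Gamma : forall x s, cube a r x -> `|s - t| < r ->
    Gamma s x <-> Phi [::] (spacetime x s) = 0;
  chart_T : forall s, `|s - t| < r -> T s;
  chart_lap : forall z, cube (spacetime a t) r z -> jetlap space W z = 0;
  chart_grad : forall x s j, cube a r x -> `|s - t| < r -> Gamma s x ->
    W [:: space j] (spacetime x s) = x 0 j;
  chart_val : forall x s, cube a r x -> `|s - t| < r -> Gamma s x ->
    W [::] (spacetime x s) = 2^-1 * enorm x ^+ 2;
  chart_w : forall x s, cube a r x -> `|s - t| < r -> w x s = W [::] (spacetime x s)
}.

Lemma nbhs_cube_pair (a : 'rV[R]_n) (t : R) (A : set ('rV[R]_n * R)) :
  nbhs (a, t) A -> exists2 r, 0 < r &
    forall x s, cube a r x -> `|s - t| < r -> A (x, s).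
Proof.
move=> [[B C] /= [/nbhs_cube[r1 r10 r1B] /nbhs_ballP[r2 /= r20 r2C]] BC].
exists (Num.min r1 r2); first by rewrite lt_min r10.
move=> x s ax st; apply: (BC (x, s)); split=> /=.
  by apply: r1B; apply: cube_sub ax; rewrite ge_min lexx.
by apply: r2C; rewrite /ball/= distrC (lt_le_trans st)// ge_min lexx orbT.
Qed.

(** For each time [w] is only known to be analytic in space. The Cauchy problem
    with the moving boundary, solved in space-time, yields a jointly analytic
    [W]; for each nearby time it has the same Cauchy data as [w] on a boundary
    that meets a fixed cube around [a], hence agrees with [w] on that cube. *)
Lemma local_chart_exists t a : T t -> Gamma t a ->
  exists r k Phi W, local_chart a t r k Phi W.
Proof.
move=> Tt Ga; have [phi [aphi gphi Gphi]] := analyticGamma Tt Ga.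
have [r0 [Phi [r00 bPhi PhiE]]] := analytic_at_bjet aphi.
set z0 := row_mx _ _ in bPhi PhiE.
have z0E : z0 = spacetime a t by [].
have {}PhiE x s : cube a r0 x -> `|s - t| < r0 -> Phi [::] (spacetime x s) = phi x s.
  move=> ax st; rewrite PhiE; last exact: cube_spacetime.
  by rewrite /spacetime row_mxKl row_mxKr mxE.
have [r1 r10 Hr1] := nbhs_cube_pair Gphi.
have Nat : N (a, t).
  by have [[_ GN] _ _ _ _] := schwarz_w Tt; exact: GN.
have [r2 r20 Hr2] := nbhs_cube_pair (open_nbhs_nbhs (conj openN Nat)).
have [r3 r30 Hr3] : exists2 r3 : R, 0 < r3 & forall s, `|s - t| < r3 -> T s.
  have /nbhs_ballP[r3 /= r30 Hr3] : nbhs t T by apply: open_nbhs_nbhs.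
  by exists r3 => // s st; apply: Hr3; rewrite /ball/= distrC.
pose r4 := Num.min (Num.min r0 r1) (Num.min r2 r3).
have r40 : 0 < r4 by rewrite !lt_min r00 r10 r20.
have r4r0 : r4 <= r0 by rewrite !ge_min lexx.
have r4r1 : r4 <= r1 by rewrite !ge_min lexx orbT.
have r4r2 : r4 <= r2 by rewrite !ge_min lexx !orbT.
have r4r3 : r4 <= r3 by rewrite !ge_min lexx !orbT.
have bPhi4 := bjet_sub (cube_sub r4r0) bPhi.
have aat : cube a r4 a by exact: cube_center.
have tt : `|t - t| < r4 by rewrite subrr normr0.
have Phi0 : Phi [::] z0 = 0.
  rewrite z0E PhiE ?(lt_le_trans tt)//; last exact: cube_sub aat.
  have := Hr1 a t (cube_sub r4r1 aat) (lt_le_trans tt r4r1).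
  by case=> /= + _; apply.
have aPhi4 : ajet (cube z0 r4) Phi by apply: bjet_ajet => //; exact: open_cube.
have partialphi i : partial i (phi^~ t) a = Phi [:: space i] z0.
  have aS := ajet_slice (aPhi4 : ajet (cube (spacetime a t) r4) Phi) tt.
  rewrite /partial -[RHS]/(slice t Phi [:: i] a).
  have [_ /= <-] := aS.1 [::] i a aat.
  apply: near_eq_derive; apply: filterS (cube_nbhs a r40) => x ax.
  by rewrite /slice PhiE ?(lt_le_trans tt)//; exact: cube_sub ax.
have [k Phik] : exists k, Phi [:: space k] z0 != 0.
  apply: contrapT => H; move/eqP: gphi; apply; apply/rowP => i; rewrite !mxE partialphi.
  by apply/eqP; apply: contrapT => /negP Hi; apply: H; exists i.
have sumPhi : 0 < \sum_i Phi [:: space i] z0 ^+ 2.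
  rewrite (bigD1 k)//= ltr_wpDr ?sumr_ge0// => [i _|]; first exact: sqr_ge0.
  by rewrite exprn_even_gt0.
have [r5 [W [r50 r5sub bW lapW dataW]]] := cauchy_kovalevskaya_laplace
  (@open_cube _ _ z0 r4) (cube_center z0 r40) bPhi4 (bjet_halfsq z0 r40) Phi0 sumPhi.
have [r6 [r60 r6sub Hr6]] := @ajet_near _ _ (cube z0 r4) Phi [:: space k] z0
  (`|Phi [:: space k] z0| / 2) aPhi4 (cube_center z0 r40)
  (ltac:(by rewrite divr_gt0// normr_gt0)).
have Phik_near z : cube z0 r6 z -> Phi [:: space k] z != 0.
  move=> /Hr6; apply: contraTneq => ->; rewrite sub0r normrN -ltNge.
  by rewrite ltr_pdivrMr// mulr_natr mulr2n ltrDl normr_gt0.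
pose r7 := Num.min r4 (Num.min r5 r6).
have r70 : 0 < r7 by rewrite lt_min r40/= lt_min r50.
have r7r4 : r7 <= r4 by rewrite ge_min lexx.
have r7r5 : r7 <= r5 by rewrite ge_min [X in _ || X]ge_min lexx orbT.
have r7r6 : r7 <= r6 by rewrite ge_min [X in _ || X]ge_min lexx !orbT.
have oc7 : open (cube z0 r7) by exact: open_cube.
have aPhi : ajet (cube z0 r7) Phi by apply: ajet_sub aPhi4 => //; exact: cube_sub.
have aW : ajet (cube z0 r7) W.
  by apply: bjet_ajet => //; apply: bjet_sub bW; exact: cube_sub.
have GP x s : cube a r7 x -> `|s - t| < r7 -> Gamma s x <-> Phi [::] (spacetime x s) = 0.
  move=> ax st; have ax4 := cube_sub r7r4 ax; have st4 := lt_le_trans st r7r4.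
  rewrite PhiE; first by apply: Hr1; [exact: cube_sub ax4|exact: lt_le_trans st4 _].
    exact: cube_sub ax4.
  exact: lt_le_trans st4 _.
have GW x s : cube a r7 x -> `|s - t| < r7 -> Gamma s x ->
    W [::] (spacetime x s) = 2^-1 * enorm x ^+ 2 /\
    forall j, W [:: space j] (spacetime x s) = x 0 j.
  move=> ax st /(GP x s ax st) P0.
  have [] := dataW (spacetime x s) _ P0.
    by apply: cube_spacetime; [exact: cube_sub ax|exact: lt_le_trans st _].
  move=> -> H; split=> [|j]; first exact: halfsq_jet0.
  by rewrite H halfsq_jet_space.
(* the moving hypersurface stays within reach of [a] for nearby times *)
have [r8 [r80 r8r7 Hr8]] : exists r8 : R, [/\ 0 < r8, r8 <= r7 & forall s, `|s - t| < r8 ->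
    exists2 p, cube a r7 p & Phi [::] (spacetime p s) = 0].
  have [lam [lam0 dlam Hlam]] := @implicit_curve _ _ (cube z0 r7) Phi [::] z0 time
    (space k) oc7 aPhi (cube_center z0 r70) Phi0 Phik.
  have dg := is_derive_graph z0 time (space k) dlam.
  set gam := (fun h : R => _ + _) in dg.
  have g0 : gam 0 = z0 by rewrite /gam lam0 !scale0r !add0r.
  have gnear : \forall h \near (0 : R), cube z0 r7 (gam h).
    by apply: (is_derive1_continuous dg); rewrite g0; exact: cube_nbhs.
  have HH : nbhs (0 : R) [set h | Phi [::] (gam h) = 0 /\ cube z0 r7 (gam h)].
    exact: filterI Hlam gnear.
  have /nbhs_ballP[d /= d0 Hd] := HH.
  exists (Num.min d r7); split; [by rewrite lt_min d0|by rewrite ge_min lexx orbT|].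
  move=> s; rewrite lt_min => /andP[sd _].
  have [] := Hd (s - t); first by rewrite /ball/= sub0r normrN.
  rewrite /gam z0E -spacetime_move -spacetime_wait subrK => P0 inc.
  exists (lam (s - t) *: delta_mx 0 k + a) => // i.
  by have := inc (space i); rewrite !spacetime_coordl.
have sub8 : cube z0 r8 `<=` cube z0 r7 by exact: cube_sub.
exists r8, k, Phi, W; split=> //.
- by apply: ajet_sub aPhi => //; exact: open_cube.
- by apply: ajet_sub aW => //; exact: open_cube.
- by move=> z /sub8/(cube_sub r7r6); exact: Phik_near.
- by move=> x s ax st; apply: GP; [exact: cube_sub ax|exact: lt_le_trans st _].
- by move=> s st; apply: Hr3; rewrite (lt_le_trans st)// (le_trans r8r7)// (le_trans r7r4).
- by move=> z /sub8/(cube_sub r7r5); exact: lapW.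
- move=> x s j ax st Gx.
  by have [_ ->] := GW x s (cube_sub r8r7 ax) (lt_le_trans st r8r7) Gx.
- move=> x s ax st Gx.
  by have [-> _] := GW x s (cube_sub r8r7 ax) (lt_le_trans st r8r7) Gx.
- move=> x s ax st.
  have st7 := lt_le_trans st r8r7.
  have Ts : T s by apply: Hr3; rewrite (lt_le_trans st7)// (le_trans r7r4).
  have [_ an lap val gr] := schwarz_w Ts.
  have NU y : cube a r7 y -> N (y, s).
    move=> ay; apply: Hr2; last by rewrite (lt_le_trans st7)// (le_trans r7r4).
    by apply: cube_sub ay; rewrite (le_trans r7r4).
  have aw : ajet (cube a r7) (fun l => partials l (w^~ s)).
    by apply: analytic_ajet; [exact: open_cube|move=> y /NU; exact: an].
  have aWs : ajet (cube a r7) (slice s W).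
    exact: (ajet_slice (aW : ajet (cube (spacetime a t) r7) W)).
  have aPs : ajet (cube a r7) (slice s Phi).
    exact: (ajet_slice (aPhi : ajet (cube (spacetime a t) r7) Phi)).
  have aD := ajet_lin 1 (-1) (@open_cube _ _ a r7) aw aWs.
  have [p ap Pp] := Hr8 s st.
  have inz y : cube a r7 y -> cube z0 r7 (spacetime y s) by move=> ay; exact: cube_spacetime.
  have := @cauchy_uniqueness _ _ a p x r7 (slice s Phi) _ k aPs aD _ _ _ ap Pp
    (cube_sub r8r7 ax) [::].
  rewrite /= mul1r mulN1r => H; apply/eqP; rewrite -subr_eq0; apply/eqP; apply: H.
  + by move=> y /inz/(cube_sub r7r6); exact: Phik_near.
  + move=> y ay; rewrite /jetlap/=.
    under eq_bigr do rewrite mul1r mulN1r; rewrite sumrB.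
    have -> : \sum_i partial i (partial i (w^~ s)) y = 0 by exact: (lap y (NU y ay)).
    have -> : \sum_i slice s W [:: i; i] y = jetlap space W (spacetime y s) by [].
    by rewrite lapW ?subrr//; apply: cube_sub r7r5 _ _; exact: inz.
  + move=> y ay P0; have Gy : Gamma s y by apply/(GP y s ay st7).
    have [W0 Wj] := GW y s ay st7 Gy.
    split=> [|j] /=.
      by rewrite /slice W0 (val y Gy) mul1r mulN1r subrr.
    rewrite /slice Wj mul1r mulN1r.
    have := gr y Gy; move/rowP/(_ j); rewrite mxE => ->; exact: subrr.
Qed.
End LocalPotential.

(** * Velocity of the moving boundary *)

Section ChartGeometry.
Variables (R : realType) (n : nat).
Notation time := (rshift n ord0 : 'I_(n + 1)).
Notation space := (@lshift n 1).
Variables (T : set R) (Omega : R -> set 'rV[R]_n) (w : 'rV[R]_n -> R -> R).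
Let Gamma s := boundary (Omega s).
Variables (a : 'rV[R]_n) (t r : R) (k : 'I_n).
Variables (Phi W : seq 'I_(n + 1) -> 'rV[R]_(n + 1) -> R).
Hypothesis chart : local_chart T Omega w a t r k Phi W.
Let box := cube (spacetime a t) r.

Lemma box_split z : box z -> exists x s, [/\ z = spacetime x s, cube a r x & `|s - t| < r].
Proof.
move=> bz; exists (lsubmx z), (rsubmx z 0 0); split.
- apply/rowP => j; case: (split_ordP j) => i ->.
    by rewrite spacetime_coordl mxE.
  by rewrite spacetime_coordr mxE ord1.
- by move=> i; have := bz (space i); rewrite spacetime_coordl mxE.
- by have := bz time; rewrite spacetime_coordr mxE.
Qed.

Let r0 : 0 < r := chart_gt0 chart.
Let obox : open box. Proof. exact: open_cube. Qed.

Variables (x : 'rV[R]_n) (s : R).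
Hypotheses (ax : cube a r x) (st : `|s - t| < r) (Gx : Gamma s x).
Let z := spacetime x s.
Let bz : box z. Proof. exact: cube_spacetime. Qed.
Let Pz : Phi [::] z = 0. Proof. exact/(chart_Gamma chart). Qed.
Let Pk : Phi [:: space k] z != 0. Proof. exact: (chart_k chart). Qed.

(** [W - |x|^2 / 2] vanishes together with its [x_k]-derivative on the moving
    boundary, hence with all its first derivatives in space-time. *)
Lemma chart_time_vanish : W [:: time] z = 0.
Proof.
have bH := bjet_ajet obox (bjet_halfsq (spacetime a t) r0).
have aG := ajet_lin 1 (-1) obox (chart_W chart) bH.
have := @gradient_parallel _ _ box Phi [::] _ [::] z time (space k) obox
  (chart_Phi chart) aG bz Pz Pk _.
rewrite /= !mul1r !mulN1r halfsq_jet_time halfsq_jet_space subr0 => ->.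
  by rewrite (chart_grad chart)// subrr mul0r.
move=> y /box_split[x' [s' [-> ax' st']]] /(chart_Gamma chart ax' st') G'.
by rewrite !mul1r mulN1r halfsq_jet0 (chart_val chart)// subrr.
Qed.

(** [x - grad w] vanishes on the moving hypersurface, so that its space-time
    gradient is [g (x) d Phi]; symmetry of the Hessian and the trace, which is
    [n] because [w] is harmonic, determine [g]. *)
Lemma chart_mixed i :
  (\sum_j Phi [:: space j] z ^+ 2) * W [:: space i; time] z =
  - n%:R * Phi [:: time] z * Phi [:: space i] z.
Proof.
pose G i : seq 'I_(n + 1) -> 'rV[R]_(n + 1) -> R := fun l y =>
  1 * coord_jet (space i) l y + -1 * djet (space i) W l y.
have aG j : ajet box (G j).
  apply: ajet_lin => //; first by apply: bjet_ajet => //; exact: bjet_coord.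
  exact: ajet_djet (chart_W chart).
have par j l : G j [:: l] z = G j [:: space k] z * (Phi [:: l] z / Phi [:: space k] z).
  apply: (@gradient_parallel _ _ box Phi [::] (G j) [::] z l (space k) obox
    (chart_Phi chart) (aG j) bz Pz Pk) => y /box_split[x' [s' [-> ax' st']]].
  move=> /(chart_Gamma chart ax' st') G'.
  by rewrite /G /= /djet spacetime_coordl (chart_grad chart)// mul1r mulN1r subrr.
have GE j l : G j [:: space l] z = (j == l)%:R - W [:: space j; space l] z.
  by rewrite /G /= /djet mul1r mulN1r (inj_eq (@lshift_inj _ _)).
have sym j l : G j [:: space l] z = G l [:: space j] z.
  rewrite !GE eq_sym; congr (_ - _).
  exact: (@ajet_symmetric _ _ box W [::] z (space j) (space l) (chart_W chart)).
set nu := fun j => Phi [:: space j] z; set kap := G k [:: space k] z / nu k ^+ 2.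
have nuk : nu k != 0 by [].
have g j : G j [:: space k] z = kap * nu k * nu j.
  by rewrite sym par /kap -/(nu _) -/(nu _); field.
have trace : n%:R = kap * \sum_j nu j ^+ 2.
  have : \sum_j G j [:: space j] z = n%:R.
    under eq_bigr do rewrite GE eqxx.
    rewrite sumrB sumr_const card_ord.
    have := chart_lap chart bz; rewrite /jetlap => ->.
    by rewrite subr0.
  move=> <-; rewrite mulr_sumr; apply: eq_bigr => j _.
  by rewrite par g -/(nu j) -/(nu k); field.
have Gt : G i [:: time] z = - W [:: space i; time] z.
  by rewrite /G /= /djet eq_lrshift mul1r mulN1r add0r.
have : W [:: space i; time] z = - (kap * nu i * Phi [:: time] z).
  by rewrite -[LHS]opprK -Gt par g -/(nu k); congr (- _); field.
move=> ->; rewrite trace -/(nu i); ring.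
Qed.

Definition chart_normal : 'rV[R]_n := \row_i Phi [:: space i] z.

Lemma sum_spacetime (f : 'I_(n + 1) -> R) (v : 'rV[R]_n) :
  \sum_j f j * spacetime v 1 0 j = \sum_i f (space i) * v 0 i + f time.
Proof.
rewrite big_split_ord/= big_ord1 spacetime_coordr mulr1; congr (_ + _).
by apply: eq_bigr => i _; rewrite spacetime_coordl.
Qed.

Lemma chart_moving_curve (c : R -> 'rV[R]_n) (v : 'rV[R]_n) :
  c s = x -> is_derive s (1 : R) c v -> (\forall u \near s, Gamma u (c u)) ->
  dot v chart_normal = - Phi [:: time] z.
Proof.
move=> cs dc Gc; have dz := is_derive_spacetime dc.
have bs : box (spacetime (c s) s) by rewrite cs.
have D := @ajet_chain _ _ box Phi [::] (fun u => spacetime (c u) u) _ s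
  (chart_Phi chart) bs dz.
have near_box : \forall u \near s, box (spacetime (c u) u).
  by apply: (is_derive1_continuous dz); exact: open_nbhs_nbhs.
have Z : \forall u \near s, Phi [::] (spacetime (c u) u) = cst 0 u.
  near=> u; have bu : box (spacetime (c u) u) by near: u.
  have [y [u' [E ay tu]]] := box_split bu.
  have Eu : u = u' by rewrite -(spacetime_coordr (c u) u ord0) E spacetime_coordr.
  have Ey : c u = y.
    by apply/rowP => j; rewrite -(spacetime_coordl (c u) u j) E spacetime_coordl.
  rewrite Ey; apply/(chart_Gamma chart); rewrite ?Eu// -Ey -Eu.
  by near: u.
have [_ E] := near_eq_is_derive Z D.
move: E; rewrite derive_cst sum_spacetime cs -/z => /esym/eqP.
rewrite addr_eq0 => /eqP <-; rewrite /dot; apply: eq_bigr => i _.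
by rewrite mxE mulrC.
Unshelve. all: by end_near. Qed.

Lemma chart_normal_at : normal_at (Gamma s) x chart_normal.
Proof.
move=> tau [c [c0 dc Gc]].
have aS := ajet_slice (chart_Phi chart) st.
have c0U : cube a r (c 0) by rewrite c0.
have D := ajet_chain [::] aS c0U dc.
have near_c : \forall u \near (0 : R), cube a r (c u).
  apply: (is_derive1_continuous dc); apply: open_nbhs_nbhs; split=> //.
  exact: open_cube.
have Z : \forall u \near (0 : R), slice s Phi [::] (c u) = cst 0 u.
  near=> u; apply/(chart_Gamma chart) => //; near: u; first exact: near_c.
  exact: Gc.
have [_ E] := near_eq_is_derive Z D.
move: E; rewrite derive_cst c0 => E; rewrite /dot [RHS]E.
by apply: eq_bigr => i _; rewrite mxE.
Unshelve. all: by end_near. Qed.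

(** The tangent space is large enough to determine the normal line: for each
    [i] it contains a vector in the plane of the directions [i] and [k]. *)
Lemma normal_at_parallel v : normal_at (Gamma s) x v ->
  forall i, v 0 i = v 0 k / Phi [:: space k] z * Phi [:: space i] z.
Proof.
move=> nv i; have aS := ajet_slice (chart_Phi chart) st.
have oU : open (cube a r) by exact: open_cube.
have [lam [lam0 dlam Hlam]] := @implicit_curve _ _ (cube a r) (slice s Phi) [::] x i k
  oU aS ax Pz Pk.
have dg := is_derive_graph x i k dlam.
set gam := (fun h : R => _ + _) in dg.
have g0 : gam 0 = x by rewrite /gam lam0 !scale0r !add0r.
have near_g : \forall u \near (0 : R), cube a r (gam u).
  apply: (is_derive1_continuous dg); apply: open_nbhs_nbhs; split=> //.
  by rewrite g0.
have := nv (delta_mx 0 i + - slice s Phi (rcons [::] i) x /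
  slice s Phi (rcons [::] k) x *: delta_mx 0 k).
rewrite /dot sum_delta2 => H.
have : v 0 i + - Phi [:: space i] z / Phi [:: space k] z * v 0 k = 0.
  apply: H; exists gam; split=> //.
  near=> u; apply/(chart_Gamma chart) => //; near: u; [exact: near_g|exact: Hlam].
move/eqP; rewrite addr_eq0 => /eqP ->; field; exact: Pk.
Unshelve. all: by end_near. Qed.

(** Without such a curve the condition that defines the normal velocity would
    be void. *)
Lemma moving_curve_exists : exists c : R -> 'rV[R]_n,
  exists v, [/\ c s = x, is_derive s (1 : R) c v & \forall u \near s, Gamma u (c u)].
Proof.
have [lam [lam0 dlam Hlam]] := @implicit_curve _ _ box Phi [::] z time (space k)
  obox (chart_Phi chart) bz Pz Pk.
set l := _ / _ in dlam.
pose g h := lam h *: delta_mx 0 k + x : 'rV[R]_n.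
have dg0 : is_derive (0 : R) (1 : R) g (l *: delta_mx 0 k).
  have := is_derive_graph x k k dlam; rewrite -/l => D.
  have D2 := is_derive_affine (delta_mx 0 k : 'rV[R]_n) 0 (0 : R).
  have D3 := is_deriveB D D2.
  have -> : g = (fun h => h *: delta_mx 0 k + (lam h *: delta_mx 0 k + x)) -
      (fun h : R => h *: delta_mx 0 k + 0).
    apply/funext => h.
    rewrite -[RHS]/(h *: delta_mx 0 k + (lam h *: delta_mx 0 k + x)
      - (h *: delta_mx 0 k + 0)).
    by rewrite [h *: _ + 0]addr0 addrAC subrr add0r.
  by apply: is_derive_eq D3 _; rewrite addrAC subrr add0r.
pose c u := g (u - s).
have dc : is_derive s (1 : R) c (l *: delta_mx 0 k).
  move: dg0 => /is_derive_epsP H; apply/is_derive_epsP => e /H[d d0 Hd].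
  by exists d => // h /Hd; rewrite /c addr0 subrr addrK.
have c_s : c s = x by rewrite /c /g subrr lam0 scale0r add0r.
exists c, (l *: delta_mx 0 k); split=> //.
have near_c : \forall u \near s, cube a r (c u).
  apply: (is_derive1_continuous dc); apply: open_nbhs_nbhs; split; last by rewrite c_s.
  exact: open_cube.
have near_t : \forall u \near s, `|u - t| < r.
  have : (fun u : R => `|u - t|) @ s --> `|s - t|.
    by apply: cvg_norm; apply: cvgB; [exact: cvg_id|exact: cvg_cst].
  by move=> /cvgr_lt; apply.
have near_P : \forall u \near s, Phi [::] (spacetime (c u) u) = 0.
  move: Hlam => /nbhs_ballP[d /= d0 Hd]; apply/nbhs_ballP; exists d => //= u.
  rewrite /ball/= => su; have := Hd (u - s).
  rewrite /ball/= sub0r normrN distrC => /(_ su).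
  by rewrite /z -spacetime_move -spacetime_wait subrK.
near=> u; apply/(chart_Gamma chart); [| |].
- by near: u.
- by near: u.
- by near: u.
Unshelve. all: by end_near. Qed.

(** A point that stays on the boundary has [v . grad Phi = - d Phi / dt]
    whatever its tangential motion. *)
Lemma normal_velocityE v : normal_velocity Gamma s x v <->
  forall i, (\sum_j Phi [:: space j] z ^+ 2) * v 0 i =
    - Phi [:: time] z * Phi [:: space i] z.
Proof.
set S := \sum_j _.
have S0 : S != 0.
  rewrite gt_eqF// /S (bigD1 k)//= ltr_wpDr ?exprn_even_gt0//.
  by apply: sumr_ge0 => j _; exact: sqr_ge0.
split=> [[nv H] i|H].
  have [c [c' [cs dc Gc]]] := moving_curve_exists.
  have := H c c' cs dc Gc _ chart_normal_at.
  have -> : dot (c' - v) chart_normal = dot c' chart_normal - dot v chart_normal.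
    by rewrite /dot -sumrB; apply: eq_bigr => j _; rewrite !mxE mulrBl.
  rewrite (chart_moving_curve cs dc Gc).
  have -> : dot v chart_normal = v 0 k / Phi [:: space k] z * S.
    rewrite /dot mulr_sumr; apply: eq_bigr => j _; rewrite mxE (normal_at_parallel nv j).
    by rewrite expr2 mulrA.
  move/eqP; rewrite subr_eq0 => /eqP E.
  by rewrite (normal_at_parallel nv i) E; ring.
have vE i : v 0 i = - Phi [:: time] z / S * Phi [:: space i] z.
  apply: (mulfI S0); rewrite H; field; exact: S0.
have vS : dot v chart_normal = - Phi [:: time] z.
  rewrite /dot; transitivity (\sum_j - Phi [:: time] z / S * Phi [:: space j] z ^+ 2).
    by apply: eq_bigr => j _; rewrite vE mxE expr2 mulrA.
  by rewrite -mulr_sumr -/S divfK.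
split.
  move=> tau /chart_normal_at N0.
  transitivity (- Phi [:: time] z / S * dot chart_normal tau).
    by rewrite /dot mulr_sumr; apply: eq_bigr => j _; rewrite vE mxE mulrA.
  by rewrite N0 mulr0.
move=> c c' cs dc Gc nu /normal_at_parallel nuE.
transitivity (nu 0 k / Phi [:: space k] z * (dot c' chart_normal - dot v chart_normal)).
  rewrite /dot -sumrB mulr_sumr; apply: eq_bigr => j _.
  by rewrite nuE !mxE; ring.
by rewrite (chart_moving_curve cs dc Gc) vS subrr mulr0.
Qed.
End ChartGeometry.

(** * Harmonic functions and the pressure *)

Section Harmonic.
Variables (R : realType) (n : nat).

Lemma near_open (U : set 'rV[R]_n) x (P : 'rV[R]_n -> Prop) : open U -> U x ->
  (forall y, U y -> P y) -> \forall y \near x, P y.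
Proof. by move=> oU Ux H; apply: filterS (open_nbhs_nbhs (conj oU Ux)). Qed.

Lemma open_punctured (U : set 'rV[R]_n) x : open U -> open (U `\ x).
Proof.
move=> oU; rewrite setDE; apply: openI => //; apply: closed_openC.
by apply: accessible_closed_set1; apply: hausdorff_accessible; exact: norm_hausdorff.
Qed.

Lemma for_continuous_near (x : 'rV[R]_n) (f g : 'rV[R]_n -> R) :
  (\forall y \near x, f y = g y) -> {for x, continuous f} -> {for x, continuous g}.
Proof.
move=> fg cf; rewrite /prop_for /continuous_at -(nbhs_singleton fg).
have cf' : f @ x --> f x by exact: cf.
apply: (cvg_trans _ cf'); apply: (@near_eq_cvg _ _ (nbhs x) _ f g); exact: fg.
Qed.

Lemma harmonic_on_scale (U : set 'rV[R]_n) (f : 'rV[R]_n -> R) (c : R) :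
  open U -> harmonic_on U f -> harmonic_on U (fun x => c * f x).
Proof.
move=> oU [C2 lap].
have d1 x i : U x -> c * partial i f x = partial i (fun x => c * f x) x.
  move=> Ux; have [df _ _] := C2 x Ux i.
  by rewrite /partial; have [_ ->] := is_deriveZ c (derivableP df).
have d2 x i j : U x ->
    is_derive x (delta_mx 0 j) (partial i (fun x => c * f x)) (c * partial j (partial i f) x).
  move=> Ux; have [_ _ /(_ j)[ddf _]] := C2 x Ux i.
  apply: near_eq_is_derive (is_deriveZ c (derivableP ddf)).
  exact: (near_open oU Ux (fun y Uy => d1 y i Uy)).
split=> [x Ux i|x Ux].
  have [df cf ddf] := C2 x Ux i; split.
  - by case: (is_deriveZ c (derivableP df)).
  - apply: (@for_continuous_near _ (fun y => c * partial i f y)).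
      exact: (near_open oU Ux (fun y Uy => d1 y i Uy)).
    exact: (continuousM (@cst_continuous _ _ c x) cf).
  - move=> j; have [_ cddf] := ddf j; split; first by case: (d2 x i j Ux).
    apply: (@for_continuous_near _ (fun y => c * partial j (partial i f) y)).
      exact: (near_open oU Ux (fun y Uy => esym (@derive_val _ _ _ _ _ _ _ (d2 y i j Uy)))).
    exact: (continuousM (@cst_continuous _ _ c x) cddf).
transitivity (c * laplacian f x); last by rewrite lap// mulr0.
rewrite mulr_sumr; apply: eq_bigr => i _.
by rewrite [LHS]/partial; have [_ ->] := d2 x i i Ux.
Qed.

Lemma singular_like_scale (f : 'rV[R]_n -> R) x0 (c k : R) :
  singular_like f x0 c -> singular_like (fun x => k * f x) x0 (k * c).
Proof.
move=> /eqaddoP H; apply/eqaddoP => e e0; have := H e e0.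
apply: filterS => x; set K := fundamental_solution (x - x0) => le.
have {}le : `|f x - c * K| <= e * `|c * K| by exact: le.
suff : `|k * f x - k * c * K| <= e * `|k * c * K| by [].
have -> : k * f x - k * c * K = k * (f x - c * K) by ring.
by rewrite -mulrA !(normrM k) mulrCA; apply: ler_wpM2l.
Qed.

(** Harmonicity crosses the boundary by the identity theorem: the Laplacian of
    the analytic extension vanishes on the side of the domain. *)
Lemma harmonic_across_boundary (Omega : set 'rV[R]_n) (x0 a : 'rV[R]_n) f :
  open Omega -> Omega x0 -> boundary Omega a -> harmonic_on (Omega `\ x0) f ->
  analytic_at f a ->
  exists r F, [/\ 0 < r, ajet (cube a r) F, forall x, cube a r x -> F [::] x = f x &
    forall x, cube a r x -> jetlap id F x = 0].
Proof.
move=> oO Ox0 [cla nia] [_ lap] af.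
have nOa : ~ Omega a by move=> Oa; apply: nia; exact: open_nbhs_nbhs.
have [r [F [r0 bF Ff]]] := analytic_at_bjet af.
have oc : open (cube a r) by exact: open_cube.
have [d d0 dx0] : exists2 d, 0 < d & ~ cube a d x0.
  have [i ai] : exists i, x0 0 i != a 0 i.
    apply: contrapT => H; apply: nOa; have -> // : a = x0.
    apply/rowP => i; apply/eqP; apply: contrapT => /negP; rewrite eq_sym => ai.
    by apply: H; exists i.
  exists `|x0 0 i - a 0 i|; first by rewrite normr_gt0 subr_eq0.
  by move=> /(_ i); rewrite ltxx.
have rd0 : 0 < Num.min r d by rewrite lt_min r0.
have [q [Oq aq]] := cla _ (cube_nbhs a rd0).
have aqr : cube a r q by apply: cube_sub aq; rewrite ge_min lexx.
have qx0 : (Omega `\ x0) q.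
  split=> //= qx; apply: dx0; rewrite -qx.
  by apply: cube_sub aq; rewrite ge_min lexx orbT.
exists r, F; split=> //; first exact: bjet_ajet.
pose H : seq 'I_n -> 'rV[R]_n -> R := fun l x => \sum_i djet i (djet i F) l x.
have bH : bjet (cube a r) H by apply: bjet_sum => i; do 2!apply: bjet_djet.
have oV : open (cube a r `&` (Omega `\ x0)).
  by apply: openI => //; exact: open_punctured.
have H0 l x : (cube a r `&` (Omega `\ x0)) x -> H l x = 0.
  apply: (jet_vanish oV) => [|y [ay Oy]].
    by apply: jet_sub bH.1; exact: subIsetl.
  rewrite -(lap y Oy); apply: eq_bigr => i _.
  exact: (jet_partials oc bF.1 Ff [:: i; i] ay).
move=> x ax; apply: (@ajet_identity _ _ H a q x r _ aqr _ ax [::]).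
  exact: bjet_ajet.
by move=> l; exact: H0.
Qed.
End Harmonic.

(** * Laplacian growth and the time derivative of the potential *)

Section Growth.
Variables (R : realType) (n : nat).
Notation time := (rshift n ord0 : 'I_(n + 1)).
Notation space := (@lshift n 1).
Variables (T : set R) (Omega : R -> set 'rV[R]_n) (w P : 'rV[R]_n -> R -> R).
Let Gamma s := boundary (Omega s).
Variables (a : 'rV[R]_n) (t r : R) (k : 'I_n).
Variables (Phi W : seq 'I_(n + 1) -> 'rV[R]_(n + 1) -> R).
Hypothesis n_gt0 : (0 < n)%N.
Hypothesis chart : local_chart T Omega w a t r k Phi W.
Variables (rho : R) (F : seq 'I_n -> 'rV[R]_n -> R).
Hypotheses (rho0 : 0 < rho) (aF : ajet (cube a rho) F).
Hypothesis FP : forall x, cube a rho x -> F [::] x = P x t.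
Hypothesis Flap : forall x, cube a rho x -> jetlap id F x = 0.

Let tt : `|t - t| < r. Proof. by rewrite subrr normr0 (chart_gt0 chart). Qed.

Lemma chart_time_derive x : cube a r x ->
  is_derive t (1 : R) (w x) (W [:: time] (spacetime x t)).
Proof.
move=> ax; have bz := cube_spacetime ax tt.
have D : is_derive t (1 : R) (fun s => W [::] (spacetime x s)) (W [:: time] (spacetime x t)).
  have /is_derive_epsP H := (chart_W chart).1 [::] time _ bz.
  apply/is_derive_epsP => e /H[d d0 Hd]; exists d => // h /Hd.
  have -> : h *: (1 : R) = h by rewrite /GRing.scale/= mulr1.
  by rewrite -spacetime_wait.
apply: near_eq_is_derive D; apply/nbhs_ballP; exists r => /=; first exact: chart_gt0 chart.
by move=> s; rewrite /ball/= distrC => st; rewrite (chart_w chart).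
Qed.

Lemma gradP x : cube a rho x -> forall i, (- grad (P^~ t) x) 0 i = - F [:: i] x.
Proof.
move=> ax i; rewrite !mxE; congr (- _).
exact/esym/(jet_partials (@open_cube _ _ _ _) aF.1 FP [:: i] ax).
Qed.

(** Both the normal velocity and the gradient of [dw/dt] are multiples of the
    normal, with the same factor up to [n]. *)
Lemma growth_condition x : cube a r x -> cube a rho x -> Gamma t x ->
  normal_velocity Gamma t x (- grad (P^~ t) x) <->
  forall i, W [:: time; space i] (spacetime x t) = - n%:R * F [:: i] x.
Proof.
move=> ax arho Gx; have bz := cube_spacetime ax tt.
pose S := \sum_j Phi [:: space j] (spacetime x t) ^+ 2.
have S0 : S != 0.
  rewrite gt_eqF// /S (bigD1 k)//= ltr_wpDr ?exprn_even_gt0// ?(chart_k chart)//.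
  by apply: sumr_ge0 => j _; exact: sqr_ge0.
have n0 : (n%:R : R) != 0 by rewrite pnatr_eq0 -lt0n.
have mixed i : S * W [:: time; space i] (spacetime x t) =
    n%:R * (- Phi [:: time] (spacetime x t) * Phi [:: space i] (spacetime x t)).
  rewrite (@ajet_symmetric _ _ _ W [::] _ time (space i) (chart_W chart) bz).
  by rewrite (chart_mixed chart)//; ring.
rewrite (normal_velocityE chart ax tt Gx); split=> H i.
  by apply: (mulfI S0); rewrite mixed -H (gradP arho); rewrite -/S; ring.
apply: (mulfI n0); rewrite -mixed H (gradP arho) -/S; ring.
Qed.

(** [dw/dt] and [- n P] are harmonic near [a], vanish on the boundary and have
    the same gradient there. *)
Lemma growth_implies_time_derivative :
  (forall x, Gamma t x -> P x t = 0) ->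
  (forall x, Gamma t x -> normal_velocity Gamma t x (- grad (P^~ t) x)) -> Gamma t a ->
  \forall x \near a, is_derive t (1 : R) (w x) (- n%:R * P x t).
Proof.
move=> P0 LG Ga; pose d := Num.min r rho.
have r0 := chart_gt0 chart.
have d0 : 0 < d by rewrite lt_min r0.
have dr : d <= r by rewrite ge_min lexx.
have drho : d <= rho by rewrite ge_min lexx orbT.
have od : open (cube a d) by exact: open_cube.
have aW : ajet (cube a d) (slice t (djet time W)).
  apply: (@ajet_sub _ _ (cube a r)) => //; first exact: cube_sub.
  by apply: ajet_slice tt; exact: ajet_djet (chart_W chart).
have aF' : ajet (cube a d) F by apply: (ajet_sub od _ aF); exact: cube_sub.
have aPhi : ajet (cube a d) (slice t Phi).
  apply: (@ajet_sub _ _ (cube a r)) => //; first exact: cube_sub.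
  exact: ajet_slice (chart_Phi chart) tt.
have aD := ajet_lin 1 n%:R od aW aF'.
have ad : cube a d a by exact: cube_center.
have inz y : cube a d y -> cube (spacetime a t) r (spacetime y t).
  by move=> ay; apply: cube_spacetime => //; exact: cube_sub ay.
have Pa : slice t Phi [::] a = 0 by apply/(chart_Gamma chart) => //; exact: cube_center.
apply: filterS (cube_nbhs a d0) => x ax.
have axr := cube_sub dr ax.
have := @cauchy_uniqueness _ _ a a x d (slice t Phi) _ k aPhi aD _ _ _ ad Pa ax [::].
rewrite /= mul1r (FP (cube_sub drho ax)) => E.
have -> : - n%:R * P x t = W [:: time] (spacetime x t).
  apply/esym/eqP; rewrite mulNr -addr_eq0; apply/eqP; apply: E.
  - by move=> y ay; apply: (chart_k chart); exact: inz.
  - move=> y ay; rewrite /jetlap/= big_split/=.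
    rewrite -!mulr_sumr mul1r.
    have -> : \sum_i F [:: i; i] y = 0 by exact: (Flap (cube_sub drho ay)).
    rewrite mulr0 addr0.
    apply: (@jetlap_djet _ _ _ space (cube (spacetime a t) r) W time) => //.
    + exact: open_cube.
    + exact: chart_W chart.
    + exact: chart_lap chart.
    + exact: inz.
  - move=> y ay Py; have ayr := cube_sub dr ay; have ayrho := cube_sub drho ay.
    have Gy : Gamma t y by apply/(chart_Gamma chart).
    split=> [|j] /=.
      rewrite /slice/= /djet (chart_time_vanish chart)// FP// P0//.
      by rewrite !mulr0 addr0.
    have := (growth_condition ayr ayrho Gy).1 (LG y Gy) j.
    by rewrite /slice/= /djet => ->; ring.
exact: chart_time_derive.
Qed.

Lemma time_derivative_implies_growth : Gamma t a ->
  (\forall x \near a, is_derive t (1 : R) (w x) (- n%:R * P x t)) ->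
  normal_velocity Gamma t a (- grad (P^~ t) a).
Proof.
move=> Ga H; have r0 := chart_gt0 chart.
apply/growth_condition => //; [exact: cube_center|exact: cube_center|].
have [d d0 dH] := nbhs_cube H.
pose e := Num.min d (Num.min r rho).
have e0 : 0 < e by rewrite lt_min d0/= lt_min r0.
have ed : e <= d by rewrite ge_min lexx.
have er : e <= r by rewrite ge_min [X in _ || X]ge_min lexx orbT.
have erho : e <= rho by rewrite ge_min [X in _ || X]ge_min lexx !orbT.
have oe : open (cube a e) by exact: open_cube.
have aW : ajet (cube a r) (slice t (djet time W)).
  by apply: ajet_slice tt; exact: ajet_djet (chart_W chart).
move=> i.
pose G l x : R := - n%:R * F l x.
have jG : jet (cube a e) G.
  move=> l j x ax; apply: (is_deriveZ (- n%:R) (aF.1 l j x _)).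
  exact: cube_sub ax.
apply: (@jet_ext _ _ (cube a e) (slice t (djet time W)) [::] G [::] i a oe) => //.
- by apply: jet_sub aW.1; exact: cube_sub.
- move=> y ay; have [_ E1] := dH y (cube_sub ed ay).
  have [_ E2] := chart_time_derive (cube_sub er ay).
  rewrite /G FP; last exact: cube_sub ay.
  by rewrite -E1 E2.
- exact: cube_center.
Qed.
End Growth.

(* [T] is the time interval. [N] is the neighborhood of the moving boundary, in
   space-time, on which the family of Schwarz potentials is represented. Near
   the boundary [P] stands for its analytic extension across the boundary. *)
Theorem theorem2p1 (R : realType) (n : nat) (T : set R)
    (Omega : R -> set 'rV[R]_n) (x0 : 'rV[R]_n) (Q : R)
    (N : set ('rV[R]_n * R)) (w P : 'rV[R]_n -> R -> R)
    (n_ge2 : (2 <= n)%N)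
    (openT : open T) (itvT : is_interval T)
    (domainOmega : forall t, T t -> domain (Omega t))
    (Omega_x0 : forall t, T t -> Omega t x0)
    (analyticGamma :
       analytic_hypersurface_family T (fun t => boundary (Omega t)))
    (openN : open N)
    (schwarz_w : forall t, T t ->
       schwarz_potential (boundary (Omega t)) [set x | N (x, t)] (w^~ t))
    (pressureP : forall t, T t -> pressure (Omega t) x0 Q (P^~ t))
    (analyticP : forall t x, T t -> boundary (Omega t) x ->
       analytic_at (P^~ t) x) :
  (laplacian_growth T Omega P <->
   (forall t a, T t -> boundary (Omega t) a ->
      \forall x \near a, is_derive t (1 : R) (w x) (- n%:R * P x t)))
  /\
  (laplacian_growth T Omega P ->
   forall t, T t ->
   exists h : 'rV[R]_n -> R,
     [/\ harmonic_on (Omega t `\ x0) h,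
         forall a, boundary (Omega t) a ->
           \forall x \near a, Omega t x -> is_derive t (1 : R) (w x) (h x),
         forall x, (Omega t `\ x0) x -> h x = - n%:R * P x t &
         singular_like h x0 (n%:R * Q)]).
Proof.
have n_gt0 : (0 < n)%N by exact: ltnW.
have openOmega t : T t -> open (Omega t) by move=> /domainOmega[].
have main : laplacian_growth T Omega P <->
   (forall t a, T t -> boundary (Omega t) a ->
      \forall x \near a, is_derive t (1 : R) (w x) (- n%:R * P x t)).
  split=> H t a Tt Ga; have [harmP _ P0 _] := pressureP t Tt.
    have [r [k [Phi [W chart]]]] :=
      local_chart_exists openT openN analyticGamma schwarz_w Tt Ga.
    have [rho [F [rho0 aF FP Flap]]] := harmonic_across_boundary (openOmega t Tt)
      (Omega_x0 t Tt) Ga harmP (analyticP t a Tt Ga).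
    apply: (growth_implies_time_derivative n_gt0 chart rho0 aF FP Flap P0 _ Ga).
    by move=> x; exact: H.
  have [r [k [Phi [W chart]]]] :=
    local_chart_exists openT openN analyticGamma schwarz_w Tt Ga.
  have [rho [F [rho0 aF FP Flap]]] := harmonic_across_boundary (openOmega t Tt)
    (Omega_x0 t Tt) Ga harmP (analyticP t a Tt Ga).
  exact: (time_derivative_implies_growth n_gt0 chart rho0 aF FP Ga (H t a Tt Ga)).
split=> // LG t Tt; have [harmP _ _ singP] := pressureP t Tt.
exists (fun x => - n%:R * P x t); split.
- apply: harmonic_on_scale => //; apply: open_punctured; exact: openOmega.
- by move=> a Ga; apply: filterS (main.1 LG t a Tt Ga) => x.
- by [].
- by have := singular_like_scale (- n%:R) singP; rewrite mulrNN.
Qed.
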